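(* Let $n\ge2$ be an integer and $p\in[1,+\infty)$. Let $\mu$ be a finite Borel measure on $\mathbb{R}^n$ with density $e^{-V}$ with respect to Lebesgue measure, where $V:\mathbb{R}^n\to[0,+\infty)$ is a $p$-homogeneous convex function. Let $\alpha$ be the largest number such that $$\mu(\lambda K+(1-\lambda)L)^{\alpha}\ge\lambda\,\mu(K)^{\alpha}+(1-\lambda)\,\mu(L)^{\alpha}$$ holds for all convex bodies $K,L$ in $\mathbb{R}^n$ containing the origin and all $\lambda\in[0,1]$. Then $$\alpha\ge\frac1n\, e^{\frac{(p-1)n}{p}}\Big(\frac{(p-1)n}{p}\Big)^{\frac np}\Gamma\Big(1-\frac np,\frac{(p-1)n}{p}\Big),$$ where for $p=1$ the right-hand side is interpreted as its limit as $p\to1^+$, which equals $0$.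
   Context: A function $V:\mathbb{R}^n\to\mathbb{R}$ is $p$-homogeneous if $V(\lambda x)=\lambda^pV(x)$ for all $x\in\mathbb{R}^n$ and $\lambda>0$. A convex body in $\mathbb{R}^n$ is a compact convex set with nonempty interior; ''containing the origin'' means the origin is an element of the body (possibly on its boundary). $\lambda K+(1-\lambda)L=\{\lambda x+(1-\lambda)y: x\in K,\ y\in L\}$. $\Gamma(s,x)=\int_x^{+\infty}t^{s-1}e^{-t}\,dt$ ($s\in\mathbb{R}$, $x>0$) is the upper incomplete gamma function. The Brunn-Minkowski inequality with exponent $0$ is interpreted in the limiting sense, i.e. as $\mu(\lambda K+(1-\lambda)L)\ge\mu(K)^{\lambda}\mu(L)^{1-\lambda}$. *)

(* Defs.v *)
From HB Require Import structures.
From mathcomp Require Import all_boot all_order all_algebra.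
From mathcomp Require Import all_classical all_reals all_analysis.
From mathcomp Require Import measurable_realfun.

Set Implicit Arguments.
Unset Strict Implicit.
Unset Printing Implicit Defensive.

Import Order.TTheory GRing.Theory Num.Theory.
Import numFieldTopology.Exports numFieldNormedType.Exports.

Local Open Scope classical_set_scope.
Local Open Scope ring_scope.

Notation borel_rV R n := (g_sigma_algebraType (@open 'rV[R]_n)).

Lemma pushforward_sigma_additive d d' (T1 : measurableType d)
    (T2 : measurableType d') (R : realFieldType)
    (m : {measure set T1 -> \bar R}) (f : T1 -> T2) :
  measurable_fun [set: T1] f -> semi_sigma_additive (pushforward m f).
Proof.
move=> mf F mF tF mUF; rewrite /pushforward preimage_bigcup.
apply: measure_semi_sigma_additive.
- by move=> n; rewrite -[X in measurable X]setTI; exact: mf.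
- apply/trivIsetP => /= i j _ _ ij; rewrite -preimage_setI.
  by move/trivIsetP : tF => /(_ _ _ _ _ ij) ->//; rewrite preimage_set0.
- by rewrite -preimage_bigcup -[X in measurable X]setTI; exact: mf.
Qed.

(* Lebesgue measure on R^n: the n-fold product of [lebesgue_measure] is built by
   recursion on n.-tuples, then transported to row vectors. *)
Section lebesgue_tuple.
Context {R : realType}.
Local Notation T := (measurableTypeR R).

Definition cons_tup n (xt : T * n.-tuple T) : n.+1.-tuple T :=
  [the n.+1.-tuple T of xt.1 :: xt.2].

Lemma measurable_cons_tup n :
  measurable_fun [set: T * n.-tuple T] (@cons_tup n).
Proof. exact: measurable_cons. Qed.

Definition uncons_tup n (t : n.+1.-tuple T) : T * n.-tuple T :=
  (tnth t ord0, [tuple of behead t]).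

Lemma measurable_uncons_tup n :
  measurable_fun [set: n.+1.-tuple T] (@uncons_tup n).
Proof.
by apply: measurable_fun_pair; [exact: measurable_tnth|exact: measurable_behead].
Qed.

Lemma cons_tupK n : cancel (@cons_tup n) (@uncons_tup n).
Proof. by move=> [x t]; congr pair; exact/val_inj. Qed.

Lemma uncons_tupK n : cancel (@uncons_tup n) (@cons_tup n).
Proof. by move=> t; rewrite [RHS]tuple_eta; exact/val_inj. Qed.

Section succ.
Variables (n : nat) (mu : {sigma_finite_measure set (n.-tuple T) -> \bar R}).

Definition leb_tup_succ : set (n.+1.-tuple T) -> \bar R :=
  pushforward (lebesgue_measure \x mu)%E (@cons_tup n).

Let nu0 : leb_tup_succ set0 = 0%E.
Proof. by rewrite /leb_tup_succ /pushforward preimage_set0 measure0. Qed.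

Let nu_ge0 A : (0 <= leb_tup_succ A)%E.
Proof. exact: (measure_ge0 (lebesgue_measure \x mu)%E). Qed.

Let nu_sigma_additive : semi_sigma_additive leb_tup_succ.
Proof.
apply: (@pushforward_sigma_additive _ _ _ _ _ (lebesgue_measure \x mu)%E).
exact: measurable_cons_tup.
Qed.

HB.instance Definition _ :=
  isMeasure.Build _ _ _ leb_tup_succ nu0 nu_ge0 nu_sigma_additive.

Let nu_sigma_finite : sigma_finite [set: n.+1.-tuple T] leb_tup_succ.
Proof.
have [F [TF Foo]] : exists F : (set (T * n.-tuple T))^nat,
    [set: T * n.-tuple T] = \bigcup_k F k /\
    forall k, measurable (F k) /\ ((lebesgue_measure \x mu) (F k) < +oo)%E.
  have /sigma_finiteP[G [TG ndG Goo]] := sigma_finiteT (@lebesgue_measure R).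
  have /sigma_finiteP[H [TH ndH Hoo]] := sigma_finiteT mu.
  exists (fun k => G k `*` H k); split.
    rewrite -setXTT TG TH predeqE => -[x y]; split.
      move=> [/= [k _ Gkx] [l _ Hly]]; exists (maxn k l) => //; split.
      - by move: x Gkx; exact/subsetPset/ndG/leq_maxl.
      - by move: y Hly; exact/subsetPset/ndH/leq_maxr.
    by move=> [k _ []/= ? ?]; split; exists k.
  move=> k; have [? ?] := Goo k; have [? ?] := Hoo k.
  split; first exact: measurableX.
  by rewrite product_measure1E// lte_mul_pinfty// ge0_fin_numE.
exists (fun k => @uncons_tup n @^-1` F k).
  by rewrite -preimage_bigcup -TF preimage_setT.
move=> k; have [mF Fk] := Foo k; split.
  by rewrite -[X in measurable X]setTI; exact: measurable_uncons_tup.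
rewrite /leb_tup_succ /pushforward /= -comp_preimage.
rewrite (_ : _ \o _ = id) ?preimage_id//.
by apply/funext => x /=; rewrite cons_tupK.
Qed.

HB.instance Definition _ :=
  Measure_isSigmaFinite.Build _ _ _ leb_tup_succ nu_sigma_finite.

End succ.

Fixpoint leb_tup n : {sigma_finite_measure set (n.-tuple T) -> \bar R} :=
  if n is m.+1 then leb_tup_succ (leb_tup m) else \d_([tuple] : 0.-tuple T).

End lebesgue_tuple.

Section lebesgue_rV.
Context {R : realType} (n : nat).
Local Notation T := (measurableTypeR R).

Definition rV_of_tuple (t : n.-tuple T) : borel_rV R n := \row_i tnth t i.

Lemma open_rV_bigcup_rat (U : set 'rV[R]_n) : open U ->
  U = \bigcup_(qk : 'rV[rat]_n * nat)
        [set x : 'rV[R]_n | ball (map_mx ratr qk.1 : 'rV[R]_n) qk.2.+1%:R^-1 x /\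
           ball (map_mx ratr qk.1 : 'rV[R]_n) qk.2.+1%:R^-1 `<=` U].
Proof.
move=> oU; apply/seteqP; split => [x Ux|x [qk _ [/= xq]]]; last exact.
have /nbhs_ballP[_/posnumP[e] xeU] : nbhs x U by exact: open_nbhs_nbhs.
have [k ke] : exists k, k.+1%:R^-1 + k.+1%:R^-1 < e%:num :> R.
  have [k _ /(_ k (leqnn k))] := near_infty_natSinv_lt (e%:num / 2)%:pos.
  by move=> /= ke; exists k; rewrite [ltRHS]splitr ltrD.
have k0 : 0 < k.+1%:R^-1 :> R by rewrite invr_gt0.
have /choice[q xq] (i : 'I_n) :
    exists q : rat, ball (x ord0 i) k.+1%:R^-1 (ratr q).
  have := @dense_rat R (ball (x ord0 i) k.+1%:R^-1).
  case; [by exists (x ord0 i); exact: ballxx|exact: ball_open|].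
  by move=> y [xy [q _ qy]]; exists q; rewrite qy.
have bx : ball (map_mx ratr (\row_i q i) : 'rV[R]_n) k.+1%:R^-1 x.
  split=> // i j; rewrite !mxE ord1; exact/ball_sym/xq.
exists (\row_i q i, k) => //=; split=> // y yq.
apply: xeU; apply: (le_ball (ltW ke)).
exact: (ball_triangle (ball_sym bx) yq).
Qed.

Lemma measurable_rV_of_tuple :
  measurable_fun [set: n.-tuple T] rV_of_tuple.
Proof.
apply: (@measurability _ _ _ (borel_rV R n) _ _ (@open 'rV[R]_n)) =>
  [//|_ [U oU <-]].
rewrite setTI (open_rV_bigcup_rat oU) preimage_bigcup.
apply: countable_bigcupT_measurable => [|[q k]] /=; first exact: countableP.
have [qU|qU] := pselect (ball (map_mx ratr q : 'rV[R]_n) k.+1%:R^-1 `<=` U);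
  last by rewrite [X in measurable X](_ : _ = set0)// -subset0 => t [_ /qU].
rewrite [X in measurable X](_ : _ = \bigcap_(i in [set: 'I_n])
    (@tnth n T ^~ i) @^-1` ball (ratr (q ord0 i) : R) k.+1%:R^-1).
  apply: fin_bigcap_measurable => // i _.
  rewrite -[X in measurable X]setTI; apply: measurable_tnth => //.
  by apply: open_measurable; exact: ball_open.
apply/seteqP; split=> [t [[_ qt] _] i _|t qt] /=.
  by have := qt ord0 i; rewrite !mxE.
split=> //; split; first by rewrite invr_gt0.
by move=> i j; rewrite !mxE ord1; exact: qt.
Qed.

Definition lebesgue_rV : set (borel_rV R n) -> \bar R :=
  pushforward (leb_tup n) rV_of_tuple.

Let nu0 : lebesgue_rV set0 = 0%E.
Proof. by rewrite /lebesgue_rV /pushforward preimage_set0 measure0. Qed.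

Let nu_ge0 A : (0 <= lebesgue_rV A)%E.
Proof. exact: (measure_ge0 (leb_tup n)). Qed.

Let nu_sigma_additive : semi_sigma_additive lebesgue_rV.
Proof.
exact: (@pushforward_sigma_additive _ _ _ _ _ (leb_tup n) _
  measurable_rV_of_tuple).
Qed.

HB.instance Definition _ :=
  isMeasure.Build _ _ _ lebesgue_rV nu0 nu_ge0 nu_sigma_additive.

End lebesgue_rV.
Arguments lebesgue_rV R n : clear implicits.

Lemma leb_tup_box (R : realType) n (A : 'I_n -> set (measurableTypeR R)) :
  (forall i, measurable (A i)) ->
  leb_tup n [set t | forall i, A i (tnth t i)] =
  (\prod_(i < n) lebesgue_measure (A i))%E.
Proof.
elim: n A => [|n IH] A mA.
  by rewrite big_ord0 /= diracE mem_set// => -[].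
rewrite big_ord_recl -IH//= /leb_tup_succ /pushforward.
rewrite -product_measure1E//; last first.
  rewrite [X in measurable X](_ : _ = \bigcap_(i in [set: 'I_n])
      (@tnth n _ ^~ i) @^-1` A (lift ord0 i)).
    apply: fin_bigcap_measurable => // i _.
    by rewrite -[X in measurable X]setTI; apply: measurable_tnth.
  by apply/seteqP; split=> [t At i _|t At i]; exact: At.
congr (_ _); apply/seteqP; split=> [[x t] /= At|[x t] [/= A0 At] i].
  split=> [|i]; first exact: (At ord0).
  by have := At (lift ord0 i); rewrite tnthS.
by case: (unliftP ord0 i) => [j|] ->//; rewrite tnthS; exact: At.
Qed.

(* Lebesgue measure of a box; this formula determines [lebesgue_rV]. *)
Lemma lebesgue_rV_box (R : realType) n (A : 'I_n -> set (measurableTypeR R)) :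
  (forall i, measurable (A i)) ->
  lebesgue_rV R n [set v : 'rV[R]_n | forall i, A i (v ord0 i)] =
  (\prod_(i < n) lebesgue_measure (A i))%E.
Proof.
move=> mA; rewrite -leb_tup_box// /lebesgue_rV /pushforward; congr (_ _).
by apply/seteqP; split=> t At i; have := At i; rewrite /= mxE.
Qed.

Section brunn_minkowski.
Context {R : realType} {n : nat}.
Implicit Types (K L : set 'rV[R]_n) (V : 'rV[R]_n -> R).

Definition homogeneous (p : R) V :=
  forall (x : 'rV[R]_n) (l : R), 0 < l -> V (l *: x) = l `^ p * V x.

Definition convex_body K := [/\ compact K, convex_set K & K° !=set0].

Definition minkowski_comb (l : R) K L : set 'rV[R]_n :=
  [set l *: x + (1 - l) *: y | x in K & y in L].

(* For alpha = 0 the inequality is its limiting form, with a geometric mean.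
   No positivity of alpha is imposed: for the log-concave measures considered
   here 0 is admissible, so negative values play no role in a maximum. *)
Definition brunn_minkowski (mu : set (borel_rV R n) -> \bar R) (alpha : R) :=
  forall K L (l : R), convex_body K -> convex_body L -> K 0 -> L 0 ->
    0 <= l <= 1 ->
    if alpha == 0
    then (mu K `^ l * mu L `^ (1 - l)%R <= mu (minkowski_comb l K L))%E
    else (l%:E * mu K `^ alpha + (1 - l)%:E * mu L `^ alpha
          <= mu (minkowski_comb l K L) `^ alpha)%E.

End brunn_minkowski.

Definition upper_gamma {R : realType} (s x : R) : R :=
  \int[lebesgue_measure]_(t in `[x, +oo[) (t `^ (s - 1) * expR (- t)).

Definition bm_exponent {R : realType} (n : nat) (p : R) : R :=
  let c := (p - 1) * n%:R / p in
  n%:R^-1 * expR c * c `^ (n%:R / p) * upper_gamma (1 - n%:R / p) c.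

(* Main.v *)
From HB Require Import structures.
Require Import Defs.
From mathcomp Require Import all_boot all_order all_algebra.
From mathcomp Require Import all_classical all_reals all_analysis.
From mathcomp Require Import measurable_realfun ring lra.

Set Implicit Arguments.
Unset Strict Implicit.
Unset Printing Implicit Defensive.

Import Order.TTheory GRing.Theory Num.Theory.
Import numFieldTopology.Exports numFieldNormedType.Exports.

Local Open Scope classical_set_scope.
Local Open Scope ring_scope.

(** Where V is p-homogeneous and convex and p > 1, the weight exp(-V) behaves near x like a
    weight of effective dimension N(x) = n + V(x) p / (p - 1): moving x while rescaling it
    freely shows that V gains, on top of convexity, exactly what is needed for the power
    1 / N(x) of the weighted volume to be concave to second order. The exponent
    of the statement is the mean of 1 / N over the whole space, and the proof has three parts.

    The mean of 1 / N. With c = (p - 1) n / p, one has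
    exp(-V) / N = (exp(c) / n) int_c^oo exp(-t) exp(-t V / c) dt. By homogeneity
    exp(-t V / c) is exp(-V) composed with a dilation of ratio (t / c)^(1/p) >= 1, so its
    integral over a set K that is star-shaped about 0 is at least (t / c)^(-n/p) mu(K).
    Integrating in t shows that the mean of 1 / N over K is at least [bm_exponent n p]:
    this is [star_shaped_bound], where it matters that the bodies contain 0.

    The midpoint inequality. [midpoint_measure] says that for K, L star-shaped about 0,
    mu((K + L) / 2) >= sqrt (mu K mu L) (1 + (alpha / 8 - e) rho^2) with
    alpha = [bm_exponent n p] and rho = ln (mu L / mu K) small; the power mean of exponent
    alpha of mu K and mu L has the same expansion. It rests on [transport_rV], which is
    the change of variables along Knothe's triangular map T from K to L, with the
    Jacobian of (x + T x) / 2 bounded below through the diagonal entries of the derivative of T.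
    The transport is never built in dimension n: the integrand is a sum of a function of x
    and a function of T x, whose integrals do not depend on the coupling, and therefore
    Fubini's theorem reduces the inequality to the line ([transport_line]), where T is the
    monotone rearrangement. A sum is enough because of [pointwise_midpoint]: when V(x) and
    V(T x) differ by much more than rho the convexity gain alone is sufficient, and
    otherwise 1 / N varies by O(rho) between x and T x, which is absorbed by e.

    From local to global. The same transport gives log-concavity of t |-> mu(t K + (1 - t) L)
    ([log_concave_measure]), hence its continuity on the open interval. For 0 < beta < alpha
    the midpoint inequality makes its power beta midpoint-concave at small scales, hence
    concave ([power_concave_of_midpoint]). So every such beta is an admissible exponent,
    and a largest admissible exponent is at least alpha. When p = 1 the bound is the
    limit 0, and log-concavity is the required inequality. *)

(** * Elementary inequalities *)

Lemma prodr_pair_gt0 (R : realDomainType) (s : seq (R * R)) (f : R * R -> R) :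
  all (fun q => (0 < q.1) && (0 < q.2)) s ->
  (forall q, 0 < q.1 -> 0 < q.2 -> 0 < f q) -> 0 < \prod_(q <- s) f q.
Proof.
move=> s0 f0; rewrite big_seq; apply: prodr_gt0 => q qs.
by have /allP/(_ q qs)/andP[? ?] := s0; exact: f0.
Qed.

Section numeric.
Context {R : realType}.
Implicit Types (x y l u : R) (s : seq (R * R)).

(** Taylor's formula at order two, in the form of an upper bound: the remainder has
    nonnegative second derivative, so two applications of the mean value theorem give its
    sign on both sides of 0. *)
Lemma taylor2_le (f f1 f2 : R -> R) (r M : R) :
  (forall x, `|x| < r -> is_derive x 1 f (f1 x)) ->
  (forall x, `|x| < r -> is_derive x 1 f1 (f2 x)) ->
  (forall x, `|x| < r -> f2 x <= M) ->
  forall u, `|u| < r -> f u <= f 0 + f1 0 * u + M / 2 * u ^+ 2.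
Proof.
move=> df df1 f2M u ur.
pose g1 x := f1 0 + M * x - f1 x.
pose g x := f 0 + f1 0 * x + M / 2 * x ^+ 2 - f x.
have dg x : `|x| < r -> is_derive x 1 g (g1 x).
  move=> xr; have dfx := df _ xr.
  by apply: is_derive_eq; rewrite /g1 /GRing.scale/=; field.
have dg1 x : `|x| < r -> is_derive x 1 g1 (M - f2 x).
  move=> xr; have dfx := df1 _ xr.
  by apply: is_derive_eq; rewrite /GRing.scale/=; ring.
have mvt (h h' : R -> R) (v : R) : `|v| < r -> (forall x, `|x| < r -> is_derive x 1 h (h' x)) ->
    exists2 w, `|w| <= `|v| /\ 0 <= v * w & h v - h 0 = h' w * v.
  move=> vr dh.
  have [v0|v0] := leP 0 v.
    have [|| w] := @MVT_segment R h h' 0 v v0.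
    - move=> x; rewrite in_itv/= => /andP[x0 xv]; apply: dh.
      by rewrite gtr0_norm// (lt_trans xv)// -(ger0_norm v0).
    - apply: derivable_within_continuous => x; rewrite in_itv/= => /andP[x0 xv].
      have ? : is_derive x 1 h (h' x) by apply: dh; rewrite ger0_norm// (le_lt_trans xv)//
          -(ger0_norm v0).
      by [].
    rewrite in_itv/= => /andP[w0 wv]; rewrite subr0 => ->; exists w => //.
    by rewrite !ger0_norm// mulr_ge0.
  have [|| w] := @MVT_segment R h h' v 0 (ltW v0).
  - move=> x; rewrite in_itv/= => /andP[xv x0]; apply: dh.
    by rewrite ltr0_norm// (le_lt_trans _ vr)// ltr0_norm// lerN2 ltW.
  - apply: derivable_within_continuous => x; rewrite in_itv/= => /andP[xv x0].
    have ? : is_derive x 1 h (h' x).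
      by apply: dh; rewrite ler0_norm// (le_lt_trans _ vr)// ltr0_norm// lerN2.
    by [].
  rewrite in_itv/= => /andP[wv w0]; rewrite sub0r mulrN => /eqP; rewrite -eqr_opp opprB
      opprK => /eqP ->.
  exists w => //; split; last by rewrite mulr_le0// ltW.
  by rewrite ler0_norm// ltr0_norm// lerN2.
(* g is the remainder: it vanishes at 0 together with its derivative g1 *)
have [w [wu uw]] := mvt _ _ _ ur dg.
have wr : `|w| < r by exact: le_lt_trans ur.
have [v [vw _]] := mvt _ _ _ wr dg1.
have vr : `|v| < r by exact: le_lt_trans wr.
have M0 : 0 <= M - f2 v by rewrite subr_ge0 f2M.
rewrite {2}/g1 mulr0 addr0 subrr subr0 => ->.
rewrite {2}/g mulr0 expr0n/= mulr0 !addr0 subrr subr0 => gE.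
suff : 0 <= g u by rewrite /g subr_ge0.
by rewrite gE -mulrA mulr_ge0// mulrC.
Qed.

Lemma cosh_ge y : 2 + y ^+ 2 <= expR y + expR (- y).
Proof.
have := @taylor2_le (fun x => - (expR x + expR (- x))) (fun x => - (expR x - expR (- x)))
  (fun x => - (expR x + expR (- x))) (`|y| + 1) (- 2) _ _ _ y.
rewrite oppr0 expR0 ltrDl ltr01 => H.
suff : - (expR y + expR (- y)) <= - (1 + 1) + - (1 - 1) * y + - 2 / 2 * y ^+ 2 by lra.
apply: H => //.
- by move=> x _; apply: is_derive_eq; rewrite /GRing.scale/=; ring.
- by move=> x _; apply: is_derive_eq; rewrite /GRing.scale/=; ring.
move=> x _; rewrite lerN2 expRN.
have := expR_gt0 x; move: (expR x) => e e0.
have : 0 <= (e - 1) ^+ 2 / e by rewrite divr_ge0 ?sqr_ge0// ltW.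
rewrite (_ : _ / e = e + e^-1 - 2); last by field; rewrite gt_eqF.
by rewrite subr_ge0.
Qed.

Lemma amgm2 l x y : 0 <= l <= 1 -> 0 < x -> 0 < y ->
  x `^ l * y `^ (1 - l) <= l * x + (1 - l) * y.
Proof.
move=> /andP[l0 l1] x0 y0.
have : expR (l * ln x + (1 - l) * ln y) <= l * expR (ln x) + (1 - l) * expR (ln y).
  exact: (@convex_expR R (Itv01 l0 l1) (ln x) (ln y)).
rewrite !lnK ?posrE// => h.
by rewrite /powR !gt_eqF// -expRD.
Qed.

(** The Jacobian estimate behind log-concavity: no dimension survives in it. *)
Lemma prod_amgm l s : 0 <= l <= 1 -> all (fun q => (0 < q.1) && (0 < q.2)) s ->
  (\prod_(q <- s) q.2) `^ l * (\prod_(q <- s) q.1) `^ (1 - l) <=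
  \prod_(q <- s) (l * q.2 + (1 - l) * q.1).
Proof.
move=> l01; have /andP[l0 l1] := l01.
elim: s => [|q s IH]; first by rewrite !big_nil !powR1 mulr1.
move=> /= /andP[/andP[q1 q2] s0]; rewrite !big_cons.
have P1 : 0 < \prod_(q <- s) q.1 by exact: prodr_pair_gt0.
have P2 : 0 < \prod_(q <- s) q.2 by exact: prodr_pair_gt0.
rewrite !powRM ?(ltW q1) ?(ltW q2) ?(ltW P1) ?(ltW P2)//.
rewrite mulrACA; apply: ler_pM; rewrite ?mulr_ge0 ?powR_ge0//.
- exact: amgm2.
- exact: IH.
Qed.

(** A lower bound for the Jacobian of the midpoint map of a triangular transport. With q.1
    / q.2 the diagonal entries of its derivative, each factor is a geometric mean times the
    hyperbolic cosine of half of ln (q.2 / q.1), and the sum of the squared logarithms is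
    at least the square of their sum divided by the dimension. This carries the dimensional
    part n of N. *)
Lemma prod_half_ge s : all (fun q => (0 < q.1) && (0 < q.2)) s ->
  Num.sqrt (\prod_(q <- s) q.1 * \prod_(q <- s) q.2) *
  (1 + (ln (\prod_(q <- s) q.2) - ln (\prod_(q <- s) q.1)) ^+ 2 / (8 * (size s)%:R)) <=
  \prod_(q <- s) (2^-1 * q.2 + (1 - 2^-1) * q.1).
Proof.
move=> s0.
pose X s := ln (\prod_(q <- s) q.2) - ln (\prod_(q <- s) q.1).
have [Q [Q0 XQ H]] : exists Q : R, [/\ 0 <= Q, X s ^+ 2 <= (size s)%:R * Q &
    Num.sqrt (\prod_(q <- s) q.1 * \prod_(q <- s) q.2) * (1 + Q / 8) <=
    \prod_(q <- s) (2^-1 * q.2 + (1 - 2^-1) * q.1)].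
  elim: s s0 => [_|q s IH /= /andP[/andP[q1 q2] s0]].
    by exists 0; rewrite /X !big_nil mulr1 sqrtr1 ln1 subrr expr0n/= !mul0r addr0 mulr1.
  have [Q [Q0 XQ H]] := IH s0.
  have P1 : 0 < \prod_(q <- s) q.1 by exact: prodr_pair_gt0.
  have P2 : 0 < \prod_(q <- s) q.2 by exact: prodr_pair_gt0.
  pose a := ln q.2 - ln q.1.
  have XE : X (q :: s) = a + X s.
    by rewrite /X !big_cons !lnM ?posrE// /a; ring.
  exists (a ^+ 2 + Q); split; first by rewrite addr_ge0 ?sqr_ge0.
    rewrite XE [size _]/= -natr1 sqrrD.
    have : (0 <= (size s)%:R :> R) by [].
    move: (size s)%:R XQ => m XQ m0; move: (X s) XQ => x XQ.
    have [m00|m1] := eqVneq m 0.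
      have x0 : x = 0 by move: XQ; rewrite m00 mul0r => x2; apply/eqP; rewrite -sqrf_eq0
          eq_le x2 sqr_ge0.
      by rewrite x0 m00; nra.
    have mp : 0 < m by rewrite lt_def m1.
    have : 0 <= (m * a - x) ^+ 2 by exact: sqr_ge0.
    move=> h.
    suff : 2 * (a * x) <= m * a ^+ 2 + Q by nra.
    rewrite -(ler_pM2l mp); nra.
  rewrite !big_cons mulrACA sqrtrM ?mulr_ge0 ?(ltW q1) ?(ltW q2)//.
  have q12 : 0 < q.1 * q.2 by rewrite mulr_gt0.
  have hq : Num.sqrt (q.1 * q.2) * (1 + a ^+ 2 / 8) <= 2^-1 * q.2 + (1 - 2^-1) * q.1.
    have -> : Num.sqrt (q.1 * q.2) = expR ((ln q.1 + ln q.2) / 2).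
      rewrite -lnM ?posrE// -powR12_sqrt ?(ltW q12)// /powR gt_eqF//.
      by congr expR; rewrite mulrC.
    have e1 : q.1 = expR ((ln q.1 + ln q.2) / 2) * expR (- (a / 2)).
      by rewrite -expRD -[LHS]lnK ?posrE//; congr expR; rewrite /a; field.
    have e2 : q.2 = expR ((ln q.1 + ln q.2) / 2) * expR (a / 2).
      by rewrite -expRD -[LHS]lnK ?posrE//; congr expR; rewrite /a; field.
    rewrite [X in _ <= _ * X + _]e2 [X in _ <= _ + _ * X]e1.
    have := cosh_ge (a / 2).
    have := expR_gt0 ((ln q.1 + ln q.2) / 2).
    move: (expR ((ln q.1 + ln q.2) / 2)) (expR (a / 2)) (expR (- (a / 2))) => e f g e0 h.
    rewrite [leRHS](_ : _ = e * ((f + g) / 2)); last by field.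
    by rewrite ler_pM2l//; nra.
  have hs : 1 + (a ^+ 2 + Q) / 8 <= (1 + a ^+ 2 / 8) * (1 + Q / 8).
    have := sqr_ge0 a; move: (a ^+ 2) => A A0; nra.
  apply: le_trans (ler_wpM2l _ hs) _.
    by rewrite mulr_ge0// sqrtr_ge0.
  rewrite mulrACA; apply: ler_pM => //.
    by rewrite mulr_ge0 ?sqrtr_ge0// addr_ge0// divr_ge0// sqr_ge0.
  by rewrite mulr_ge0 ?sqrtr_ge0// addr_ge0// divr_ge0.
apply: le_trans H; rewrite ler_wpM2l ?sqrtr_ge0// lerD2l -/(X s).
have [s00|sn0] := eqVneq (size s)%:R (0 : R).
  by rewrite s00 mulr0 invr0 mulr0 divr_ge0.
have sp : 0 < (size s)%:R :> R by rewrite lt_def sn0/=.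
rewrite ler_pdivrMr ?mulr_gt0// [leRHS](_ : _ = (size s)%:R * Q)//.
by field.
Qed.

End numeric.

Lemma cvg_powR (R : realType) (a x : R) : 0 < x ->
  y `^ a @[y --> x] --> x `^ a.
Proof.
move=> x0.
have d : derivable (@powR R ^~ a) x 1 by apply: derivable_powR; rewrite in_itv/= x0.
have /differentiable_continuous : differentiable (@powR R ^~ a : R^o -> R^o) x.
  exact/derivable1_diffP.
exact.
Qed.

Lemma powR_taylor2_le (R : realType) (p d : R) : 1 < p -> 0 < d ->
  exists2 r : R, 0 < r < 1 & forall u, `|u| < r ->
    (1 + u) `^ (1 - p) <= 1 + (1 - p) * u + p * (p - 1) * (1 + d) / 2 * u ^+ 2.
Proof.
move=> p1 d0.
have [r r01 Hr] : exists2 r : R, 0 < r < 1 & forall u, `|u| < r -> (1 + u) `^ (- p - 1) <=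
    1 + d.
  have : x `^ (- p - 1) @[x --> (1 : R)] --> 1 `^ (- p - 1) by exact: cvg_powR.
  rewrite powR1 => /cvgr_lt /(_ (1 + d)); rewrite ltrDl => /(_ d0) [e /= e0 He].
  exists (Num.min (e / 2) 2^-1).
    by rewrite lt_min divr_gt0//= gt_min; apply/andP; split; [lra|apply/orP; right; lra].
  move=> u; rewrite lt_min => /andP[ue _]; apply/ltW/He.
  rewrite /ball_/= opprD addrA subrr sub0r normrN (lt_trans ue)//; lra.
have /andP[r0 r1] := r01.
exists r => // u ur.
have pos x : `|x| < r -> 0 < 1 + x.
  by move=> /ltr_normlP[]; lra.
have dpow (a x : R) : `|x| < r -> is_derive x 1 (fun x => (1 + x) `^ a) (a * (1 + x) `^ (a
    - 1)).
  move=> xr; have x0 := pos _ xr.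
  have h1 : is_derive (1 + x) 1 (@powR R ^~ a) (a * (1 + x) `^ (a - 1)) by exact:
      is_derive1_powR.
  have h2 : is_derive x 1 (fun x : R => 1 + x) 1.
    by apply: is_derive_eq; rewrite /GRing.scale/= add0r mulr1.
  have := @is_derive1_comp _ (@powR R ^~ a) (fun x : R => 1 + x) x _ _ h1 h2.
  by rewrite mulr1.
have := @taylor2_le R (fun x => (1 + x) `^ (1 - p)) (fun x => (1 - p) * (1 + x) `^ (- p))
  (fun x => (1 - p) * (- p * (1 + x) `^ (- p - 1))) r (p * (p - 1) * (1 + d)) _ _ _ u ur.
rewrite addr0 !powR1 mulr1; apply.
- move=> x xr; have := dpow (1 - p) x xr.
  by rewrite (_ : 1 - p - 1 = - p)//; ring.
- move=> x xr; have := dpow (- p) x xr => h.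
  by apply: is_derive_eq; rewrite /GRing.scale/= ?mulr0 ?mul0r ?addr0 ?add0r; ring.
- move=> x xr; rewrite (_ : (1 - p) * _ = p * (p - 1) * (1 + x) `^ (- p - 1)); last by ring.
  by rewrite ler_wpM2l ?Hr// mulr_ge0//; lra.
Qed.

(** The mean of 1 / (m + q A) and 1 / (m + q B) exceeds its value at the midpoint of A and
    B by a term quadratic in D = B - A, which is negligible when D is of the order of rho. *)
Lemma midpoint_scalar_ineq (R : realType) (m q e D rho A B : R) :
  0 < m -> 0 < q -> 0 < e -> 0 <= A -> 0 <= B -> D = B - A -> `|D| <= 3 * `|rho| ->
  9 * q ^+ 2 * rho ^+ 2 <= 16 * m ^+ 3 * e ->
  rho ^+ 2 / 16 * ((m + q * A)^-1 + (m + q * B)^-1) - e * rho ^+ 2 <=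
  rho ^+ 2 / (8 * (m + q * ((A + B) / 2))) - e / 2 * rho ^+ 2.
Proof.
move=> m0 q0 e0 A0 B0 DE Drho small.
have qA : 0 <= q * A by rewrite mulr_ge0// ltW.
have qB : 0 <= q * B by rewrite mulr_ge0// ltW.
have N0 : 0 < m + q * A by lra.
have N1 : 0 < m + q * B by lra.
have N2 : 0 < m + q * ((A + B) / 2) by lra.
have D2 : D ^+ 2 <= 9 * rho ^+ 2.
  rewrite -[D ^+ 2]real_normK ?num_real// -[rho ^+ 2]real_normK ?num_real//.
  have := normr_ge0 D; nra.
rewrite lerBlDr -lerBlDl.
have -> : rho ^+ 2 / 16 * ((m + q * A)^-1 + (m + q * B)^-1) -
   (rho ^+ 2 / (8 * (m + q * ((A + B) / 2)))  - e / 2 * rho ^+ 2) =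
   rho ^+ 2 * (q ^+ 2 * D ^+ 2 / (32 * (m + q * A) * (m + q * B) * (m + q * ((A + B) / 2)))
       + e / 2).
  by rewrite DE; field; rewrite !gt_eqF//; lra.
rewrite [leRHS]mulrC ler_wpM2l ?sqr_ge0//.
suff : q ^+ 2 * D ^+ 2 / (32 * (m + q * A) * (m + q * B) * (m + q * ((A + B) / 2))) <= e /
    2 by lra.
rewrite ler_pdivrMr ?mulr_gt0//.
have q2 : 0 <= q ^+ 2 by exact: sqr_ge0.
apply: (@le_trans _ _ (16 * m ^+ 3 * e)).
  apply: le_trans small; rewrite mulrAC -mulrA mulrC -mulrA; nra.
have -> : 16 * m ^+ 3 * e = e / 2 * (32 * (m * m * m)) by field.
rewrite ler_pM2l ?divr_gt0// -!mulrA ler_pM2l//.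
rewrite ler_pM ?mulr_ge0 ?(ltW m0)//; first lra.
by rewrite ler_pM ?(ltW m0)//; lra.
Qed.

(** * Concavity of powers from local midpoint inequalities *)

Section local_to_global.
Context {R : realType}.

(** A function that is midpoint-concave at small scales, where smallness may depend on the
    point, lies above its chord: otherwise subtracting the chord and adding a small
    strictly concave parabola yields an interior minimum, at which the second difference is
    both nonnegative and negative. *)
Lemma chord_le_of_local_midpoint (f : R -> R) (a b : R) : a < b ->
  {within `[a, b], continuous f} ->
  (forall t, a < t < b -> exists2 e0, 0 < e0 & forall e, 0 < e < e0 ->
    f (t - e) + f (t + e) <= 2 * f t) ->
  forall t, a <= t <= b -> (b - t) * f a + (t - a) * f b <= (b - a) * f t.
Proof.
move=> ab cf mid t0 /andP[at0 t0b]; rewrite leNgt; apply/negP => neg.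
pose g t := (b - a) * f t - (b - t) * f a - (t - a) * f b.
have g0 : g t0 < 0 by rewrite /g; lra.
pose P := (t0 - a) * (b - t0).
have P0 : 0 <= P by rewrite mulr_ge0 ?subr_ge0.
(* small enough for G to remain negative at t0 *)
pose eta := - g t0 / (2 * (P + 1)).
have eta0 : 0 < eta by rewrite divr_gt0 ?oppr_gt0// mulr_gt0//; lra.
pose G t := g t + eta * ((t - a) * (b - t)).
have Gt0 : G t0 < 0.
  rewrite /G -/P.
  have : eta * P <= eta * (P + 1) by rewrite ler_pM2l//; lra.
  have -> : eta * (P + 1) = - g t0 / 2 by rewrite /eta; field; rewrite gt_eqF//; lra.
  lra.
have cG : {within `[a, b], continuous G}.
  have cid : {within `[a, b], continuous (id : R -> R)}.
    by apply: continuous_subspaceT => x; exact: cvg_id.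
  have cc (k : R) : {within `[a, b], continuous (fun=> k : R)}.
    by apply: continuous_subspaceT => x; exact: cvg_cst.
  move=> x; apply: cvgD.
    apply: cvgB; first apply: cvgB.
    - by apply: cvgM; [exact: cc|exact: cf].
    - by apply: cvgM; [apply: cvgB; [exact: cc|exact: cid]|exact: cc].
    - by apply: cvgM; [apply: cvgB; [exact: cid|exact: cc]|exact: cc].
  apply: cvgM; first exact: cc.
  by apply: cvgM; apply: cvgB; [exact: cid|exact: cc|exact: cc|exact: cid].
have [s sab Gs] := EVT_min (ltW ab) cG.
have Gs0 : G s < 0 by apply: le_lt_trans Gt0; apply: Gs; rewrite in_itv/= at0.
move: sab; rewrite in_itv/= => /andP[as_ sb].
have Ga : G a = 0 by rewrite /G /g; ring.
have Gb : G b = 0 by rewrite /G /g; ring.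
have as' : a < s by rewrite lt_neqAle as_ andbT; apply: contraTneq Gs0 => <-; rewrite Ga ltxx.
have sb' : s < b by rewrite lt_neqAle sb andbT; apply: contraTneq Gs0 => ->; rewrite Gb ltxx.
have [e0 e0_gt0 He0] := mid s (introT andP (conj as' sb')).
pose e := Num.min e0 (Num.min (s - a) (b - s)) / 2.
have m0 : 0 < Num.min e0 (Num.min (s - a) (b - s)) by rewrite !lt_min e0_gt0 !subr_gt0 as' sb'.
have [e1 e2 e3] : [/\ e < e0, e < s - a & e < b - s].
  have : e < Num.min e0 (Num.min (s - a) (b - s)) by rewrite /e; lra.
  by rewrite !lt_min => /and3P[].
have e_gt0 : 0 < e by rewrite divr_gt0.
have := He0 e; rewrite e_gt0 e1 => /(_ isT) hf.
have h1 : G s <= G (s - e) by apply: Gs; rewrite in_itv/=; apply/andP; split; lra.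
have h2 : G s <= G (s + e) by apply: Gs; rewrite in_itv/=; apply/andP; split; lra.
have : G (s - e) + G (s + e) - 2 * G s =
   (b - a) * (f (s - e) + f (s + e) - 2 * f s) - 2 * eta * e ^+ 2.
  by rewrite /G /g; ring.
have : 0 < eta * e ^+ 2 by rewrite mulr_gt0// exprn_gt0.
have : (b - a) * (f (s - e) + f (s + e) - 2 * f s) <= 0.
  by rewrite mulr_ge0_le0//; lra.
lra.
Qed.

Lemma cosh_le (d : R) : 0 < d -> exists2 r : R, 0 < r &
  forall y, `|y| < r -> expR y + expR (- y) <= 2 + (1 + d) * y ^+ 2.
Proof.
move=> d0.
have [r r0 Hr] : exists2 r : R, 0 < r & forall y, `|y| < r -> expR y + expR (- y) <= 2 * (1
    + d).
  have : (fun y : R => expR y + expR (- y)) y @[y --> (0:R)] --> expR 0 + expR (- 0).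
    apply: cvgD; first exact: continuous_expR.
    apply: (@continuous_comp _ _ _ (fun x : R => - x) expR); last exact: continuous_expR.
    by apply: cvgN; exact: cvg_id.
  rewrite oppr0 expR0 => /cvgr_lt /(_ (2 * (1 + d))).
  have l2 : 1 + 1 < 2 * (1 + d) by lra.
  move=> /(_ l2) [e /= e0 He]; exists e => // y ye; apply/ltW/He.
  by rewrite /ball_/= sub0r normrN.
exists r => // y yr.
have := @taylor2_le R (fun x => expR x + expR (- x)) (fun x => expR x - expR (- x))
  (fun x => expR x + expR (- x)) r (2 * (1 + d)) _ _ Hr y yr.
rewrite oppr0 expR0 subrr mul0r addr0 => H.
suff : expR y + expR (- y) <= 1 + 1 + 2 * (1 + d) / 2 * y ^+ 2 by lra.
by apply: H => x _; apply: is_derive_eq; rewrite /GRing.scale/=; ring.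
Qed.

Lemma ln_ge1BV (x : R) : 0 < x -> 1 - x^-1 <= ln x.
Proof.
move=> x0; have := expR_ge1Dx (- ln x).
by rewrite expRN lnK ?posrE//; lra.
Qed.

(** The inequality for means of exponent be < al. Both the mean of exponent be of exp (c -
    rho / 2) and exp (c + rho / 2) and the assumed lower bound for exp w expand as exp c
    times 1 + (constant / 8) rho^2, with constants be and al; the gap between the constants
    absorbs the higher order terms. *)
Lemma power_mean_local (al be : R) : 0 < be -> be < al ->
  exists e rho1, [/\ 0 < e, 0 < rho1 & forall c w rho : R, `|rho| <= rho1 ->
    expR c * (1 + (al / 8 - e) * rho ^+ 2) <= expR w ->
    expR (be * (c - rho / 2)) + expR (be * (c + rho / 2)) <= 2 * expR (be * w)].
Proof.
move=> be0 beal.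
have al0 : 0 < al by exact: lt_trans beal.
pose g := (al - be) / (4 * be).
have g0 : 0 < g by rewrite divr_gt0 ?subr_gt0// mulr_gt0.
(* (1 + d)^2 <= 1 + 2 g, and 1 + 2 g = 8 kap / be *)
pose d := Num.min 1 (g / 2).
have d0 : 0 < d by rewrite lt_min ltr01 divr_gt0.
have [d1 dg] : d <= 1 /\ d <= g / 2.
  by apply/andP; rewrite -le_min.
have [r r0 Hr] := cosh_le d0.
pose kap := (al + be) / 16.
have kap0 : 0 < kap by rewrite divr_gt0// addr_gt0.
exists ((al - be) / 16), (Num.min 1 (Num.min (r / be) (d / kap))); split.
- by rewrite divr_gt0// subr_gt0.
- rewrite !lt_min ltr01 (divr_gt0 r0 be0) (divr_gt0 d0 kap0)//.
move=> c w rho; rewrite !le_min => /and3P[rho1 rho2 rho3].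
rewrite (_ : al / 8 - _ = kap); last by rewrite /kap; field.
set x := kap * rho ^+ 2 => hw.
have x0 : 0 <= x by rewrite mulr_ge0 ?sqr_ge0// ltW.
have xd : x <= d.
  rewrite /x mulrC -ler_pdivlMr//; apply: le_trans rho3.
  by rewrite -[rho ^+ 2]real_normK ?num_real// expr2 ler_piMl.
have x10 : 0 < 1 + x by lra.
have wc : 1 - (1 + x)^-1 <= w - c.
  apply: (le_trans (ln_ge1BV x10)).
  rewrite -ler_expR lnK ?posrE// expRB ler_pdivlMr ?expR_gt0//.
  by rewrite mulrC.
have y_r : `|be * rho / 2| < r.
  rewrite normrM normrM gtr0_norm// [X in _ * X]gtr0_norm ?invr_gt0//.
  have : be * `|rho| <= r by rewrite mulrC -ler_pdivlMr.
  lra.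
have := Hr _ y_r => ch.
have -> : be * (c - rho / 2) = be * c + - (be * rho / 2) by field.
have -> : be * (c + rho / 2) = be * c + be * rho / 2 by field.
rewrite !expRD -mulrDr.
have -> : be * w = be * c + be * (w - c) by ring.
rewrite expRD mulrCA ler_pM2l ?expR_gt0// addrC.
apply: (le_trans ch).
apply: (@le_trans _ _ (2 * (1 + be * (w - c)))); last by rewrite ler_pM2l// expR_ge1Dx.
apply: (@le_trans _ _ (2 * (1 + be * (1 - (1 + x)^-1)))); last by rewrite ler_pM2l// lerD2l
    ler_pM2l.
suff : (1 + d) * (be * rho ^+ 2 / 8) <= 1 - (1 + x)^-1.
  move=> h; have := ler_wpM2l (ltW be0) h; lra.
have -> : 1 - (1 + x)^-1 = x / (1 + x) by field; rewrite gt_eqF.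
rewrite ler_pdivlMr//.
have key : (1 + d) * (1 + x) * be <= 8 * kap.
  have : (1 + d) * (1 + x) <= 1 + 2 * g.
    have dx : d * x <= d by rewrite ler_piMr ?(ltW d0)//; lra.
    lra.
  move=> h; have := ler_wpM2r (ltW be0) h => h'; apply: (le_trans h').
  by rewrite /g /kap le_eqVlt; apply/orP; left; apply/eqP; field; rewrite gt_eqF.
have := ler_wpM2r (sqr_ge0 rho) key; rewrite /x; lra.
Qed.

End local_to_global.

Section power_concavity.
Context {R : realType}.

(** Concavity on the unit interval, with the conclusion asked only at interior points,
    bounds the slopes at t by those of the chords towards 0 and 1. *)
Lemma concave_lipschitz_at (phi : R -> R) (t : R) : 0 < t < 1 ->
  (forall s v l : R, 0 <= s <= 1 -> 0 <= v <= 1 -> 0 < l < 1 ->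
     0 < l * s + (1 - l) * v < 1 ->
     l * phi s + (1 - l) * phi v <= phi (l * s + (1 - l) * v)) ->
  exists2 C, 0 < C & forall v, 0 < v < 1 -> `|phi v - phi t| <= C * `|v - t|.
Proof.
move=> /andP[t0 t1] lc.
have t1' : 0 < 1 - t by lra.
pose C := `|phi t - phi 0| / t + `|phi 1 - phi t| / (1 - t) + 1.
have c1 : 0 <= `|phi t - phi 0| / t by rewrite divr_ge0// ltW.
have c2 : 0 <= `|phi 1 - phi t| / (1 - t) by rewrite divr_ge0// ltW.
have c1E : `|phi t - phi 0| = `|phi t - phi 0| / t * t by rewrite divfK// gt_eqF.
have c2E : `|phi 1 - phi t| = `|phi 1 - phi t| / (1 - t) * (1 - t) by rewrite divfK// gt_eqF.
exists C; first by rewrite /C; lra.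
(* three-point form of concavity, cleared of denominators *)
have tp s u w : 0 <= s -> s < u -> u < w -> w <= 1 -> (w - u) * phi s + (u - s) * phi w <=
    (w - s) * phi u.
  move=> s0 su uw w1; have ws : 0 < w - s by lra.
  have [l [l0 l1 uE lE1 lE2]] : exists l : R, [/\ 0 < l, l < 1, l * s + (1 - l) * w = u,
      (w - s) * l = w - u & (w - s) * (1 - l) = u - s].
    exists ((w - u) / (w - s)); split.
    - by rewrite divr_gt0//; lra.
    - by rewrite ltr_pdivrMr//; lra.
    - by field; rewrite gt_eqF.
    - by field; rewrite gt_eqF.
    - by field; rewrite gt_eqF.
  have h : l * phi s + (1 - l) * phi w <= phi u.
    by rewrite -uE; apply: lc; rewrite ?uE; apply/andP; split; lra.
  have := ler_wpM2l (ltW ws) h.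
  by rewrite mulrDr !mulrA lE1 lE2.
move=> v /andP[v0 v1].
have n1 := ler_norm (phi t - phi 0); have n1' := ler_norm (- (phi t - phi 0)).
have n2 := ler_norm (phi 1 - phi t); have n2' := ler_norm (- (phi 1 - phi t)).
rewrite !normrN in n1' n2'.
move: c1E c2E c1 c2 n1 n1' n2 n2'; rewrite /C.
move: `|phi t - phi 0| `|phi 1 - phi t| => a b.
move: (a / t) (b / (1 - t)) => a' b' aE bE a0 b0 n1 n1' n2 n2'.
have [tv|vt|->] := ltgtP t v; last by rewrite !subrr normr0 mulr0.
- have h1 := tp 0 t v (lexx 0) t0 tv (ltW v1).
  have h2 := tp t v 1 (ltW t0) tv v1 (lexx 1).
  rewrite [X in _ <= _ * X]gtr0_norm ?subr_gt0// ler_norml; apply/andP; split.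
    have : (v - t) * (phi t - phi 1) <= (v - t) * (b' * (1 - t)).
      by apply: ler_wpM2l; lra.
    move=> h3; rewrite -(ler_pM2l t1').
    have : 0 <= (1 - t) * (a' + 1) * (v - t) by rewrite !mulr_ge0//; lra.
    lra.
  have : (v - t) * (phi t - phi 0) <= (v - t) * (a' * t).
    by apply: ler_wpM2l; lra.
  move=> h3; rewrite -(ler_pM2l t0).
  have : 0 <= t * (b' + 1) * (v - t) by rewrite !mulr_ge0//; lra.
  lra.
- have h1 := tp 0 v t (lexx 0) v0 vt (ltW t1).
  have h2 := tp v t 1 (ltW v0) vt t1 (lexx 1).
  rewrite [X in _ <= _ * X]ltr0_norm ?subr_lt0// ler_norml; apply/andP; split.
    have : (t - v) * (phi t - phi 0) <= (t - v) * (a' * t).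
      by apply: ler_wpM2l; lra.
    move=> h3; rewrite -(ler_pM2l t0).
    have : 0 <= t * (b' + 1) * (t - v) by rewrite !mulr_ge0//; lra.
    lra.
  have : (t - v) * (phi t - phi 1) <= (t - v) * (b' * (1 - t)).
    by apply: ler_wpM2l; lra.
  move=> h3; rewrite -(ler_pM2l t1').
  have : 0 <= (1 - t) * (a' + 1) * (t - v) by rewrite !mulr_ge0//; lra.
  lra.
Qed.

(** The chord inequality holds on every compact subinterval of the open unit interval. The
    passage to the end points costs nothing, since log-concavity bounds the values near the
    end points from below by quantities that tend to the end values. *)
Lemma power_concave_of_midpoint (phi : R -> R) (al be : R) : 0 < be -> be < al ->
  (forall s v l : R, 0 <= s <= 1 -> 0 <= v <= 1 -> 0 < l < 1 ->
     0 < l * s + (1 - l) * v < 1 ->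
     l * phi s + (1 - l) * phi v <= phi (l * s + (1 - l) * v)) ->
  (forall e : R, 0 < e -> exists2 rho0 : R, 0 < rho0 & forall s v : R,
     0 < s < 1 -> 0 < v < 1 -> `|phi v - phi s| <= rho0 ->
     expR ((phi s + phi v) / 2) * (1 + (al / 8 - e) * (phi v - phi s) ^+ 2) <=
     expR (phi ((s + v) / 2))) ->
  forall t, 0 < t < 1 ->
  t * expR (be * phi 1) + (1 - t) * expR (be * phi 0) <= expR (be * phi t).
Proof.
move=> be0 beal lc mid t /andP[t0 t1].
pose f x := expR (be * phi x).
have cphi (x : R) : 0 < x < 1 -> phi y @[y --> x] --> phi x.
  move=> x01; have [C C0 HC] := concave_lipschitz_at x01 lc.
  have /andP[x0 x1] := x01.
  apply/cvgrPdist_lt => e e0; near=> y.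
  rewrite distrC (le_lt_trans (HC _ _))//.
    by apply/andP; split; near: y; [exact: lt_nbhsr|exact: lt_nbhsl].
  rewrite mulrC -ltr_pdivlMr// distrC; near: y.
  by apply: cvgr_dist_lt => //; rewrite divr_gt0.
have cf a b : 0 < a -> b < 1 -> {within `[a, b], continuous f}.
  move=> a0 b1; apply: continuous_in_subspaceT => x; rewrite inE/= in_itv/= => /andP[ax xb].
  apply: (@continuous_comp _ _ _ (fun x => be * phi x) expR); last exact: continuous_expR.
  apply: cvgM; first exact: cvg_cst.
  by apply: cphi; rewrite (lt_le_trans a0)//= (le_lt_trans xb).
have local s : 0 < s < 1 -> exists2 e0, 0 < e0 & forall e, 0 < e < e0 ->
    f (s - e) + f (s + e) <= 2 * f s.
  move=> s01; have /andP[s0 s1] := s01.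
  have [e [rho1 [e_gt0 rho1_gt0 He]]] := power_mean_local be0 beal.
  have [rho0 rho0_gt0 Hrho] := mid e e_gt0.
  have [C C0 HC] := concave_lipschitz_at s01 lc.
  pose r := Num.min rho0 rho1 / (2 * C).
  have r0 : 0 < r by rewrite divr_gt0 ?mulr_gt0// lt_min rho0_gt0.
  exists (Num.min r (Num.min s (1 - s))).
    by rewrite !lt_min r0 s0 subr_gt0.
  move=> d /andP[d0]; rewrite !lt_min => /and3P[dr ds ds1].
  have i1 : 0 < s - d < 1 by apply/andP; split; lra.
  have i2 : 0 < s + d < 1 by apply/andP; split; lra.
  have Hr : `|phi (s + d) - phi (s - d)| <= Num.min rho0 rho1.
    have h1 := HC _ i1; have h2 := HC _ i2.
    have e1 : `|s - d - s| = d by rewrite addrAC subrr add0r normrN gtr0_norm.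
    have e2 : `|s + d - s| = d by rewrite addrAC subrr add0r gtr0_norm.
    rewrite e1 in h1; rewrite e2 in h2.
    have := ler_distD (phi s) (phi (s + d)) (phi (s - d)).
    rewrite [`|phi s - _|]distrC => h3.
    have : 2 * C * d <= Num.min rho0 rho1.
      by move: dr; rewrite /r ltr_pdivlMr ?mulr_gt0// mulrC => /ltW.
    lra.
  move: Hr; rewrite le_min => /andP[Hr0 Hr1].
  have := Hrho _ _ i1 i2 Hr0.
  have -> : (s - d + (s + d)) / 2 = s by field.
  move=> /(He _ _ _ Hr1).
  have -> : (phi (s - d) + phi (s + d)) / 2 - (phi (s + d) - phi (s - d)) / 2 = phi (s - d)
      by field.
  by have -> : (phi (s - d) + phi (s + d)) / 2 + (phi (s + d) - phi (s - d)) / 2 = phi (s +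
      d) by field.
rewrite leNgt; apply/negP => neg.
(* the chord inequality on [d, 1 - d], with end values bounded below by log-concavity *)
pose c0 d := expR (be * ((1 - d) * phi 0 + d * phi 1)).
pose c1 d := expR (be * (d * phi 0 + (1 - d) * phi 1)).
pose Q d := (1 - d - t) * c0 d + (t - d) * c1 d - (1 - 2 * d) * f t.
have Q0 : 0 < Q 0.
  rewrite /Q /c0 /c1 /f !subr0 mulr0 subr0 !mul1r !mul0r addr0 add0r; lra.
have cQ : Q d @[d --> (0:R)] --> Q 0.
  have cc (k : R) : (fun=> k : R) d @[d --> (0:R)] --> k by exact: cvg_cst.
  have cid : (d : R) @[d --> (0:R)] --> (0:R) by exact: cvg_id.
  have ce (u v : R) (g h : R -> R) : g d @[d --> (0:R)] --> g 0 -> h d @[d --> (0:R)] --> h 0 ->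
      expR (be * (g d * u + h d * v)) @[d --> (0:R)] --> expR (be * (g 0 * u + h 0 * v)).
    move=> cg ch.
    apply: (@continuous_comp _ _ _ (fun d => be * (g d * u + h d * v)) expR); last exact:
        continuous_expR.
    apply: cvgM; first exact: cc.
    by apply: cvgD; apply: cvgM => //; exact: cc.
  have c1d : (1 - d) @[d --> (0:R)] --> (1 - 0 : R) by apply: cvgB; [exact: cc|exact: cid].
  apply: cvgB; first apply: cvgD.
  - apply: cvgM; first by apply: cvgB => //; exact: cc.
    by apply: (ce _ _ (fun d => 1 - d) id).
  - apply: cvgM; first by apply: cvgB => //; exact: cc.
    by apply: (ce _ _ id (fun d => 1 - d)).
  - apply: cvgM; last exact: cc.
    by apply: cvgB; [exact: cc|apply: cvgM; [exact: cc|exact: cid]].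
have near1 : \forall d \near (0:R)^'+, [/\ 0 < d, d < t, d < 1 - t & 0 < Q d].
  near=> d; split.
  - by [].
  - by near: d; exact: nbhs_right_lt.
  - by near: d; apply: nbhs_right_lt; lra.
  - near: d; have /cvgr_gt /(_ _ Q0) [e /= e0 He] := cQ.
    by exists e => //= y ye _; exact: He.
have [d [d0 dt dt1 Qd]] := filter_ex near1.
have ab : d < 1 - d by lra.
have := chord_le_of_local_midpoint ab (cf d (1 - d) d0 _) _ _ => /(_ _ _ t).
move: Qd; rewrite /Q.
have f0 : c0 d <= f d.
  rewrite ler_expR ler_pM2l//.
  have := lc 0 1 (1 - d); rewrite !mulr0 add0r subKr mulr1.
  by apply; apply/andP; split; lra.
have f1 : c1 d <= f (1 - d).
  rewrite ler_expR ler_pM2l//.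
  have := lc 0 1 d; rewrite !mulr0 add0r mulr1.
  by apply; apply/andP; split; lra.
have h0 : (1 - d - t) * c0 d <= (1 - d - t) * f d by rewrite ler_wpM2l//; lra.
have h1 : (t - d) * c1 d <= (t - d) * f (1 - d) by rewrite ler_wpM2l//; lra.
move=> Qd H.
have : (1 - d - t) * f d + (t - d) * f (1 - d) <= (1 - d - d) * f t.
  apply: H.
  - lra.
  - by move=> s /andP[s1 s2]; apply: local; apply/andP; split; lra.
  - by apply/andP; split; lra.
lra.
Unshelve. all: by end_near. Qed.

End power_concavity.

(** * Densities, domination by Lebesgue measure, quantiles *)

Lemma measurable_fun_invr d (T : measurableType d) (R : realType) (f : T -> R) :
  (forall x, 0 <= f x) -> measurable_fun [set: T] f ->
  measurable_fun [set: T] (fun x => (f x)^-1).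
Proof.
move=> f0 mf; apply: (eq_measurable_fun (fun x => f x `^ (-1))).
  by move=> x _; rewrite powR_inv1.
exact: (measurableT_comp (measurable_powR _)).
Qed.

Lemma finite_measure_fine d (T : measurableType d) (R : realType)
    (mu : {finite_measure set T -> \bar R}) (A : set T) :
  measurable A -> mu A = (fine (mu A))%:E.
Proof. by move=> mA; rewrite fineK// fin_num_measure. Qed.

Lemma fine_ge0_le (R : realDomainType) (x : \bar R) :
  (0 <= x)%E -> ((fine x)%:E <= x)%E.
Proof. by case: x => [r||]//= _; rewrite leey. Qed.

Section density.
Local Open Scope ereal_scope.
Context d (T : measurableType d) (R : realType).
Variables (mu : {measure set T -> \bar R}) (g : T -> R).

(** The proofs [mg] and [g0] are parameters so that the measure structure can be inferred. *)
Definition density (mg : measurable_fun [set: T] g) (g0 : forall x, (0 <= g x)%R)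
  (A : set T) : \bar R := \int[mu]_(x in A) (g x)%:E.

Hypotheses (mg : measurable_fun [set: T] g) (g0 : forall x, (0 <= g x)%R).
Local Notation nu := (density mg g0).

Let density0 : nu set0 = 0.
Proof. by rewrite /density integral_set0. Qed.

Let density_ge0 A : 0 <= nu A.
Proof. by rewrite /density integral_ge0// => x _; rewrite lee_fin. Qed.

Let density_sigma_additive : semi_sigma_additive nu.
Proof.
move=> /= F mF tF mUF; rewrite /density; apply: cvg_toP.
  apply: ereal_nondecreasing_is_cvgn => m n mn.
  by apply: lee_sum_nneg_natr => // k _ _; by apply: integral_ge0 => x _; rewrite lee_fin.
rewrite ge0_integral_bigcup//.
  exact/measurable_EFinP/measurable_funTS.
by move=> x _; rewrite lee_fin.
Qed.

HB.instance Definition _ :=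
  isMeasure.Build _ _ _ nu density0 density_ge0 density_sigma_additive.

Import HBNNSimple.

Let integral_density_nnsfun (f : {nnsfun T >-> R}) :
  \int[nu]_x (f x)%:E = \int[mu]_x ((f x)%:E * (g x)%:E).
Proof.
under [LHS]eq_integral do rewrite fimfunE -fsumEFin//.
rewrite [LHS]ge0_integral_fsum//; last 2 first.
  - by move=> r; exact/measurable_EFinP/measurableT_comp.
  - by move=> n x _; rewrite EFinM nnfun_muleindic_ge0.
under [RHS]eq_integral.
  move=> x xD; rewrite fimfunE -fsumEFin// ge0_mule_fsuml; last first.
    by move=> r; rewrite EFinM nnfun_muleindic_ge0.
  over.
rewrite [RHS]ge0_integral_fsum//; last 2 first.
  - move=> r; apply: emeasurable_funM; apply/measurable_EFinP => //.
    by do 2 apply/measurableT_comp => //.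
  - by move=> n x _; rewrite mule_ge0 ?(lee_fin _ (g x))// EFinM nnfun_muleindic_ge0.
apply: eq_fsbigr => r _.
rewrite !integralZl_indic_nnsfun//= integral_indic//= setIT.
have [r0|r0] := ltP r 0%R.
  rewrite preimage_nnfun0// measure0 mule0 integral0_eq// => x _.
  by rewrite indicE in_set0 mulr0 mul0e.
under eq_integral do rewrite EFinM -muleA.
rewrite ge0_integralZl//.
- congr (_ * _); rewrite /density [LHS]integral_mkcond; apply: eq_integral => x _.
  by rewrite patchE indicE; case: ifPn; rewrite ?mul1e ?mul0e.
- apply: emeasurable_funM => //; exact/measurable_EFinP.
- by move=> x _; rewrite mule_ge0// lee_fin.
Qed.

Lemma ge0_integral_density (f : T -> \bar R) :
  measurable_fun [set: T] f -> (forall x, 0 <= f x) ->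
  \int[nu]_x f x = \int[mu]_x (f x * (g x)%:E).
Proof.
move=> mf f0; pose f_ := nnsfun_approx measurableT mf.
transitivity (lim (\int[nu]_x (f_ n x)%:E @[n --> \oo])).
  rewrite -monotone_convergence//=.
  - apply: eq_integral => ? /[!inE] xD; apply/esym/cvg_lim => //=.
    exact: cvg_nnsfun_approx.
  - by move=> n; exact/measurable_EFinP/measurable_funTS.
  - by move=> n ? _; rewrite lee_fin.
  - by move=> ? _ ? ? mn; rewrite lee_fin; exact/lefP/nd_nnsfun_approx.
under eq_fun do rewrite integral_density_nnsfun.
rewrite -monotone_convergence//=.
- apply: eq_integral => x /[!inE] xD; apply/cvg_lim => //=.
  by apply: cvgeZr => //; exact: cvg_nnsfun_approx.
- by move=> n; apply: emeasurable_funM; exact/measurable_EFinP/measurable_funTS.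
- by move=> n x _; rewrite mule_ge0 ?lee_fin.
- move=> x _ m n mn; apply: lee_wpmul2r; rewrite lee_fin//.
  exact/lefP/nd_nnsfun_approx.
Qed.

End density.

Section line.
Context {R : realType}.
Local Open Scope ereal_scope.
Local Notation leb := (@lebesgue_measure R).

(** Lebesgue measure of A is the infimum of the total lengths of covers of A by intervals,
    and nu is subadditive. *)
Lemma measure_le_lebesgue (nu : {measure set (measurableTypeR R) -> \bar R}) :
  (forall a b : R, (a <= b)%R -> nu `]a, b]%classic <= (b - a)%:E) ->
  forall A, measurable A -> nu A <= leb A.
Proof.
move=> nuI A mA.
rewrite /lebesgue_measure/= /lebesgue_stieltjes_measure /measure_extension/=.
apply: le_ereal_inf_tmp => _ [F [mF AF]] <-.
have mF' k : measurable (F k : set (measurableTypeR R)).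
  by apply: sub_sigma_algebra; exact: mF.
apply: (@le_trans _ _ (\sum_(k <oo) nu (F k))).
  exact: measure_sigma_subadditive.
apply: lee_nneseries => // k _.
have /ocitvP[->|[[a b] /= ab ->]] := mF k.
  by rewrite measure0.
by rewrite wlength_itv_bnd ?nuI// ltW.
Qed.

(** If the image of m under z charges intervals at most by their length, then it is below
    Lebesgue measure. This replaces the change of variables formula for z, which may be
    neither injective nor differentiable. *)
Lemma ge0_integral_comp_le d (T : measurableType d)
    (m : {measure set T -> \bar R}) (z : T -> measurableTypeR R) (h : R -> \bar R) :
  measurable_fun [set: T] z ->
  (forall a b : R, (a <= b)%R -> m (z @^-1` `]a, b]) <= (b - a)%:E) ->
  measurable_fun [set: measurableTypeR R] h -> (forall x, 0 <= h x) ->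
  \int[m]_x h (z x) <= \int[leb]_x h x.
Proof.
move=> mz zI mh h0.
pose zm := isMeasurableFun.Build _ _ _ _ _ mz.
pose zf : {mfun T >-> measurableTypeR R} := HB.pack z zm.
rewrite -[leLHS]/(\int[m]_(x in (zf @^-1` [set: measurableTypeR R])) (h \o zf) x).
rewrite -(ge0_integral_pushforward mz)//.
apply: ge0_le_measure_integral => // A mA.
by apply: measure_le_lebesgue => // a b ab; exact: zI.
Qed.

Let measurable_scale (c : R) :
  measurable_fun [set: measurableTypeR R]
    (fun x : measurableTypeR R => (c * x)%R : measurableTypeR R).
Proof. exact: measurable_funM. Qed.

(** Half of the scaling rule; it follows from the domination lemma applied to the inverse
    dilation. *)
Lemma ge0_le_integral_scale (k : R) (f : R -> \bar R) : (0 < k)%R ->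
  measurable_fun [set: measurableTypeR R] f -> (forall x, 0 <= f x) ->
  (k^-1)%:E * \int[leb]_x f x <= \int[leb]_x f (k * x)%R.
Proof.
move=> k0 mf f0.
have k'0 : (0 <= k^-1)%R by rewrite invr_ge0 ltW.
have := @ge0_integral_comp_le _ (measurableTypeR R) (mscale (NngNum k'0) leb)
  (fun x => (k^-1 * x)%R) (fun x => f (k * x)%R) (measurable_scale k^-1).
rewrite ge0_integral_mscale//=; last first.
- apply: measurableT_comp => //; apply: measurableT_comp => //.
under eq_integral do rewrite mulrA divff ?gt_eqF// mul1r.
apply => //; last exact: measurableT_comp.
move=> a b ab; rewrite /mscale/=.
rewrite (_ : _ @^-1` _ = `](k * a)%R, (k * b)%R]%classic); last first.
  apply/seteqP; split=> x /=; rewrite !in_itv/=.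
    by rewrite ltr_pdivlMl// ler_pdivrMl.
  by rewrite ltr_pdivlMl// ler_pdivrMl.
rewrite lebesgue_measure_itv/= lte_fin.
case: ifPn => _; rewrite -?EFinD -?EFinM lee_fin.
  by rewrite -mulrBr mulKf// gt_eqF.
by rewrite mulr0 subr_ge0.
Qed.

End line.

Section quantile.
Context {R : realType}.
Local Open Scope ereal_scope.
Local Notation leb := (@lebesgue_measure R).
Variable P : probability (measurableTypeR R) R.

Let idTR : measurableTypeR R -> R := idfun.

#[local] HB.instance Definition _ :=
  @isMeasurableFun.Build _ _ _ _ idTR (@measurable_id _ _ setT).

Let Phi (r : R) : R := fine (P `]-oo, r]%classic).

Let PhiE r : P `]-oo, r]%classic = (Phi r)%:E.
Proof. by rewrite /Phi fineK// fin_num_measure. Qed.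

Let cdfE r : cdf (idTR : {RV P >-> R}) r = (Phi r)%:E.
Proof. by rewrite -PhiE. Qed.

Let Phi_nd (r s : R) : (r <= s)%R -> (Phi r <= Phi s)%R.
Proof. by move=> rs; rewrite -lee_fin -!cdfE cdf_nondecreasing. Qed.

Let Phi_gt (u : R) : (u < 1)%R -> exists x, (u < Phi x)%R.
Proof.
move=> u1; have := @cvg_cdfy1 _ _ _ P (idTR : {RV P >-> R}).
move=> /(_ [set x | u%:E < x]) /= h.
have [|M [_ /(_ (M + 1)%R)]] := h _; first by apply: open_ereal_gt'; rewrite ?lte_fin//.
by rewrite ltrDl ltr01 => /(_ isT); rewrite /= cdfE lte_fin; exists (M + 1)%R.
Qed.

Let Phi_lt (u : R) : (0 < u)%R -> exists x, (Phi x < u)%R.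
Proof.
move=> u1; have := @cvg_cdfNy0 _ _ _ P (idTR : {RV P >-> R}).
move=> /(_ [set x | x < u%:E]) /= h.
have [|M [_ /(_ (M - 1)%R)]] := h _; first by apply: open_ereal_lt'; rewrite ?lte_fin//.
rewrite ltrBlDr ltrDl ltr01 => /(_ isT); rewrite /= cdfE lte_fin.
by exists (M - 1)%R.
Qed.

Let Phi_rc (u c : R) : (forall d, (c < d)%R -> (u <= Phi d)%R) -> (u <= Phi c)%R.
Proof.
move=> h; rewrite leNgt; apply/negP => cu.
have := @cdf_right_continuous _ _ _ P (idTR : {RV P >-> R}) c.
rewrite cdfE => /(_ [set x | x < u%:E]) /= h'.
have : \forall x \near c^'+, cdf (idTR : {RV P >-> R}) x < u%:E.
  by apply: h'; apply: open_ereal_lt'; rewrite lte_fin.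
move=> near_c; near (at_right c) => d.
have : cdf (idTR : {RV P >-> R}) d < u%:E by near: d.
rewrite cdfE lte_fin ltNge h//.
Unshelve. all: by end_near. Qed.

Let q (u : R) : R := if (0 < u < 1)%R then inf [set x | u <= Phi x]%R else 0%R.

Let qP (u c : R) : (0 < u < 1)%R -> (q u <= c)%R = (u <= Phi c)%R.
Proof.
move=> u01; rewrite /q u01; have /andP[u0 u1] := u01.
have lb : has_lbound [set x | u <= Phi x]%R.
  have [y yu] := Phi_lt u0; exists y => z /= uz; rewrite leNgt; apply/negP => zy.
  by have := lt_le_trans yu uz; rewrite ltNge Phi_nd// ltW.
have ne : [set x | u <= Phi x]%R !=set0.
  by have [y uy] := Phi_gt u1; exists y; exact: ltW.
apply/idP/idP => [h|]; last exact: ge_inf.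
apply: Phi_rc => d cd.
have [x ux xd] : exists2 x, (u <= Phi x)%R & (x < d)%R.
  by have [x ux xd] := inf_lt ne (le_lt_trans h cd); exists x.
by rewrite (le_trans ux)// Phi_nd// ltW.
Qed.

(** q is the generalized inverse of the distribution function; right continuity gives q u
    <= c iff u <= P ]-oo, c], which identifies the law of q under the uniform distribution
    on half-lines. *)
Lemma quantile_exists : exists q : measurableTypeR R -> measurableTypeR R,
  [/\ measurable_fun [set: measurableTypeR R] q,
      (forall u v : R, 0 < u -> u <= v -> v < 1 -> q u <= q v)%R &
      forall A, measurable A -> leb (q @^-1` A `&` `]0%R, 1%R[) = P A].
Proof.
have q_nd (u v : R) : (0 < u -> u <= v -> v < 1 -> q u <= q v)%R.
  move=> u0 uv v1; rewrite qP ?u0 ?(le_lt_trans uv)//.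
  by rewrite (le_trans uv)// -qP// v1 (lt_le_trans u0).
have qray x : q @^-1` `]x, +oo[ `&` `]0%R, 1%R[ = `]Phi x, +oo[ `&` `]0%R, 1%R[.
  apply/seteqP; split=> u /= [+ u01]; rewrite !in_itv/= !andbT; rewrite in_itv/= in u01.
    by rewrite ltNge qP// -ltNge.
  by move=> xu; split=> //; rewrite ltNge qP// -ltNge.
have mq : measurable_fun [set: measurableTypeR R] (q : measurableTypeR R -> measurableTypeR R).
  apply: (measurability (@RGenOInfty.G R)) => [|/= _ [_] [r] -> <-].
    exact: RGenOInfty.measurableE.
  rewrite setTI -[X in measurable X](setIT) -(setUv `]0%R, 1%R[%classic) setIUr qray.
  apply: measurableU; first exact: measurableI.
  have [r0|r0] := ltP r 0%R.
    rewrite (_ : _ `&` _ = ~` `]0%R, 1%R[); first exact: measurableC.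
    apply/seteqP; split=> [u []//|u /= u01]; split=> //=.
    by rewrite in_itv/= in u01; rewrite /= in_itv/= /q; move/negP/negbTE : u01 => ->;
        rewrite r0.
  rewrite (_ : _ `&` _ = set0)//; apply/seteqP; split=> [u [/= + u01]|//].
  rewrite in_itv/= in u01; rewrite /= in_itv/= /q; move/negP/negbTE : u01 => ->.
  by rewrite ltNge r0.
exists q; split => // A mA.
have mD : measurable (`]0%R, 1%R[%classic : set (measurableTypeR R)) by exact: measurable_itv.
pose m : {measure set (measurableTypeR R) -> \bar R} := mrestr leb mD.
pose q' : measurableTypeR R -> measurableTypeR R := q.
have m1_ : {m1 : {measure set (measurableTypeR R) -> \bar R} | forall B, m1 B = m (q' @^-1` B)}.
  by exists (measure_function_pushforward__canonical__measure_function_Measure m mq).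
have [m1 m1E] := m1_; rewrite -[LHS]/(m (q' @^-1` A)) -m1E.
have m1ray x : m1 `]x, +oo[%classic = P `]x, +oo[%classic.
  rewrite m1E /q' /m/= /mrestr/= qray.
  rewrite (_ : `]x, +oo[%classic = ~` `]-oo, x]%classic); last by rewrite setCitvl.
  rewrite probability_setC// PhiE.
  have Phi0 : (0 <= Phi x)%R by rewrite -lee_fin -PhiE.
  have Phi1 : (Phi x <= 1)%R by rewrite -lee_fin -PhiE probability_le1.
  rewrite (_ : _ `&` _ = `]Phi x, 1%R[%classic); last first.
    apply/seteqP; split=> u /=; rewrite !in_itv/= !andbT.
      by move=> [-> /andP[_ ->]].
    by move=> /andP[xu u1]; rewrite xu u1 (le_lt_trans Phi0).
  rewrite lebesgue_measure_itv/= lte_fin; case: ltP => // Phi1'.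
  by rewrite (_ : Phi x = 1%R) ?subee//; apply/eqP; rewrite eq_le Phi1.
have Gm : @RGenOInfty.G R `<=` (measurable : set (set (measurableTypeR R))).
  by move=> _ [x ->]; exact: measurable_itv.
have Gg (k : nat) : @RGenOInfty.G R `](- k%:R)%R, +oo[%classic by exists (- k%:R)%R.
have gT : \bigcup_(k : nat) `](- k%:R)%R, +oo[%classic = [set: measurableTypeR R].
  apply/seteqP; split=> // x _; exists (Num.bound x) => //=.
  rewrite in_itv/= andbT ltrNl (le_lt_trans (ler_norm _))// normrN.
  by rewrite (lt_le_trans (archi_boundP (normr_ge0 x)))// /Num.bound normr_id.
apply: (@g_sigma_algebra_measure_unique _ R (measurableTypeR R) _ Gm _ Gg gT m1 P).
- move=> _ _ [x ->] [y ->]; exists (Num.max x y).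
  apply/seteqP; split=> u /=; rewrite !in_itv/= !andbT gt_max.
    by move=> [-> ->].
  by move=> /andP[-> ->].
- by move=> _ [x ->].
- by move=> k; rewrite m1ray (le_lt_trans (probability_le1 _ _)) ?ltry.
- by move: mA; rewrite RGenOInfty.measurableE.
Qed.

End quantile.

Lemma sup_inf_le (R : realType) (S : set R) (c : R) : S !=set0 ->
  (forall s t, S s -> S t -> s - t <= c) ->
  sup S - inf S <= c /\ S `<=` `[inf S, sup S].
Proof.
move=> [s0 Ss0] h.
have ub : has_ubound S by exists (s0 + c) => s Ss; rewrite -lerBlDl h.
have lb : has_lbound S by exists (s0 - c) => s Ss; rewrite lerBlDr -lerBlDl h.
split; last by move=> s Ss; rewrite /= in_itv/= ub_le_sup// ge_inf.
rewrite lerBlDr -lerBlDl; apply: lb_le_inf; first by exists s0.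
move=> t St; rewrite lerBlDl; apply: ge_sup; first by exists s0.
by move=> s Ss; rewrite -lerBlDr h.
Qed.

Section quantile_density.
Context {R : realType}.
Local Open Scope ereal_scope.
Local Notation leb := (@lebesgue_measure R).

Lemma quantile_density (f : measurableTypeR R -> R) :
  measurable_fun [set: measurableTypeR R] f -> (forall x, 0 <= f x)%R ->
  \int[leb]_x (f x)%:E = 1 ->
  exists q : measurableTypeR R -> measurableTypeR R,
  [/\ measurable_fun [set: measurableTypeR R] q,
      (forall u v : R, 0 < u -> u <= v -> v < 1 -> q u <= q v)%R &
      forall psi : measurableTypeR R -> \bar R,
        measurable_fun [set: measurableTypeR R] psi -> (forall x, 0 <= psi x) ->
        \int[leb]_(u in `]0%R, 1%R[) psi (q u) = \int[leb]_x (psi x * (f x)%:E)].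
Proof.
move=> mf f0 f1.
pose P0 : {measure set (measurableTypeR R) -> \bar R} := density leb mf f0.
have P01 : P0 setT = 1 by [].
pose P : probability (measurableTypeR R) R := HB.pack (P0 : set _ -> _) (Measure.on P0)
   (Measure_isProbability.Build _ _ _ P0 P01).
have [q [mq qnd qP]] := quantile_exists P.
exists q; split=> // psi mpsi psi0.
rewrite -(ge0_integral_density leb mf f0)//.
have mD : measurable (`]0%R, 1%R[%classic : set (measurableTypeR R)) by exact: measurable_itv.
have mI : measurable_fun [set: measurableTypeR R] (\1_(`]0%R, 1%R[%classic : set
    (measurableTypeR R)) : _ -> R).
  exact: measurable_indic.
have I0 (x : measurableTypeR R) : (0 <= \1_(`]0%R, 1%R[%classic : set (measurableTypeR R))
    x :> R)%R.
  by [].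
pose m : {measure set (measurableTypeR R) -> \bar R} := density leb mI I0.
transitivity (\int[m]_x psi (q x)).
  rewrite [RHS](ge0_integral_density leb mI I0)//; last exact: measurableT_comp.
  rewrite [LHS]integral_mkcond; apply: eq_integral => u _.
  by rewrite patchE indicE; case: ifPn; rewrite ?mule1 ?mule0.
rewrite -[LHS]/(\int[m]_(x in (q @^-1` [set: measurableTypeR R])) (psi \o q) x).
rewrite -(ge0_integral_pushforward mq)//.
apply: eq_measure_integral => A mA _; rewrite -[RHS]qP//.
rewrite -[LHS]/(\int[leb]_(x in q @^-1` A) (\1_(`]0%R, 1%R[%classic : set (measurableTypeR
    R)) x)%:E) integral_indic//; last first.
  by rewrite -[X in measurable X]setTI; exact: mq.
by rewrite setIC.
Qed.

End quantile_density.

(** * Monotone transport on the line *)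

Section quantile_mix.
Context {R : realType}.
Local Open Scope ereal_scope.
Local Notation leb := (@lebesgue_measure R).
Local Notation T := (measurableTypeR R).
Local Notation I01 := (`]0%R, 1%R[%classic : set T).

(** The derivative of u |-> l x(u) + (1 - l) y(u) is l / f(x(u)) + (1 - l) / g(y(u)) where
    x and y are the quantile functions of f and g. Only the inequality between the integral
    of the right-hand side and the increment of the left-hand side is needed, and it holds
    without differentiating: the integral of 1 / f(x(u)) is the length of the part of the
    range of x where f does not vanish. *)
Lemma quantile_mix_speed_le (l : R) (f g : T -> R) (x y : T -> T) (J : set T) (c : R) :
  (0 < l < 1)%R ->
  measurable_fun [set: T] f -> (forall t, 0 <= f t)%R ->
  measurable_fun [set: T] g -> (forall t, 0 <= g t)%R ->
  measurable_fun [set: T] x -> measurable_fun [set: T] y ->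
  (forall u v : R, 0 < u -> u <= v -> v < 1 -> x u <= x v)%R ->
  (forall u v : R, 0 < u -> u <= v -> v < 1 -> y u <= y v)%R ->
  (forall psi : T -> \bar R, measurable_fun [set: T] psi -> (forall x, 0 <= psi x) ->
        \int[leb]_(u in I01) psi (x u) = \int[leb]_x (psi x * (f x)%:E)) ->
  (forall psi : T -> \bar R, measurable_fun [set: T] psi -> (forall x, 0 <= psi x) ->
        \int[leb]_(u in I01) psi (y u) = \int[leb]_x (psi x * (g x)%:E)) ->
  measurable J -> J `<=` I01 -> (0 <= c)%R ->
  (forall u v, J u -> J v ->
     (l * x u + (1 - l) * y u) - (l * x v + (1 - l) * y v) <= c)%R ->
  \int[leb]_(u in J) (l * (f (x u))^-1 + (1 - l) * (g (y u))^-1)%:E <= c%:E.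
Proof.
move=> /andP[l0 l1] mf f0 mg g0 mx my xnd ynd xP yP mJ JI c0 Jc.
have l1' : (0 < 1 - l)%R by rewrite subr_gt0.
have [->|J0] := eqVneq J set0; first by rewrite integral_set0 lee_fin.
have {}J0 : J !=set0 by exact/set0P.
have minv (h : T -> R) (z : T -> T) : (forall t, 0 <= h t)%R ->
    measurable_fun [set: T] h -> measurable_fun [set: T] z ->
    measurable_fun [set: T] (fun u : T => ((h (z u))^-1)%R : R).
  by move=> h0 mh mz; apply: measurable_fun_invr => //; exact: measurableT_comp.
(* both coordinates may be varied independently because they are monotone *)
have Jc4 u v u' v' : J u -> J v -> J u' -> J v' ->
    (l * (x u - x v) + (1 - l) * (y u' - y v') <= c)%R.
  move=> Ju Jv Ju' Jv'.
  have JI' w : J w -> (0 < w < 1)%R by move=> /JI /=; rewrite in_itv.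
  have /andP[u0 u1] := JI' _ Ju; have /andP[v0 v1] := JI' _ Jv.
  have /andP[u0' u1'] := JI' _ Ju'; have /andP[v0' v1'] := JI' _ Jv'.
  have [w [Jw uw uw' w1]] : exists w, [/\ J w, (u <= w)%R, (u' <= w)%R & (w < 1)%R].
    by have [uu'|/ltW uu'] := leP u u'; [exists u'|exists u].
  have [s [Js sv sv' s0]] : exists s, [/\ J s, (s <= v)%R, (s <= v')%R & (0 < s)%R].
    by have [vv'|/ltW vv'] := leP v v'; [exists v|exists v'].
  apply: le_trans (Jc _ _ Jw Js).
  rewrite [leRHS](_ : _ = l * (x w - x s) + (1 - l) * (y w - y s))%R; last by ring.
  rewrite lerD// ler_wpM2l ?(ltW l0) ?(ltW l1')//; apply: lerB.
  - exact: xnd.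
  - exact: xnd.
  - exact: ynd.
  - exact: ynd.
have J2 := J0; have [u0 Ju0] := J0.
pose X := x @` J; pose Y := y @` J.
have hX u' v' : J u' -> J v' -> (sup X - inf X <= (c - (1 - l) * (y u' - y v')) / l)%R /\
    X `<=` `[inf X, sup X].
  move=> Ju' Jv'; apply: sup_inf_le; first by exists (x u0), u0.
  by move=> _ _ [u Ju <-] [v Jv <-]; rewrite ler_pdivlMr// lerBrDr mulrC Jc4.
have hY : (sup Y - inf Y <= (c - l * (sup X - inf X)) / (1 - l))%R /\
    Y `<=` `[inf Y, sup Y].
  apply: sup_inf_le; first by exists (y u0), u0.
  move=> _ _ [u Ju <-] [v Jv <-].
  rewrite ler_pdivlMr// lerBrDr mulrC.
  have [+ _] := hX _ _ Ju Jv; rewrite ler_pdivlMr// [((1 - l) * _)%R]mulrC.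
  by rewrite lerBrDr addrC [(l * _)%R]mulrC.
have int_le (h : T -> R) (z : T -> T) :
    measurable_fun [set: T] h -> (forall t, 0 <= h t)%R -> measurable_fun [set: T] z ->
    (forall psi : T -> \bar R, measurable_fun [set: T] psi -> (forall x, 0 <= psi x) ->
        \int[leb]_(u in I01) psi (z u) = \int[leb]_x (psi x * (h x)%:E)) ->
    z @` J `<=` `[inf (z @` J), sup (z @` J)] ->
    \int[leb]_(u in J) ((h (z u))^-1)%:E <= (sup (z @` J) - inf (z @` J))%:E.
  move=> mh h0 mz zP zJ; set S := `[_, _]%classic in zJ.
  have mS : measurable (S : set T) by exact: measurable_itv.
  pose psi (t : T) : \bar R := (\1_S t * (h t)^-1)%:E.
  have psi0 t : 0 <= psi t by rewrite lee_fin mulr_ge0 ?invr_ge0.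
  have mpsi : measurable_fun [set: T] psi.
    apply/measurable_EFinP; apply: measurable_funM; first exact: measurable_indic.
    exact: (minv h id h0).
  apply: (@le_trans _ _ (\int[leb]_(u in I01) psi (z u))).
    rewrite [leLHS](_ : _ = \int[leb]_(u in J) psi (z u)); last first.
      apply: eq_integral => u; rewrite inE => Ju.
      rewrite /psi indicE (_ : (z u \in S) = true) ?mul1r//.
      by apply/mem_set; apply: zJ; exists u.
    apply: ge0_subset_integral => //.
      by apply: measurable_funTS; exact: measurableT_comp.
  rewrite zP//.
  apply: (@le_trans _ _ (\int[leb]_t (\1_S t)%:E)).
    apply: ge0_le_integral => //.
    - by move=> t _; rewrite mule_ge0// lee_fin.
    - by apply: emeasurable_funM => //; exact/measurable_EFinP.
    - by apply/measurable_EFinP; exact: measurable_indic.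
    - move=> t _; rewrite /psi -EFinM lee_fin -mulrA.
      have [->|ht] := eqVneq (h t) 0%R; first by rewrite mulr0 mulr0.
      by rewrite mulVf// mulr1.
  rewrite integral_indic// setIT -[leLHS]/(lebesgue_measure S) /S lebesgue_measure_itv/=
      lte_fin.
  case: ifPn => // ; rewrite -leNgt => _; rewrite lee_fin subr_ge0.
  have /zJ : (z @` J) (z u0) by exists u0.
  by rewrite /S/= in_itv/= => /andP[]; exact: le_trans.
under eq_integral do rewrite EFinD !EFinM.
have nn (h : T -> R) (z : T -> T) : (forall t, 0 <= h t)%R -> forall u, J u -> (0 <= ((h (z
    u))^-1)%:E).
  by move=> h0 u _; rewrite lee_fin invr_ge0.
rewrite ge0_integralD//; last 4 first.
- by move=> u Ju; apply: mule_ge0; [rewrite lee_fin ltW|exact: (nn _ x f0)].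
- apply/measurable_funTS; apply: emeasurable_funM => //; apply/measurable_EFinP; exact: minv.
- by move=> u Ju; apply: mule_ge0; [rewrite lee_fin ltW|exact: (nn _ y g0)].
- apply/measurable_funTS; apply: emeasurable_funM => //; apply/measurable_EFinP; exact: minv.
rewrite !ge0_integralZl_EFin ?(ltW l0) ?(ltW l1')//; last 4 first.
- exact: (nn _ y g0).
- by apply/measurable_funTS; apply/measurable_EFinP; exact: minv.
- exact: (nn _ x f0).
- by apply/measurable_funTS; apply/measurable_EFinP; exact: minv.
apply: (@le_trans _ _ (l%:E * (sup X - inf X)%:E + (1 - l)%:E * (sup Y - inf Y)%:E)).
  apply: leeD; apply: lee_wpmul2l; rewrite ?lee_fin ?(ltW l0) ?(ltW l1')//.
    by apply: int_le => //; have [] := hX _ _ Ju0 Ju0.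
  by apply: int_le => //; have [] := hY.
rewrite -!EFinM -EFinD lee_fin.
have [+ _] := hY; rewrite ler_pdivlMr// mulrC => h.
by rewrite addrC -lerBrDr.
Qed.

End quantile_mix.

Section transport_line_real.
Context {R : realType}.
Local Open Scope ereal_scope.
Local Notation leb := (@lebesgue_measure R).
Local Notation T := (measurableTypeR R).
Local Notation I01 := (`]0%R, 1%R[%classic : set T).

Let measurable_inv (h : T -> R) (z : T -> T) : (forall t, 0 <= h t)%R ->
    measurable_fun [set: T] h -> measurable_fun [set: T] z ->
    measurable_fun [set: T] (fun u : T => ((h (z u))^-1)%R : R).
Proof.
by move=> h0 mh mz; apply: measurable_fun_invr => //; exact: measurableT_comp.
Qed.

(** Divided by f s * g t, the hypothesis bounds al s / f s + be t / g t by h at the mixed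
    point times the speed of the mixed quantile function. It is used only for s and t the
    quantiles of f and g of the same order u: integrating in u turns the left-hand side
    into the integrals of al and be, and the right-hand side into at most the integral of
    h. The constant C forces al to vanish with f, and be with g. *)
Lemma transport_line_real (l C : R) (f g : T -> R) (al be h : T -> \bar R) :
  (0 < l < 1)%R -> 
  measurable_fun [set: T] f -> (forall t, 0 <= f t)%R -> \int[leb]_t (f t)%:E = 1 ->
  measurable_fun [set: T] g -> (forall t, 0 <= g t)%R -> \int[leb]_t (g t)%:E = 1 ->
  measurable_fun [set: T] al -> (forall t, 0 <= al t) ->
  measurable_fun [set: T] be -> (forall t, 0 <= be t) ->
  measurable_fun [set: T] h -> (forall t, 0 <= h t) ->
  (forall t, al t <= C%:E * (f t)%:E) -> (forall t, be t <= C%:E * (g t)%:E) ->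
  (forall s t, (0 < f s)%R -> (0 < g t)%R ->
     al s * (g t)%:E + be t * (f s)%:E <=
     h (l * s + (1 - l) * t)%R * (l * g t + (1 - l) * f s)%:E) ->
  \int[leb]_t al t + \int[leb]_t be t <= \int[leb]_t h t.
Proof.
move=> l01 mf f0 f1 mg g0 g1 mal al0 mbe be0 mh h0 alf beg H.
have /andP[l0 l1] := l01.
have l1' : (0 < 1 - l)%R by rewrite subr_gt0.
have [x [mx xnd xP]] := quantile_density mf f0 f1.
have [y [my ynd yP]] := quantile_density mg g0 g1.
pose z (u : T) : T := (l * x u + (1 - l) * y u)%R.
have mz : measurable_fun [set: T] z.
  by apply: measurable_funD; apply: measurable_funM.
pose D0 (u : T) : R := (l * (f (x u))^-1 + (1 - l) * (g (y u))^-1)%R.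
have D00 u : (0 <= D0 u)%R.
  by rewrite addr_ge0// mulr_ge0 ?invr_ge0 ?(ltW l0) ?(ltW l1').
have mD0 : measurable_fun [set: T] D0.
  by apply: measurable_funD; apply: measurable_funM => //; exact: measurable_inv.
pose D (u : T) : R := (D0 u * \1_I01 u)%R.
have D_ge0 u : (0 <= D u)%R by rewrite mulr_ge0.
have mI : measurable I01 by exact: measurable_itv.
have mD : measurable_fun [set: T] D.
  by apply: measurable_funM => //; exact: measurable_indic.
have intD (A : set T) (k : T -> \bar R) :
    \int[leb]_(u in A) (k u * (D u)%:E) = \int[leb]_(u in A `&` I01) (k u * (D0 u)%:E).
  rewrite [RHS]integral_mkcondr; apply: eq_integral => u _.
  by rewrite patchE /D indicE; case: ifPn; rewrite ?mulr1 ?mulr0 ?mule0.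
pose m : {measure set T -> \bar R} := density leb mD D_ge0.
apply: (@le_trans _ _ (\int[m]_u h (z u))); last first.
  apply: ge0_integral_comp_le => // a b ab.
  have -> : m (z @^-1` `]a, b]) = \int[leb]_(u in z @^-1` `]a, b]) (1 * (D u)%:E).
    by apply: eq_integral => u _; rewrite mul1e.
  rewrite intD; under eq_integral do rewrite mul1e.
  apply: (@quantile_mix_speed_le _ l f g x y) => //.
  - by apply: measurableI => //; rewrite -[X in measurable X]setTI; exact: mz.
  - by rewrite subr_ge0.
  - move=> u v [+ _] [+ _]; rewrite /= !in_itv/= => /andP[_ ub] /andP[av _].
    exact: lerB ub (ltW av).
rewrite (ge0_integral_density leb mD D_ge0)//; last exact: measurableT_comp.
rewrite intD setTI.
have quot (k : T -> R) (be' : T -> \bar R) : (forall t, 0 <= k t)%R -> measurable_fun [set: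
    T] k ->
    (forall t, 0 <= be' t) -> measurable_fun [set: T] be' -> (forall t, be' t <= C%:E * (k
        t)%:E) ->
    [/\ forall t, 0 <= be' t * ((k t)^-1)%:E,
    measurable_fun [set: T] (fun t => be' t * ((k t)^-1)%:E) &
    \int[leb]_t be' t = \int[leb]_t (be' t * ((k t)^-1)%:E * (k t)%:E)].
  move=> k0 mk be'0 mbe' bk; split.
  - by move=> t; rewrite mule_ge0// lee_fin invr_ge0.
  - apply: emeasurable_funM => //; apply/measurable_EFinP.
    exact: (@measurable_inv k id).
  - apply: eq_integral => t _; rewrite -muleA -EFinM.
    have [kt|kt] := eqVneq (k t) 0%R; last by rewrite mulVf// mule1.
    by apply/eqP; rewrite kt mulr0 mule0 eq_le be'0 andbT (le_trans (bk t))// kt mule0.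
have [qa0 mqa ->] := quot _ _ f0 mf al0 mal alf.
have [qb0 mqb ->] := quot _ _ g0 mg be0 mbe beg.
rewrite -xP// -yP// -ge0_integralD//; last 2 first.
- by apply: measurable_funTS; exact: (measurableT_comp mqa).
- by apply: measurable_funTS; exact: (measurableT_comp mqb).
(* f and g do not vanish at almost every pair of quantiles *)
have aepos (k : T -> R) (w : T -> T) : (forall t, 0 <= k t)%R -> measurable_fun [set: T] k ->
    (forall psi : T -> \bar R, measurable_fun [set: T] psi -> (forall x, 0 <= psi x) ->
        \int[leb]_(u in I01) psi (w u) = \int[leb]_x (psi x * (k x)%:E)) ->
    measurable_fun [set: T] w ->
    {ae leb, forall u, I01 u -> (0 < k (w u))%R}.
  move=> k0 mk wP mw; pose Z := k @^-1` [set 0%R].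
  have mZ : measurable Z by rewrite -[X in measurable X]setTI; exact: mk.
  exists (I01 `&` w @^-1` Z); split.
  - by apply: measurableI => //; rewrite -[X in measurable X]setTI; exact: mw.
  - transitivity (\int[leb]_(u in I01) (\1_Z (w u) : R)%:E).
      rewrite -[RHS]/(\int[leb]_(u in I01) (\1_(w @^-1` Z) u : R)%:E).
      rewrite integral_indic// 1?setIC//.
      by rewrite -[X in measurable X]setTI; exact: mw.
    rewrite (wP (fun t => (\1_Z t)%:E))//; last first.
      exact/measurable_EFinP/measurable_indic.
    apply: integral0_eq => t _; rewrite -EFinM indicE.
    case: (boolP (t \in Z)); rewrite ?mul0r// inE.
    by rewrite /Z/= => ->; rewrite mulr0.
  - move=> u /= /not_implyP[Iu /negP]; rewrite -leNgt => ku; split => //.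
    by apply/eqP; rewrite eq_le ku k0.
have aef := aepos _ _ f0 mf xP mx.
have aeg := aepos _ _ g0 mg yP my.
apply: ae_ge0_le_integral => //.
- by move=> u _; rewrite adde_ge0.
- by apply: measurable_funTS; apply: emeasurable_funD; [exact: (measurableT_comp
    mqa)|exact: (measurableT_comp mqb)].
- by move=> u _; rewrite mule_ge0// lee_fin.
- apply: measurable_funTS; apply: emeasurable_funM; last exact/measurable_EFinP.
  exact: measurableT_comp.
apply: filterS2 aef aeg => u fu gu Iu.
have {}fu := fu Iu; have {}gu := gu Iu.
have := H _ _ fu gu; rewrite -/(z u) => Hu.
have fg : (0 <= (f (x u) * g (y u))^-1)%R by rewrite invr_ge0 mulr_ge0.
have := lee_wpmul2r _ Hu => /(_ ((f (x u) * g (y u))^-1)%:E).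
rewrite lee_fin => /(_ fg).
rewrite ge0_muleDl ?mule_ge0 ?lee_fin//.
rewrite -!muleA -!EFinM.
rewrite (_ : g (y u) * _ = (f (x u))^-1)%R; last by field; rewrite !gt_eqF.
rewrite (_ : f (x u) / _ = (g (y u))^-1)%R; last by field; rewrite !gt_eqF.
rewrite (_ : (l * _ + _) / _ = D0 u)%R// /D0; by field; rewrite !gt_eqF.
Qed.

End transport_line_real.

Section transport_line.
Context {R : realType}.
Local Open Scope ereal_scope.
Local Notation leb := (@lebesgue_measure R).
Local Notation T := (measurableTypeR R).

(** The same for densities with infinite values, which arise as marginals. *)
Lemma transport_line (l C : R) (F G : T -> \bar R) (al be h : T -> \bar R) :
  (0 < l < 1)%R -> 
  measurable_fun [set: T] F -> (forall t, 0 <= F t) -> \int[leb]_t F t = 1 ->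
  measurable_fun [set: T] G -> (forall t, 0 <= G t) -> \int[leb]_t G t = 1 ->
  measurable_fun [set: T] al -> (forall t, 0 <= al t) ->
  measurable_fun [set: T] be -> (forall t, 0 <= be t) ->
  measurable_fun [set: T] h -> (forall t, 0 <= h t) ->
  (forall t, al t <= C%:E * F t) -> (forall t, be t <= C%:E * G t) ->
  (forall s t (f g : R), (0 < f)%R -> (0 < g)%R -> F s = f%:E -> G t = g%:E ->
     al s * g%:E + be t * f%:E <=
     h (l * s + (1 - l) * t)%R * (l * g + (1 - l) * f)%:E) ->
  \int[leb]_t al t + \int[leb]_t be t <= \int[leb]_t h t.
Proof.
move=> l01 mF F0 F1 mG G0 G1 mal al0 mbe be0 mh h0 alF beG H.
pose fin (K a : T -> \bar R) (t : T) := if K t == +oo then 0 else a t.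
have finP (K a : T -> \bar R) : measurable_fun [set: T] K -> (forall t, 0 <= K t) ->
    \int[leb]_t K t = 1 -> measurable_fun [set: T] a -> (forall t, 0 <= a t) ->
    [/\ measurable_fun [set: T] (fin K a), (forall t, 0 <= fin K a t) &
    \int[leb]_t a t = \int[leb]_t fin K a t].
  move=> mK K0 K1 ma a0.
  have mKoo : measurable_fun [set: T] (fun t => K t == +oo).
    apply: (measurable_fun_bool true).
    rewrite (_ : _ @^-1` _ = K @^-1` [set +oo]).
      by apply: mK => //; exact: emeasurable_set1.
    by apply/seteqP; split=> t /= /eqP.
  have mfin : measurable_fun [set: T] (fin K a).
    by apply: measurable_fun_ifT => //; exact: measurable_cst.
  have fin0 t : 0 <= fin K a t by rewrite /fin; case: ifP.
  split => //.
  apply: ae_eq_integral => //.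
  have : leb.-integrable setT K.
    apply/integrableP; split => //.
    by under eq_integral do rewrite gee0_abs//; rewrite K1 ltry.
  move=> /(integrable_ae measurableT) [N [mN N0 NK]]; exists N; split => // t /= tN.
  apply: NK => /= Kt; apply: tN => _; rewrite /fin ifF//.
  by apply/negbTE/eqP => Koo; move: (Kt I); rewrite Koo.
have [mal' al'0 ->] := finP F al mF F0 F1 mal al0.
have [mbe' be'0 ->] := finP G be mG G0 G1 mbe be0.
have [mF' F'0] := finP F F mF F0 F1 mF F0; rewrite F1 => /esym F'1.
have [mG' G'0] := finP G G mG G0 G1 mG G0; rewrite G1 => /esym G'1.
have fineF (K : T -> \bar R) t : (forall t, 0 <= K t) -> (fine (K t))%:E = fin K K t.
  move=> K0; rewrite /fin; case: ifPn => [/eqP ->//|Koo].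
  by rewrite fineK// ge0_fin_numE// ltey.
apply: (@transport_line_real _ l C (fun t => fine (F t)) (fun t => fine (G t))) => //.
- exact: measurableT_comp.
- by move=> t; rewrite fine_ge0.
- by under eq_integral do rewrite fineF//.
- exact: measurableT_comp.
- by move=> t; rewrite fine_ge0.
- by under eq_integral do rewrite fineF//.
- move=> t; rewrite fineF// /fin; case: ifP => // _; first by rewrite mule0.
- move=> t; rewrite fineF// /fin; case: ifP => // _; first by rewrite mule0.
- move=> s t Fs Gt.
  have Fs' : F s != +oo by apply: contraTN Fs => /eqP ->; rewrite ltxx.
  have Gt' : G t != +oo by apply: contraTN Gt => /eqP ->; rewrite ltxx.
  rewrite /fin (negbTE Fs') (negbTE Gt'); apply: H => //.
    by rewrite fineK// ge0_fin_numE// ltey.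
  by rewrite fineK// ge0_fin_numE// ltey.
Qed.

End transport_line.

(** * Triangular transport in dimension n *)

Section tuples.
Context {R : realType}.
Local Open Scope ereal_scope.
Local Notation leb := (@lebesgue_measure R).
Local Notation T := (measurableTypeR R).

Lemma integral_leb_tupS n (f : n.+1.-tuple T -> \bar R) :
  measurable_fun [set: n.+1.-tuple T] f -> (forall x, 0 <= f x) ->
  \int[leb_tup n.+1]_x f x =
  \int[leb]_a \int[leb_tup n]_x f (cons_tup (a, x)).
Proof.
move=> mf f0.
rewrite -[LHS]/(\int[pushforward (leb \x leb_tup n) (@cons_tup R n)]_x f x).
rewrite (ge0_integral_pushforward (@measurable_cons_tup R n))//=.
rewrite preimage_setT fubini_tonelli1//.
by apply: measurableT_comp => //; exact: measurable_cons_tup.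
Qed.

Definition mix_tup n (l : R) (x y : n.-tuple T) : n.-tuple T :=
  [tuple (l * tnth x i + (1 - l) * tnth y i)%R | i < n].

Lemma mix_tup_cons n l a b (x y : n.-tuple T) :
  mix_tup l (cons_tup (a, x)) (cons_tup (b, y)) =
  cons_tup ((l * a + (1 - l) * b)%R, mix_tup l x y).
Proof.
apply: eq_from_tnth => i; rewrite tnth_mktuple.
by case: (unliftP ord0 i) => [j|] ->; rewrite ?tnthS ?tnth0// tnth_mktuple.
Qed.

Lemma measurable_cons_l n (f : n.+1.-tuple T -> \bar R) (a : T) :
  measurable_fun [set: n.+1.-tuple T] f ->
  measurable_fun [set: n.-tuple T] (fun x => f (cons_tup (a, x))).
Proof.
move=> mf; apply: (measurableT_comp mf).
apply: (measurableT_comp (@measurable_cons_tup R n)).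
exact: measurable_pair1.
Qed.

Lemma measurable_integral_cons n (f : n.+1.-tuple T -> \bar R) :
  measurable_fun [set: n.+1.-tuple T] f -> (forall x, 0 <= f x) ->
  measurable_fun [set: T] (fun a => \int[leb_tup n]_x f (cons_tup (a, x))).
Proof.
move=> mf f0.
apply: (@measurable_fun_fubini_tonelli_F _ _ _ _ _ _ (fun z => f (cons_tup z))) => //.
by apply: measurableT_comp => //; exact: measurable_cons_tup.
Qed.

(** The list s stands for the successive conditional densities of F at x and of G at y, so
    that a triangular transport has diagonal derivatives q.1 / q.2. Quantifying over all
    factorizations of F x and G y makes the induction immediate: sections divided by their
    masses f and g satisfy the hypothesis with the pair (f, g) prepended to the list, and
    the induction hypothesis is then the hypothesis of the one-dimensional statement for
    the marginals. In dimension 0 the normalization forces F = G = 1. *)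
Lemma transport_tuple n (l C : R) (F G al be h : n.-tuple T -> \bar R) :
  (0 < l < 1)%R -> (0 <= C)%R ->
  measurable_fun [set: n.-tuple T] F -> (forall t, 0 <= F t) -> \int[leb_tup n]_t F t = 1 ->
  measurable_fun [set: n.-tuple T] G -> (forall t, 0 <= G t) -> \int[leb_tup n]_t G t = 1 ->
  measurable_fun [set: n.-tuple T] al -> (forall t, 0 <= al t) ->
  measurable_fun [set: n.-tuple T] be -> (forall t, 0 <= be t) ->
  measurable_fun [set: n.-tuple T] h -> (forall t, 0 <= h t) ->
  (forall t, al t <= C%:E * F t) -> (forall t, be t <= C%:E * G t) ->
  (forall x y (s : seq (R * R)), size s = n -> all (fun p => (0 < p.1) && (0 < p.2))%R s ->
     F x = (\prod_(p <- s) p.1)%:E -> G y = (\prod_(p <- s) p.2)%:E ->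
     al x * (\prod_(p <- s) p.2)%:E + be y * (\prod_(p <- s) p.1)%:E <=
     h (mix_tup l x y) * (\prod_(p <- s) (l * p.2 + (1 - l) * p.1))%:E) ->
  \int[leb_tup n]_t al t + \int[leb_tup n]_t be t <= \int[leb_tup n]_t h t.
Proof.
move=> l01.
elim: n => [|n IH] in C F G al be h *; move=> C0 mF F0 F1 mG G0 G1 mal al0 mbe be0 mh h0
    alF beG H.
  move: F1 G1; rewrite /= !integral_dirac//= !diracT !mul1e => F1 G1.
  have := H [tuple] [tuple] [::]; rewrite !big_nil/= !mule1 F1 G1.
  rewrite (tuple0 (mix_tup l _ _)).
  by apply.
rewrite !integral_leb_tupS//.
have F1' := F1; rewrite integral_leb_tupS// in F1'.
have G1' := G1; rewrite integral_leb_tupS// in G1'.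
have ige0 (f : n.+1.-tuple T -> \bar R) : (forall x, 0 <= f x) ->
   forall a, 0 <= \int[leb_tup n]_x f (cons_tup (a, x)).
  by move=> f0 a; exact: integral_ge0.
have ile (f k : n.+1.-tuple T -> \bar R) : 
   measurable_fun [set: n.+1.-tuple T] f -> (forall x, 0 <= f x) ->
   measurable_fun [set: n.+1.-tuple T] k -> (forall x, 0 <= k x) ->
   (forall t, k t <= C%:E * f t) ->
   forall a, \int[leb_tup n]_x k (cons_tup (a, x)) <= C%:E * \int[leb_tup n]_x f (cons_tup
       (a, x)).
  move=> mf f0 mk k0 kf a.
  rewrite -ge0_integralZl_EFin//; last exact: measurable_cons_l.
  apply: ge0_le_integral => //; first exact: measurable_cons_l.
  by apply: emeasurable_funM => //; exact: measurable_cons_l.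
apply: (@transport_line _ l C _ _ _ _ _ l01
  (measurable_integral_cons mF F0) (ige0 _ F0) F1'
  (measurable_integral_cons mG G0) (ige0 _ G0) G1'
  (measurable_integral_cons mal al0) (ige0 _ al0)
  (measurable_integral_cons mbe be0) (ige0 _ be0)
  (measurable_integral_cons mh h0) (ige0 _ h0) (ile _ _ mF F0 mal al0 alF) (ile _ _ mG G0
      mbe be0 beG)).
move=> a b f g f0 g0 Fa Gb.
have l0 : (0 <= l * g + (1 - l) * f)%R.
  have /andP[? ?] := l01.
  by rewrite addr_ge0// mulr_ge0 ?ltW// subr_gt0.
have mZ (k : n.+1.-tuple T -> \bar R) (c : R) (e : T) : measurable_fun [set: n.+1.-tuple T] k ->
    measurable_fun [set: n.-tuple T] (fun x => c%:E * k (cons_tup (e, x))).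
  by move=> mk; apply: emeasurable_funM => //; exact: measurable_cons_l.
have Z0 (k : n.+1.-tuple T -> \bar R) c (e : T) : (0 <= c)%R -> (forall x, 0 <= k x) ->
    forall x : n.-tuple T, 0 <= c%:E * k (cons_tup (e, x)).
  by move=> c0 k0 x; rewrite mule_ge0.
have intZ (k : n.+1.-tuple T -> \bar R) c (e : T) : (0 <= c)%R ->
     measurable_fun [set: n.+1.-tuple T] k -> (forall x, 0 <= k x) ->
     \int[leb_tup n]_x (c%:E * k (cons_tup (e, x))) = c%:E * \int[leb_tup n]_x k (cons_tup
         (e, x)).
  by move=> c0 mk k0; rewrite ge0_integralZl_EFin//; exact: measurable_cons_l.
have [fi gi] : (0 <= f^-1 /\ 0 <= g^-1)%R by rewrite !invr_ge0 !ltW.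
have [f0' g0'] : (0 <= f /\ 0 <= g)%R by rewrite !ltW.
rewrite ![_ * _%:E]muleC -!intZ//.
apply: (IH (C * f * g)%R (fun x => (f^-1)%:E * F (cons_tup (a, x))) (fun x => (g^-1)%:E * G
    (cons_tup (b, x)))) => //.
- by rewrite !mulr_ge0.
- exact: mZ.
- exact: Z0.
- by rewrite intZ// Fa -EFinM mulVf// gt_eqF.
- exact: mZ.
- exact: Z0.
- by rewrite intZ// Gb -EFinM mulVf// gt_eqF.
- exact: mZ.
- exact: Z0.
- exact: mZ.
- exact: Z0.
- exact: mZ.
- exact: Z0.
- move=> x; rewrite muleA -EFinM mulrAC mulfK ?gt_eqF// [(C * g)%R]mulrC EFinM -muleA.
  by rewrite lee_wpmul2l.
- move=> x; rewrite muleA -EFinM mulfK ?gt_eqF// [(C * f)%R]mulrC EFinM -muleA.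
  by rewrite lee_wpmul2l.
move=> x y s sn s0 Fx Gy.
have FE : F (cons_tup (a, x)) = (\prod_(p <- (f, g) :: s) p.1)%:E.
  by rewrite big_cons/= EFinM -Fx muleA -EFinM mulfV ?mul1e// gt_eqF.
have GE : G (cons_tup (b, y)) = (\prod_(p <- (f, g) :: s) p.2)%:E.
  by rewrite big_cons/= EFinM -Gy muleA -EFinM mulfV ?mul1e// gt_eqF.
have := H (cons_tup (a, x)) (cons_tup (b, y)) ((f, g) :: s).
rewrite /= sn f0 g0 s0 => /(_ erefl isT FE GE).
rewrite mix_tup_cons !big_cons/= !EFinM.
by rewrite [g%:E * al _]muleC [f%:E * be _]muleC [_ * h _]muleC -!muleA.
Qed.

End tuples.

Section row_vectors.
Context {R : realType}.
Local Open Scope ereal_scope.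
Local Notation leb := (@lebesgue_measure R).
Local Notation T := (measurableTypeR R).

Definition scale_tup n (k : R) (x : n.-tuple T) : n.-tuple T :=
  [tuple (k * tnth x i)%R | i < n].

Lemma scale_tup_cons n k a (x : n.-tuple T) :
  scale_tup k (cons_tup (a, x)) = cons_tup ((k * a)%R, scale_tup k x).
Proof.
apply: eq_from_tnth => i; rewrite tnth_mktuple.
by case: (unliftP ord0 i) => [j|] ->; rewrite ?tnthS ?tnth0// tnth_mktuple.
Qed.

Lemma measurable_scale_tup n k :
  measurable_fun [set: n.-tuple T] (@scale_tup n k).
Proof.
apply/measurable_fun_tnthP => i /=.
rewrite (_ : _ \o _ = fun x : n.-tuple T => (k * tnth x i)%R).
  by apply: measurable_funM => //; exact: measurable_tnth.
by apply/funext => x; rewrite /= tnth_mktuple.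
Qed.

Lemma ge0_le_integral_scale_tup n (k : R) (f : n.-tuple T -> \bar R) : (0 < k)%R ->
  measurable_fun [set: n.-tuple T] f -> (forall x, 0 <= f x) ->
  (k^-1 ^+ n)%:E * \int[leb_tup n]_x f x <= \int[leb_tup n]_x f (scale_tup k x).
Proof.
move=> k0; elim: n f => [|n IH] f mf f0.
  rewrite expr0 mul1e; apply: ge0_le_integral => //.
    by apply: measurableT_comp => //; exact: measurable_scale_tup.
  by move=> x _; rewrite (tuple0 (scale_tup k x)) (tuple0 x).
rewrite !integral_leb_tupS//; last first.
  by apply: measurableT_comp => //; exact: measurable_scale_tup.
have k'0 : (0 <= k^-1)%R by rewrite invr_ge0 ltW.
pose J a := \int[leb_tup n]_x f (cons_tup (a, x)).
have J0 a : 0 <= J a by exact: integral_ge0.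
have mJ : measurable_fun [set: T] J by exact: measurable_integral_cons.
apply: (@le_trans _ _ (\int[leb]_a ((k^-1 ^+ n)%:E * J (k * a)%R))).
  rewrite ge0_integralZl_EFin//; last 2 first.
  - by apply: measurableT_comp => //; exact: measurable_funM.
  - by rewrite exprn_ge0.
  rewrite exprSr EFinM -muleA lee_wpmul2l//; last exact: ge0_le_integral_scale.
  by rewrite lee_fin exprn_ge0.
apply: ge0_le_integral => //.
- by move=> a _; rewrite mule_ge0// lee_fin exprn_ge0.
- apply: emeasurable_funM => //; apply: measurableT_comp => //; exact: measurable_funM.
- apply: (measurable_integral_cons (f := fun x => f (scale_tup k x))) => //.
  by apply: measurableT_comp => //; exact: measurable_scale_tup.
- move=> a _; under [leRHS]eq_integral do rewrite scale_tup_cons.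
  by apply: (IH (fun x => f (cons_tup ((k * a)%R, x)))) => //; exact: measurable_cons_l.
Qed.

Section rV.
Variable n : nat.
Local Notation E := (borel_rV R n).

Lemma ge0_integral_rV (f : E -> \bar R) :
  measurable_fun [set: E] f -> (forall x, 0 <= f x) ->
  \int[lebesgue_rV R n]_x f x = \int[leb_tup n]_t f (rV_of_tuple t).
Proof.
move=> mf f0.
rewrite -[LHS]/(\int[pushforward (leb_tup n) (@rV_of_tuple R n)]_x f x).
by rewrite (ge0_integral_pushforward (@measurable_rV_of_tuple R n)).
Qed.

Lemma measurable_rV_tuple (f : E -> \bar R) : measurable_fun [set: E] f ->
  measurable_fun [set: n.-tuple T] (fun t => f (rV_of_tuple t)).
Proof. by move=> mf; apply: (measurableT_comp mf); exact: measurable_rV_of_tuple. Qed.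

Lemma ge0_le_integral_scale_rV (k : R) (f : E -> \bar R) : (0 < k)%R ->
  measurable_fun [set: E] f -> (forall x, 0 <= f x) ->
  measurable_fun [set: E] (fun x => f (k *: x)%R) ->
  (k^-1 ^+ n)%:E * \int[lebesgue_rV R n]_x f x <=
  \int[lebesgue_rV R n]_x f (k *: x)%R.
Proof.
move=> k0 mf f0 mfk; rewrite !ge0_integral_rV//.
rewrite [leRHS](_ : _ = \int[leb_tup n]_t f (rV_of_tuple (scale_tup k t))).
  exact: (ge0_le_integral_scale_tup k0 (measurable_rV_tuple mf)).
apply: eq_integral => t _; congr f; apply/rowP => i.
by rewrite !mxE tnth_mktuple.
Qed.

Lemma transport_rV (l C : R) (F G al be h : E -> \bar R) :
  (0 < l < 1)%R -> (0 <= C)%R ->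
  measurable_fun [set: E] F -> (forall t, 0 <= F t) -> \int[lebesgue_rV R n]_t F t = 1 ->
  measurable_fun [set: E] G -> (forall t, 0 <= G t) -> \int[lebesgue_rV R n]_t G t = 1 ->
  measurable_fun [set: E] al -> (forall t, 0 <= al t) ->
  measurable_fun [set: E] be -> (forall t, 0 <= be t) ->
  measurable_fun [set: E] h -> (forall t, 0 <= h t) ->
  (forall t, al t <= C%:E * F t) -> (forall t, be t <= C%:E * G t) ->
  (forall x y (s : seq (R * R)), size s = n -> all (fun p => (0 < p.1) && (0 < p.2))%R s ->
     F x = (\prod_(p <- s) p.1)%:E -> G y = (\prod_(p <- s) p.2)%:E ->
     al x * (\prod_(p <- s) p.2)%:E + be y * (\prod_(p <- s) p.1)%:E <=
     h (l *: x + (1 - l) *: y)%R * (\prod_(p <- s) (l * p.2 + (1 - l) * p.1))%:E) ->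
  \int[lebesgue_rV R n]_t al t + \int[lebesgue_rV R n]_t be t <= \int[lebesgue_rV R n]_t h t.
Proof.
move=> l01 C0 mF F0 F1 mG G0 G1 mal al0 mbe be0 mh h0 alF beG H.
rewrite ge0_integral_rV// in F1; rewrite ge0_integral_rV// in G1.
rewrite !ge0_integral_rV//.
apply: (@transport_tuple _ _ l C (fun t => F (rV_of_tuple t)) (fun t => G (rV_of_tuple t)))
    => //; do ?exact: measurable_rV_tuple.
move=> x y s sn s0 Fx Gy.
have := H _ _ s sn s0 Fx Gy.
rewrite (_ : _ + _ = rV_of_tuple (mix_tup l x y))%R//.
by apply/rowP => i; rewrite !mxE tnth_mktuple.
Qed.

Let measurable_pair_rV (f : E * T -> \bar R) : measurable_fun [set: E * T] f ->
  measurable_fun [set: n.-tuple T * T] (fun z => f (rV_of_tuple z.1, z.2)).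
Proof.
move=> mf; apply: (measurableT_comp mf); apply: measurable_fun_pair => //.
by apply: (measurableT_comp (@measurable_rV_of_tuple R n)); exact: measurable_fst.
Qed.

Let integral_pair_rV (f : E * T -> \bar R) t : measurable_fun [set: E * T] f ->
  (forall z, 0 <= f z) ->
  \int[lebesgue_rV R n]_x f (x, t) = \int[leb_tup n]_x f (rV_of_tuple x, t).
Proof.
move=> mf f0; rewrite ge0_integral_rV//.
by apply: (measurableT_comp mf); exact: measurable_pair2.
Qed.

Lemma measurable_fun_fubini_tonelli_rV (f : E * T -> \bar R) :
  measurable_fun [set: E * T] f -> (forall z, 0 <= f z) ->
  measurable_fun [set: T] (fun t => \int[lebesgue_rV R n]_x f (x, t)).
Proof.
move=> mf f0.
apply: (eq_measurable_fun (fun t => \int[leb_tup n]_x f (rV_of_tuple x, t))).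
  by move=> t _; rewrite integral_pair_rV.
apply: (@measurable_fun_fubini_tonelli_G _ _ _ _ R (leb_tup n)
  (fun z : n.-tuple T * T => f (rV_of_tuple z.1, z.2))) => //.
exact: measurable_pair_rV.
Qed.

Lemma fubini_tonelli_rV (f : E * T -> \bar R) :
  measurable_fun [set: E * T] f -> (forall z, 0 <= f z) ->
  \int[lebesgue_rV R n]_x \int[leb]_t f (x, t) =
  \int[leb]_t \int[lebesgue_rV R n]_x f (x, t).
Proof.
move=> mf f0.
rewrite ge0_integral_rV//; last 2 first.
- exact: (@measurable_fun_fubini_tonelli_F _ _ _ _ _ _ f).
- by move=> x; exact: integral_ge0.
have /= -> := @fubini_tonelli _ _ _ _ R (leb_tup n) leb _ (measurable_pair_rV mf) (fun z =>
    f0 _).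
by apply: eq_integral => t _; rewrite integral_pair_rV.
Qed.

End rV.
End row_vectors.

(** * Homogeneous convex functions *)

Lemma convex_functionE (R : realType) n (V : 'rV[R]_n -> R) :
  convex_function setT V ->
  forall t x y, 0 <= t <= 1 -> V (t *: x + (1 - t) *: y) <= t * V x + (1 - t) * V y.
Proof.
move=> cV t x y t01.
have [t0 t1] : 0 <= t /\ t <= 1 by apply/andP.
have := cV (Itv01 t0 t1) x y (in_setT _) (in_setT _).
by [].
Qed.

Lemma convex_setE (R : realType) n (K : set 'rV[R]_n) :
  convex_set K ->
  forall t x y, 0 <= t <= 1 -> K x -> K y -> K (t *: x + (1 - t) *: y).
Proof.
move=> cK t x y t01 Kx Ky.
have [t0 t1] : 0 <= t /\ t <= 1 by apply/andP.
have := cK x y (Itv01 t0 t1) (mem_set Kx) (mem_set Ky).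
by rewrite inE.
Qed.

Section homogeneous_convex.
Context {R : realType} {n : nat} (p : R) (V : 'rV[R]_n -> R).
Hypothesis V0 : forall x, 0 <= V x.
Hypothesis homV : homogeneous p V.
Hypothesis cV : forall t x y, 0 <= t <= 1 ->
  V (t *: x + (1 - t) *: y) <= t * V x + (1 - t) * V y.

Lemma homogeneous_add_le x y : V (x + y) <= 2 `^ p * (V x + V y).
Proof.
have -> : x + y = (2^-1 : R) *: (2 *: x) + (1 - 2^-1) *: (2 *: y).
  have -> : 1 - 2^-1 = 2^-1 :> R by lra.
  by rewrite !scalerA mulVf// !scale1r.
apply: (le_trans (cV _ _ _)); first lra.
rewrite !homV// mulrDr !mulrA.
have t2 : 0 <= 2 `^ p :> R by exact: powR_ge0.
have -> : 1 - 2^-1 = 2^-1 :> R by lra.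
by rewrite lerD// ler_wpM2r// ger_pMl ?powR_gt0//; lra.
Qed.

(** V is bounded on the coordinate segments by convexity, and sums cost a constant factor. *)
Lemma homogeneous_bounded_ball : exists2 M, 0 <= M &
  forall v : 'rV[R]_n, (forall i, `|v ord0 i| <= 1) -> V v <= M.
Proof.
suff [M M0 MV] : exists2 M, 0 <= M & forall v : 'rV[R]_n, (forall i, `|v ord0 i| <= 1) ->
    V (\sum_(i <- index_enum 'I_n) v ord0 i *: delta_mx 0 i) <= M.
  by exists M => // v v1; rewrite [v]row_sum_delta MV.
elim: (index_enum _) => [|i r [M M0 IH]].
  by exists (V 0) => // v _; rewrite big_nil.
exists (2 `^ p * (V (delta_mx 0 i) + V (- delta_mx 0 i) + M)).
  by rewrite mulr_ge0 ?powR_ge0// !addr_ge0.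
move=> v v1; rewrite big_cons (le_trans (homogeneous_add_le _ _))//.
rewrite ler_wpM2l ?powR_ge0// lerD ?IH//.
have := v1 i; move: (v ord0 i) => a; rewrite ler_norml => /andP[a0 a1].
have -> : a *: delta_mx 0 i = ((1 + a) / 2) *: delta_mx 0 i +
   (1 - (1 + a) / 2) *: (- delta_mx 0 i) :> 'rV[R]_n.
  by rewrite scalerN -scalerBl; congr (_ *: _); field.
apply: (le_trans (cV _ _ _)); first lra.
by rewrite lerD// ler_piMl//; lra.
Qed.

(** Upper semicontinuity suffices for measurability. For r close to 1, write y near x as
    the convex combination of x / r and of a vector (y - x) / (1 - r) of norm at most 1. *)
Lemma homogeneous_sublevel_open (c : R) : open [set x | V x < c].
Proof.
have [M M0 MV] := homogeneous_bounded_ball.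
rewrite openE => x /= xc.
have : (fun r : R => r * (r `^ (- p)) * V x + (1 - r) * M) r @[r --> (1:R)] --> 1 * (1 `^
    (- p)) * V x + (1 - 1) * M.
  apply: cvgD; apply: cvgM; try exact: cvg_cst.
    apply: cvgM; first exact: cvg_id.
    exact: cvg_powR.
  by apply: cvgB; [exact: cvg_cst|exact: cvg_id].
rewrite powR1 subrr mul0r !mul1r addr0 => cvg_r.
have [r [r0 r1 rc]] : exists r : R, [/\ 0 < r, r < 1 & r * (r `^ (- p)) * V x + (1 - r) * M
    < c].
  have near1 : \forall r \near (1:R), r * (r `^ (- p)) * V x + (1 - r) * M < c.
    by move/cvgr_lt : cvg_r; exact.
  have near2 : \forall r \near (1:R)^'-, [/\ 0 < r, r < 1 & r * (r `^ (- p)) * V x + (1 -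
      r) * M < c].
    near=> r; split => //.
    near: r; move: near1 => [e /= e0 He]; exists e => //= y ye _; exact: He.
  by have /filter_ex := near2.
pose s := 1 - r.
have s0 : 0 < s by rewrite subr_gt0.
apply/nbhs_ballP; exists s => //= y [_ xy].
rewrite (_ : y = r *: (r^-1 *: x) + (1 - r) *: (s^-1 *: (y - x))); last first.
  by rewrite !scalerA mulfV ?gt_eqF// mulfV ?gt_eqF// !scale1r addrC subrK.
apply: le_lt_trans (rc); apply: (le_trans (cV _ _ _)); first by rewrite !ltW.
rewrite homV ?invr_gt0// mulrA -powR_inv1 ?(ltW r0)// -powRrM mulN1r.
rewrite lerD2l ler_pM2l// MV// => i.
have := xy ord0 i; rewrite /ball/= !mxE => /ltW xyi.
by rewrite normrM gtr0_norm ?invr_gt0// ler_pdivrMl// mulr1 distrC.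
Unshelve. all: by end_near. Qed.

End homogeneous_convex.

Section pointwise.
Context {R : realType} {n : nat} (p : R) (V : 'rV[R]_n -> R).
Hypothesis p1 : 1 < p.
Hypothesis n0 : (0 < n)%N.
Hypothesis V0 : forall x, 0 <= V x.
Hypothesis homV : homogeneous p V.
Hypothesis cV : forall t x y, 0 <= t <= 1 ->
  V (t *: x + (1 - t) *: y) <= t * V x + (1 - t) * V y.

Let nR0 : 0 < n%:R :> R. Proof. by rewrite ltr0n. Qed.

(** The midpoint of x and y is also a convex combination of x / (1 + u) and y / (1 - u),
    with weights (1 + u) / 2 and (1 - u) / 2. The freedom in u encodes the convexity of
    V^(1/p), without taking roots. *)
Lemma midpoint_le_powR (x y : 'rV[R]_n) (u : R) : `|u| < 1 ->
  V (2^-1 *: x + (1 - 2^-1) *: y) <=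
  ((1 + u) `^ (1 - p) * V x + (1 - u) `^ (1 - p) * V y) / 2.
Proof.
move=> /ltr_normlP[u1 u2].
have a0 : 0 < 1 + u by lra.
have b0 : 0 < 1 - u by lra.
have -> : 2^-1 *: x + (1 - 2^-1) *: y =
    ((1 + u) / 2) *: ((1 + u)^-1 *: x) + (1 - (1 + u) / 2) *: ((1 - u)^-1 *: y).
  rewrite !scalerA; congr (_ *: _ + _ *: _); field; rewrite gt_eqF//; lra.
apply: (le_trans (cV _ _ _)); first lra.
rewrite !homV ?invr_gt0//.
have pw (a : R) : 0 < a -> a * a^-1 `^ p = a `^ (1 - p).
  move=> a_gt0; rewrite -powR_inv1 ?(ltW a_gt0)// -powRrM mulN1r powRD ?powRr1 ?(ltW a_gt0)//.
  by rewrite (gt_eqF a_gt0) implybT.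
rewrite -!pw// le_eqVlt; apply/orP; left; apply/eqP.
by field.
Qed.

(** The effective dimension N = n + V p / (p - 1) appears here. If V x and V y differ by
    more than 3 |rho|, the square on the right-hand side is at least 4 rho^2, which is more
    than required since N >= n. Otherwise u = rho / (2 (p - 1) N), with N taken at the
    average of V x and V y, is the choice for which the terms linear in V y - V x cancel. *)
Lemma pointwise_midpoint (e : R) : 0 < e ->
  exists2 rho0 : R, 0 < rho0 & forall rho x y, `|rho| <= rho0 ->
    1 + rho ^+ 2 / 16 * ((n%:R + p / (p - 1) * V x)^-1 + (n%:R + p / (p - 1) * V y)^-1)
      - e * rho ^+ 2 <=
    expR ((V x + V y) / 2 - V (2^-1 *: x + (1 - 2^-1) *: y)) *
      (1 + (rho + (V y - V x)) ^+ 2 / (8 * n%:R)).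
Proof.
move=> e0.
pose q := p / (p - 1).
have p10 : 0 < p - 1 by rewrite subr_gt0.
have q0 : 0 < q by rewrite divr_gt0// (lt_trans _ p1).
(* the Taylor remainder of relative size d contributes d / (8 n) = e / 2 *)
pose d := 4 * n%:R * e.
have d0 : 0 < d by rewrite !mulr_gt0.
have [r /andP[r0 r1] Hr] := powR_taylor2_le p1 d0.
pose rho0 := Num.min 1 (Num.min ((p - 1) * n%:R * r) (16 * n%:R ^+ 3 * e / (9 * q ^+ 2))).
exists rho0.
  by rewrite !lt_min ltr01/= !mulr_gt0//= ?exprn_gt0// invr_gt0 mulr_gt0// exprn_gt0.
move=> rho x y; rewrite !le_min => /and3P[rho1 rho2 rho3].
set A := V x; set B := V y; set z := 2^-1 *: x + _.
have A0 : 0 <= A by exact: V0.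
have B0 : 0 <= B by exact: V0.
have w0 : 0 <= (A + B) / 2 - V z.
  have := @cV 2^-1 x y; rewrite -/z -/A -/B => h.
  have : V z <= 2^-1 * A + (1 - 2^-1) * B by apply: h; lra.
  lra.
have qA : 0 <= q * A by rewrite mulr_ge0// ltW.
have qB : 0 <= q * B by rewrite mulr_ge0// ltW.
have X0 : 0 <= (rho + (B - A)) ^+ 2 / (8 * n%:R) by rewrite divr_ge0 ?sqr_ge0// mulr_ge0.
suff main : rho ^+ 2 / 16 * ((n%:R + q * A)^-1 + (n%:R + q * B)^-1) - e * rho ^+ 2 <=
    ((A + B) / 2 - V z) + (rho + (B - A)) ^+ 2 / (8 * n%:R).
  apply: (@le_trans _ _ ((1 + ((A + B) / 2 - V z)) * (1 + (rho + (B - A)) ^+ 2 / (8 * n%:R)))).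
    rewrite -addrA; move: main X0 w0.
    move: (_ - e * _) => l; move: (_ / (8 * _)) ((A + B) / 2 - V z) => X w; nra.
  by rewrite ler_wpM2r ?expR_ge1Dx// addr_ge0.
have [Drho|Drho] := leP `|B - A| (3 * `|rho|); last first.
  have X4 : 4 * rho ^+ 2 <= (rho + (B - A)) ^+ 2.
    rewrite -[rho ^+ 2]real_normK ?num_real// -[(rho + _) ^+ 2]real_normK ?num_real//.
    have : 2 * `|rho| <= `|rho + (B - A)|.
      have := ler_normB (rho + (B - A)) rho; rewrite addrAC subrr add0r; lra.
    have := normr_ge0 rho; nra.
  have iN (s : R) : 0 <= s -> (n%:R + s)^-1 <= n%:R^-1.
    by move=> s0; rewrite lef_pV2 ?posrE ?lerDl// ltr_pwDl.
  have X' : rho ^+ 2 * n%:R^-1 / 2 <= (rho + (B - A)) ^+ 2 / (8 * n%:R).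
    rewrite (_ : _ / 2 = (4 * rho ^+ 2) / (8 * n%:R)); last by field; rewrite gt_eqF.
    by rewrite ler_wpM2r// invr_ge0 mulr_ge0.
  have er : 0 <= e * rho ^+ 2 by rewrite mulr_ge0 ?sqr_ge0// ltW.
  have H (s m a b : R) : 0 <= s -> 0 <= m -> a <= m -> b <= m -> s / 16 * (a + b) <= s * m / 2.
    by nra.
  have ni : 0 <= n%:R^-1 :> R by rewrite invr_ge0.
  have {H iN} := H _ _ _ _ (sqr_ge0 rho) ni (iN _ qA) (iN _ qB).
  lra.
pose N := n%:R + q * ((A + B) / 2).
have N0 : 0 < N by rewrite ltr_pwDl// mulr_ge0 ?(ltW q0)//; lra.
have nN : n%:R <= N by rewrite lerDl mulr_ge0 ?(ltW q0)//; lra.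
apply: (@le_trans _ _ (rho ^+ 2 / (8 * N) - e / 2 * rho ^+ 2)).
  apply: midpoint_scalar_ineq => //.
  move: rho3; rewrite ler_pdivlMr; last by rewrite mulr_gt0// exprn_gt0.
  have q9 : 0 <= 9 * q ^+ 2 by rewrite mulr_ge0// sqr_ge0.
  apply: le_trans; rewrite mulrC ler_wpM2r//.
  rewrite -[rho ^+ 2]real_normK ?num_real// expr2 ler_piMl//.
pose u := rho / (2 * (p - 1) * N).
have ur : `|u| < r.
  rewrite /u normrM normfV [X in _ / X]gtr0_norm ?mulr_gt0//.
  rewrite ltr_pdivrMr ?mulr_gt0//; apply: le_lt_trans rho2 _.
  rewrite mulrC ltr_pM2l//.
  have : (p - 1) * n%:R <= (p - 1) * N by rewrite ler_pM2l.
  have : 0 < (p - 1) * n%:R by rewrite mulr_gt0.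
  lra.
have u1 : `|u| < 1 by exact: lt_trans r1.
have Vz := midpoint_le_powR x y u1.
have h1 := Hr _ ur; have := Hr (- u); rewrite normrN => /(_ ur); rewrite sqrrN => h2.
have {h1} h1 := ler_wpM2r A0 h1; have {h2} h2 := ler_wpM2r B0 h2.
rewrite -/z -/A -/B in Vz.
have w1 : (p - 1) * u * (A - B) / 2 - p * (p - 1) * (1 + d) / 2 * u ^+ 2 * ((A + B) / 2) <=
   (A + B) / 2 - V z.
  by move: Vz h1 h2; move: ((1 + u) `^ _ * A) ((1 - u) `^ _ * B) => a b; lra.
apply: le_trans (lerD w1 (lexx _)).
(* the square is bounded below by its tangent line at kap *)
pose kap := n%:R * rho / N.
have hX : (2 * kap * (rho + (B - A)) - kap ^+ 2) / (8 * n%:R) <= (rho + (B - A)) ^+ 2 / (8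
    * n%:R).
  rewrite ler_wpM2r ?invr_ge0 ?mulr_ge0//.
  have := sqr_ge0 (rho + (B - A) - kap); lra.
apply: le_trans (lerD (lexx _) hX).
have -> : (p - 1) * u * (A - B) / 2 -
    p * (p - 1) * (1 + d) / 2 * u ^+ 2 * ((A + B) / 2) +
    (2 * kap * (rho + (B - A)) - kap ^+ 2) / (8 * n%:R) =
    rho ^+ 2 / (8 * N) - d * rho ^+ 2 * (q * ((A + B) / 2)) / (8 * N ^+ 2).
  have u2 : (p - 1) * u = rho / (2 * N).
    by rewrite /u; field; rewrite !gt_eqF.
  have u3 : p * (p - 1) * (1 + d) / 2 * u ^+ 2 = q * (1 + d) * rho ^+ 2 / (8 * N ^+ 2).
    by rewrite /u /q; field; rewrite !gt_eqF.
  rewrite u2 u3 /kap.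
  have mE : q * ((A + B) / 2) = N - n%:R by rewrite /N addrAC subrr add0r.
  have -> : q * (1 + d) * rho ^+ 2 / (8 * N ^+ 2) * ((A + B) / 2) =
     (1 + d) * rho ^+ 2 / (8 * N ^+ 2) * (N - n%:R) by rewrite -mE; ring.
  have id3 (M : R) : 0 < M ->
      rho / (2 * M) * (A - B) / 2 - (1 + d) * rho ^+ 2 / (8 * M ^+ 2) * (M - n%:R) +
      (2 * (n%:R * rho / M) * (rho + (B - A)) - (n%:R * rho / M) ^+ 2) / (8 * n%:R) =
      rho ^+ 2 / (8 * M) - d * rho ^+ 2 * (M - n%:R) / (8 * M ^+ 2).
    by move=> M0; field; rewrite !gt_eqF.
  by rewrite mE; exact: id3.
rewrite lerD2l lerN2.
have qN : q * ((A + B) / 2) <= N by rewrite lerDr.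
rewrite ler_pdivrMr ?mulr_gt0 ?exprn_gt0//.
rewrite /d [leRHS](_ : _ = 4 * e * rho ^+ 2 * (N * N)); last by field.
rewrite [leLHS](_ : _ = 4 * e * rho ^+ 2 * (n%:R * (q * ((A + B) / 2)))); last by ring.
apply: ler_wpM2l; first by rewrite mulr_ge0 ?sqr_ge0// mulr_ge0// ltW.
apply: ler_pM => //.
by rewrite mulr_ge0 ?(ltW q0)//; lra.
Qed.

End pointwise.

(** * Transport inequalities for the weighted measure *)

Section homogeneous_measure.
Context {R : realType} {n : nat} (p : R) (V : 'rV[R]_n -> R).
Local Notation E := (borel_rV R n).
Variable mu : {finite_measure set E -> \bar R}.
Hypothesis mV : measurable_fun [set: E] (V : E -> R).
Hypothesis muE : forall A : set E, measurable A ->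
    mu A = (\int[lebesgue_rV R n]_(x in A) (expR (- V x))%:E)%E.

Let measurable_expV : measurable_fun [set: E] (fun x : E => expR (- V x) : R).
Proof.
by apply: measurableT_comp => //; apply: measurableT_comp.
Qed.

Lemma integral_indic_density (K : set E) (a : E -> R) :
  (\int[lebesgue_rV R n]_x (a x * (expR (- V x) * \1_K x))%:E =
   \int[lebesgue_rV R n]_(x in K) (a x * expR (- V x))%:E)%E.
Proof.
rewrite [RHS]integral_mkcond; apply: eq_integral => x _.
by rewrite patchE indicE; case: ifPn; rewrite ?mulr1// !mulr0.
Qed.

(** [transport_rV] for the normalized restrictions to K and L of the weight, and for the
    restriction of the weight to M. *)
Lemma transport_measure (l C : R) (K L M : set E) (a b : E -> R) :
  0 < l < 1 -> measurable K -> measurable L -> measurable M ->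
  (0 < mu K)%E -> (0 < mu L)%E ->
  (forall x y, K x -> L y -> M (l *: x + (1 - l) *: y)) ->
  measurable_fun [set: E] a -> (forall x, 0 <= a x <= C) ->
  measurable_fun [set: E] b -> (forall x, 0 <= b x <= C) ->
  (forall x y (s : seq (R * R)), K x -> L y -> size s = n ->
     all (fun q => (0 < q.1) && (0 < q.2)) s ->
     \prod_(q <- s) q.1 = expR (- V x) / fine (mu K) ->
     \prod_(q <- s) q.2 = expR (- V y) / fine (mu L) ->
     (a x + b y) * (\prod_(q <- s) q.1 * \prod_(q <- s) q.2) <=
     expR (- V (l *: x + (1 - l) *: y)) * \prod_(q <- s) (l * q.2 + (1 - l) * q.1)) ->
  (((fine (mu K))^-1)%:E * \int[lebesgue_rV R n]_(x in K) (a x * expR (- V x))%:E +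
   ((fine (mu L))^-1)%:E * \int[lebesgue_rV R n]_(x in L) (b x * expR (- V x))%:E
   <= mu M)%E.
Proof.
move=> l01 mK mL mM K0 L0 KLM ma aC mb bC H.
pose k := fine (mu K); pose m := fine (mu L).
have muK : mu K = k%:E by exact: finite_measure_fine.
have muL : mu L = m%:E by exact: finite_measure_fine.
have k0 : 0 < k by rewrite -lte_fin -muK.
have m0 : 0 < m by rewrite -lte_fin -muL.
have C0 : 0 <= C by have /andP[+ +] := aC 0; exact: le_trans.
pose F (A : set E) (c : R) (x : E) : \bar R := (c^-1 * (expR (- V x) * \1_A x))%:E.
pose A_ (A : set E) (c : R) (d : E -> R) (x : E) : \bar R := (d x * (c^-1 * (expR (- V x) *
    \1_A x)))%:E.
have mF A c : measurable A -> measurable_fun [set: E] (F A c).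
  move=> mA; apply/measurable_EFinP; apply: measurable_funM => //.
  by apply: measurable_funM => //; exact: measurable_indic.
have F0 A c : 0 < c -> forall x, (0 <= F A c x)%E.
  by move=> c0 x; rewrite lee_fin mulr_ge0 ?invr_ge0 ?(ltW c0)// mulr_ge0 ?expR_ge0.
have mA_ A c d : measurable A -> measurable_fun [set: E] d -> measurable_fun [set: E] (A_ A
    c d).
  move=> mA md; apply/measurable_EFinP; apply: measurable_funM => //.
  by have /measurable_EFinP := mF A c mA.
have A_0 A c d : 0 < c -> (forall x, 0 <= d x <= C) -> forall x, (0 <= A_ A c d x)%E.
  by move=> c0 dC x; have /andP[? ?] := dC x; rewrite lee_fin mulr_ge0//; have := F0 A c c0 x.
have intF (A : set E) : measurable A -> (0 < mu A)%E ->
    (\int[lebesgue_rV R n]_x F A (fine (mu A)) x = 1)%E.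
  move=> mA A0; have muA := finite_measure_fine mu mA.
  have A0' : 0 < fine (mu A) by rewrite -lte_fin -muA.
  rewrite integral_indic_density; under eq_integral do rewrite EFinM.
  rewrite ge0_integralZl_EFin//.
  - by rewrite -muE// [X in (_ * X)%E]muA -EFinM mulVf// gt_eqF.
  - by apply: measurable_funTS; exact/measurable_EFinP.
  - by rewrite invr_ge0 ltW.
have intA (A : set E) c (d : E -> R) : 0 < c -> measurable A -> measurable_fun [set: E] d ->
   (forall x, 0 <= d x <= C) ->
    (\int[lebesgue_rV R n]_x A_ A c d x = (c^-1)%:E * \int[lebesgue_rV R n]_(x in A) (d x *
        expR (- V x))%:E)%E.
  move=> c0 mA md dC; rewrite -integral_indic_density -ge0_integralZl_EFin//.
  - by apply: eq_integral => x _; rewrite /A_ mulrCA EFinM.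
  - by move=> x _; have /andP[? ?] := dC x; rewrite lee_fin mulr_ge0// mulr_ge0// expR_ge0.
  - apply/measurable_EFinP; apply: measurable_funM => //.
    by apply: measurable_funM => //; exact: measurable_indic.
  - by rewrite invr_ge0 ltW.
rewrite -!intA// (muE mM).
rewrite [leRHS](_ : _ = \int[lebesgue_rV R n]_x (expR (- V x) * \1_M x)%:E)%E; last first.
  rewrite [LHS]integral_mkcond; apply: eq_integral => x _.
  by rewrite patchE indicE; case: ifPn; rewrite ?mulr1// !mulr0.
apply: (@transport_rV _ n l C (F K k) (F L m)) => //; do ?[exact: mF|exact: F0|exact:
    intF|exact: mA_|exact: A_0].
- apply/measurable_EFinP; apply: measurable_funM => //; exact: measurable_indic.
- move=> x; rewrite -EFinM lee_fin ler_wpM2r//; last by have /andP[] := aC x.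
  by have := F0 K k k0 x.
- move=> x; rewrite -EFinM lee_fin ler_wpM2r//; last by have /andP[] := bC x.
  by have := F0 L m m0 x.
move=> x y s sn s0 [Fx] [Gy].
have Kx : K x.
  apply: contrapT => Kx; have : 0 < \prod_(q <- s) q.1 by exact: prodr_pair_gt0.
  by rewrite -Fx indicE memNset// !mulr0 ltxx.
have Ly : L y.
  apply: contrapT => Ly; have : 0 < \prod_(q <- s) q.2 by exact: prodr_pair_gt0.
  by rewrite -Gy indicE memNset// !mulr0 ltxx.
have Mz : M (l *: x + (1 - l) *: y) by exact: KLM.
move: Fx Gy; rewrite /A_ !indicE (mem_set Kx) (mem_set Ly) (mem_set Mz)/=.
rewrite !(mulr1n, mulr1) => Fx Gy; rewrite mulrC in Fx; rewrite mulrC in Gy.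
have := H x y s Kx Ly sn s0 (esym Fx) (esym Gy).
rewrite -!EFinM -EFinD lee_fin.
by rewrite -Fx -Gy mulrDl !mulrA; congr (_ <= _); ring.
Qed.

End homogeneous_measure.

Lemma integral_expR_tail (R : realType) (b c : R) : 0 < b ->
  (\int[lebesgue_measure]_(t in `[c, +oo[) (expR (- (b * t)))%:E =
   (expR (- (b * c)) / b)%:E)%E.
Proof.
move=> b0.
have cont : continuous (fun t : R => expR (- (b * t))).
  move=> z; apply: (@continuous_comp _ _ _ (fun t : R => - (b * t)) expR).
    by apply: cvgN; apply: cvgM; [exact: cvg_cst|exact: cvg_id].
  exact: continuous_expR.
pose F (t : R) := - (b^-1 * expR (- (b * t))).
have dF (x : R) : is_derive x 1 F (expR (- (b * x))).
  rewrite /F; apply: is_derive_eq.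
  rewrite /GRing.scale/= mulr1 ?mulr0 ?addr0 ?add0r.
  by field; rewrite gt_eqF.
rewrite (@ge0_continuous_FTC2y _ (fun t => expR (- (b * t))) F c 0) //.
- by rewrite /F -EFinB sub0r opprK mulrC.
- exact: continuous_subspaceT.
- rewrite /F -oppr0; apply: cvgN; rewrite -(mulr0 b^-1); apply: cvgM; first exact: cvg_cst.
  apply: (@cvg_comp _ _ _ (fun x : R => b * x) (fun z => expR (- z)) _ (pinfty_nbhs R)).
    exact: gt0_cvgMry.
  exact: cvgr_expR.
- apply: cvg_at_right_filter; apply: cvgN; apply: cvgM; first exact: cvg_cst.
  exact: cont.
- by move=> x _; rewrite derive1E; apply: derive_val.
Qed.

Section star_shaped.
Context {R : realType} {n : nat} (p : R) (V : 'rV[R]_n -> R).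
Local Notation E := (borel_rV R n).
Local Notation leb := (@lebesgue_measure R).
Local Notation T := (measurableTypeR R).
Variable mu : {finite_measure set E -> \bar R}.
Hypothesis p1 : 1 < p.
Hypothesis n0 : (0 < n)%N.
Hypothesis V0 : forall x, 0 <= V x.
Hypothesis homV : homogeneous p V.
Hypothesis mV : measurable_fun [set: E] (V : E -> R).
Hypothesis muE : forall A : set E, measurable A ->
    mu A = (\int[lebesgue_rV R n]_(x in A) (expR (- V x))%:E)%E.

Let c : R := (p - 1) * n%:R / p.
Let p0 : 0 < p. Proof. exact: lt_trans p1. Qed.
Let nR0 : 0 < n%:R :> R. Proof. by rewrite ltr0n. Qed.
Let c0 : 0 < c. Proof. by rewrite divr_gt0// mulr_gt0// subr_gt0. Qed.

Let K_scale (K : set E) (t : R) : measurable K ->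
  (forall x (s : R), K x -> 0 <= s <= 1 -> K (s *: x)) -> c <= t ->
  (((t / c) `^ (- (n%:R / p)))%:E * mu K <=
   \int[lebesgue_rV R n]_x (expR (- (t / c * V x)) * \1_K x)%:E)%E.
Proof.
move=> mK Kstar ct.
have tc1 : 1 <= t / c by rewrite ler_pdivlMr// mul1r.
(* V (k x) = (t / c) V x *)
pose k := (t / c) `^ p^-1.
have k1 : 1 <= k.
  by rewrite /k -[leLHS](powRr0 (t / c)) ler_powR// invr_ge0 ltW.
have k0 : 0 < k by exact: lt_le_trans k1.
have kV x : V (k *: x) = t / c * V x.
  by rewrite homV// -powRrM mulVf ?gt_eqF// powRr1// (le_trans _ tc1).
pose f (x : E) : \bar R := (expR (- V x) * \1_K x)%:E.
have mf : measurable_fun [set: E] f.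
  apply/measurable_EFinP; apply: measurable_funM.
    by apply: measurableT_comp => //; exact: measurableT_comp.
  exact: measurable_indic.
have mk : measurable_fun [set: E] (fun x : E => k *: x : E).
  apply: (@measurability _ _ _ E _ _ (@open 'rV[R]_n)) => [//|_ [U oU <-]].
  rewrite setTI; apply: sub_sigma_algebra.
  by apply: open_comp => // x _; exact: scaler_continuous.
have f0 x : (0 <= f x)%E by rewrite lee_fin mulr_ge0 ?expR_ge0.
have muK : (mu K = \int[lebesgue_rV R n]_x f x)%E.
  rewrite muE// [LHS]integral_mkcond; apply: eq_integral => x _.
  by rewrite patchE /f indicE; case: ifPn; rewrite ?mulr1// !mulr0.
have kn : (t / c) `^ (- (n%:R / p)) = k^-1 ^+ n.
  rewrite -powR_mulrn ?invr_ge0 ?(ltW k0)// -[k^-1]powR_inv1 ?(ltW k0)// /k -!powRrM.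
  by congr (_ `^ _); rewrite mulN1r mulrN mulrC.
rewrite kn muK.
apply: le_trans (ge0_le_integral_scale_rV k0 mf f0 _) _.
  exact: (measurableT_comp mf mk).
apply: ge0_le_integral => //.
- exact: (measurableT_comp mf mk).
- apply/measurable_EFinP; apply: measurable_funM; last exact: measurable_indic.
  apply: measurableT_comp => //; apply: measurableT_comp => //.
  exact: measurable_funM.
- move=> x _; rewrite /f lee_fin kV ler_wpM2l ?expR_ge0// !indicE ler_nat.
  case: (boolP (_ \in K)) => [|_ //]; rewrite inE => Kkx.
  rewrite mem_set//.
  have -> : x = k^-1 *: (k *: x) by rewrite scalerA mulVf ?gt_eqF// scale1r.
  by apply: Kstar => //; rewrite invr_ge0 (ltW k0)/= invf_le1.
Qed.

(** Dilations by a factor at least 1 enlarge a star-shaped set, so replacing V by a larger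
    multiple of itself costs at most the power of the factor that it costs on the whole
    space, where there is equality. *)
Lemma star_shaped_bound (K : set E) : measurable K ->
  (forall x (s : R), K x -> 0 <= s <= 1 -> K (s *: x)) ->
  ((bm_exponent n p)%:E * mu K <=
   \int[lebesgue_rV R n]_(x in K) ((n%:R + p / (p - 1) * V x)^-1 * expR (- V x))%:E)%E.
Proof.
move=> mK Kstar.
pose f (z : E * T) : \bar R := (n%:R^-1 * expR c * expR (- ((1 + V z.1 / c) * z.2)) *
   \1_K z.1 * \1_(`[c, +oo[%classic : set T) z.2)%:E.
have f0 z : (0 <= f z)%E by rewrite lee_fin !mulr_ge0 ?expR_ge0// invr_ge0.
have mI : measurable (`[c, +oo[%classic : set T) by exact: measurable_itv.
have mf : measurable_fun [set: E * T] f.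
  have m1 : measurable_fun [set: E * T] (fun z : E * T => V z.1 : R).
    by apply: (measurableT_comp mV); exact: measurable_fst.
  have m2 : measurable_fun [set: E * T] (fun z : E * T => z.2 : R).
    exact: measurable_snd.
  apply/measurable_EFinP; apply: measurable_funM; last first.
    have mi : measurable_fun [set: T] (\1_(`[c, +oo[%classic : set T) : T -> R) by exact:
        measurable_indic.
    by apply: (measurableT_comp mi); exact: measurable_snd.
  apply: measurable_funM; last first.
    have mi : measurable_fun [set: E] (\1_K : E -> R) by exact: measurable_indic.
    by apply: (measurableT_comp mi); exact: measurable_fst.
  apply: measurable_funM => //; apply: measurableT_comp => //; apply: measurableT_comp => //.
  apply: measurable_funM => //; apply: measurable_funD => //; exact: measurable_funM.
have inner x : (\int[leb]_t f (x, t) = ((n%:R + p / (p - 1) * V x)^-1 * (expR (- V x) *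
    \1_K x))%:E)%E.
  have b0 : 0 < 1 + V x / c by rewrite ltr_pwDl// divr_ge0// ltW.
  transitivity (\int[leb]_(t in `[c, +oo[) ((n%:R^-1 * expR c * \1_K x)%:E * (expR (- ((1 +
      V x / c) * t)))%:E))%E.
    rewrite [RHS]integral_mkcond; apply: eq_integral => t _.
    rewrite patchE /f/= [X in _ * X]indicE; case: ifPn => _; rewrite ?mulr0// mulr1.
    by rewrite -EFinM mulrAC.
  rewrite ge0_integralZl_EFin//; last first.
    apply/measurable_EFinP; apply: measurable_funTS; apply: measurableT_comp => //.
    by apply: measurableT_comp => //; exact: measurable_funM.
  rewrite integral_expR_tail// -EFinM; congr (_%:E).
  have -> : expR (- ((1 + V x / c) * c)) = expR (- c) * expR (- V x).
    by rewrite -expRD; congr expR; field; rewrite gt_eqF.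
  have -> : n%:R + p / (p - 1) * V x = n%:R * (1 + V x / c).
    by rewrite /c; field; rewrite !gt_eqF// subr_gt0.
  rewrite expRN; move: (expR_gt0 c) b0.
  move: (expR c) (1 + V x / c) (\1_K x) (expR (- V x)) => e b i w e0 b0.
  by field; rewrite !gt_eqF.
rewrite -integral_indic_density -(eq_integral _ _ (fun x _ => inner x)).
rewrite fubini_tonelli_rV//.
have muK := finite_measure_fine mu mK.
have A0 : 0 <= n%:R^-1 * expR c * c `^ (n%:R / p) * fine (mu K).
  by rewrite !mulr_ge0 ?powR_ge0 ?expR_ge0 ?invr_ge0 ?fine_ge0.
have mpow a : measurable_fun [set: T] (fun t : T => t `^ a * expR (- t) : R).
  apply: measurable_funM; first exact: measurable_powR.
  by apply: measurableT_comp => //; exact: measurableT_comp.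
apply: (@le_trans _ _ (\int[leb]_(t in `[c, +oo[)
  ((n%:R^-1 * expR c * c `^ (n%:R / p) * fine (mu K))%:E *
   (t `^ (1 - n%:R / p - 1) * expR (- t))%:E))%E).
  rewrite ge0_integralZl_EFin//; last 2 first.
  - by move=> t _; rewrite lee_fin mulr_ge0 ?powR_ge0 ?expR_ge0.
  - by apply/measurable_EFinP; exact: measurable_funTS.
  rewrite muK /bm_exponent -/c /upper_gamma -EFinM mulrAC EFinM.
  rewrite lee_wpmul2l// fine_ge0_le// integral_ge0// => t _.
  by rewrite lee_fin mulr_ge0 ?powR_ge0 ?expR_ge0.
rewrite [leLHS]integral_mkcond; apply: ge0_le_integral => //.
- move=> t _; rewrite patchE; case: ifPn => // _.
  by rewrite mule_ge0// lee_fin mulr_ge0 ?powR_ge0 ?expR_ge0.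
- apply/(measurable_restrictT _ mI)/measurable_funTS; apply: emeasurable_funM => //.
  exact/measurable_EFinP.
- exact: measurable_fun_fubini_tonelli_rV.
move=> t _; rewrite patchE; case: ifPn; last by move=> _; exact: integral_ge0.
rewrite inE/= in_itv/= andbT => ct.
have t0 : 0 < t by exact: lt_le_trans ct.
apply: (@le_trans _ _ ((n%:R^-1 * expR c * expR (- t))%:E *
  (((t / c) `^ (- (n%:R / p)))%:E * mu K))%E).
  rewrite muK -!EFinM lee_fin le_eqVlt; apply/orP; left; apply/eqP.
  rewrite powRM ?invr_ge0 ?(ltW t0) ?(ltW c0)//.
  rewrite -[c^-1]powR_inv1 ?(ltW c0)// -powRrM mulN1r opprK.
  rewrite (_ : 1 - _ - 1 = - (n%:R / p)); last by ring.
  by ring.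
apply: (le_trans (lee_wpmul2l _ (K_scale mK Kstar ct))).
  by rewrite lee_fin !mulr_ge0 ?expR_ge0// invr_ge0.
have mK2 : measurable_fun [set: E] (fun x : E => expR (- (t / c * V x)) * \1_K x : R).
  apply: measurable_funM; last exact: measurable_indic.
  by apply: measurableT_comp => //; apply: measurableT_comp => //; exact: measurable_funM.
rewrite -ge0_integralZl_EFin//; last exact/measurable_EFinP.
rewrite le_eqVlt; apply/orP; left; apply/eqP; apply: eq_integral => x _.
rewrite /f/= -EFinM [X in _ = (_ * X)%:E]indicE mem_set/=; last by rewrite in_itv/= ct.
rewrite mulr1n mulr1 mulrA -!(mulrA (n%:R^-1 * expR c)) -expRD.
by congr (_ * (expR _ * _))%:E; ring.
Qed.

End star_shaped.

Section measure_inequalities.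
Context {R : realType} {n : nat} (p : R) (V : 'rV[R]_n -> R).
Local Notation E := (borel_rV R n).
Variable mu : {finite_measure set E -> \bar R}.
Hypothesis V0 : forall x, 0 <= V x.
Hypothesis cV : forall t x y, 0 <= t <= 1 ->
  V (t *: x + (1 - t) *: y) <= t * V x + (1 - t) * V y.
Hypothesis mV : measurable_fun [set: E] (V : E -> R).
Hypothesis muE : forall A : set E, measurable A ->
    mu A = (\int[lebesgue_rV R n]_(x in A) (expR (- V x))%:E)%E.

Let fmu_gt0 (K : set E) : measurable K -> (0 < mu K)%E -> 0 < fine (mu K).
Proof. by move=> mK K0; rewrite -lte_fin -finite_measure_fine. Qed.

Let measurable_expV : measurable_fun [set: E] (fun x : E => expR (- V x) : R).
Proof. by apply: measurableT_comp => //; apply: measurableT_comp. Qed.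

(** The Prekopa-Leindler inequality for the weight, from the transport inequality with
    constant a and b. *)
Lemma log_concave_measure (l : R) (K L M : set E) : 0 < l < 1 ->
  measurable K -> measurable L -> measurable M -> (0 < mu K)%E -> (0 < mu L)%E ->
  (forall x y, K x -> L y -> M (l *: x + (1 - l) *: y)) ->
  fine (mu K) `^ l * fine (mu L) `^ (1 - l) <= fine (mu M).
Proof.
move=> l01 mK mL mM K0 L0 KLM; have /andP[l0 l1] := l01.
set k := fine (mu K); set m := fine (mu L).
have k0 : 0 < k by exact: fmu_gt0.
have m0 : 0 < m by exact: fmu_gt0.
(* a = b = S / 2: the transport inequality then reads S <= mu M *)
pose S := k `^ l * m `^ (1 - l).
have S0 : 0 <= S / 2 by rewrite divr_ge0// mulr_ge0 ?powR_ge0.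
have intS (A : set E) : measurable A -> (0 < mu A)%E ->
    (((fine (mu A))^-1)%:E * \int[lebesgue_rV R n]_(x in A) (S / 2 * expR (- V x))%:E = (S
        / 2)%:E)%E.
  move=> mA A0; under eq_integral do rewrite EFinM.
  rewrite ge0_integralZl_EFin//; last first.
    by apply: measurable_funTS; exact/measurable_EFinP.
  rewrite -muE// [X in (_ * (_ * X))%E](finite_measure_fine mu mA) -!EFinM mulrCA mulVf
      ?mulr1// gt_eqF//.
  exact: fmu_gt0.
have := @transport_measure R n V mu mV muE l (S / 2) K L M (fun=> S / 2) (fun=> S / 2)
  l01 mK mL mM K0 L0 KLM.
rewrite !intS// (finite_measure_fine mu mM) -EFinD lee_fin -/S.
have -> : S / 2 + S / 2 = S by field.
apply => //; [by move=> _; rewrite S0 lexx|by move=> _; rewrite S0 lexx|].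
move=> x y s Kx Ly sn s0 P1 P2.
have l01' : 0 <= l <= 1 by rewrite !ltW.
apply: (@le_trans _ _ (expR (- V (l *: x + (1 - l) *: y)) *
   ((\prod_(q <- s) q.2) `^ l * (\prod_(q <- s) q.1) `^ (1 - l)))); last first.
  by rewrite ler_wpM2l ?expR_ge0//; exact: prod_amgm.
have P1' : 0 < \prod_(q <- s) q.1 by exact: prodr_pair_gt0.
have P2' : 0 < \prod_(q <- s) q.2 by exact: prodr_pair_gt0.
have split_pow (a : R) : 0 < a -> a = a `^ l * a `^ (1 - l).
  by move=> a0; rewrite -powRD ?(gt_eqF a0) ?implybT// addrC subrK powRr1// ltW.
rewrite [X in S * (X * _)]split_pow// [X in S * (_ * X)]split_pow//.
rewrite (_ : S * _ = S * ((\prod_(q <- s) q.1) `^ l * (\prod_(q <- s) q.2) `^ (1 - l)) *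
   ((\prod_(q <- s) q.2) `^ l * (\prod_(q <- s) q.1) `^ (1 - l))); last by ring.
apply: ler_wpM2r; first by rewrite mulr_ge0 ?powR_ge0.
rewrite P1 P2 -/k -/m !powRM ?expR_ge0 ?invr_ge0 ?(ltW k0) ?(ltW m0)//.
have -> : k^-1 `^ l = (k `^ l)^-1.
  by rewrite -[k^-1]powR_inv1 ?(ltW k0)// -powRrM mulN1r powRN.
have -> : m^-1 `^ (1 - l) = (m `^ (1 - l))^-1.
  by rewrite -[m^-1]powR_inv1 ?(ltW m0)// -powRrM mulN1r powRN.
rewrite -!expRM /S.
rewrite (_ : _ * _ = expR (- V x * l) * expR (- V y * (1 - l))); last first.
  by field; rewrite !gt_eqF// powR_gt0.
rewrite -expRD ler_expR.
have := cV x y l01'; lra.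
Qed.

Hypothesis p1 : 1 < p.
Hypothesis n0 : (0 < n)%N.
Hypothesis homV : homogeneous p V.
Let nR0 : 0 < n%:R :> R. Proof. by rewrite ltr0n. Qed.

(** The functions a and b of [transport_measure] are the two halves of the left-hand side
    of [pointwise_midpoint], up to a constant factor; their integrals are bounded below by
    [star_shaped_bound]. *)
Lemma midpoint_measure (e : R) : 0 < e ->
  exists2 rho0 : R, 0 < rho0 & forall (K L M : set E),
  measurable K -> measurable L -> measurable M -> (0 < mu K)%E -> (0 < mu L)%E ->
  (forall x y, K x -> L y -> M (2^-1 *: x + (1 - 2^-1) *: y)) ->
  (forall x (s : R), K x -> 0 <= s <= 1 -> K (s *: x)) ->
  (forall x (s : R), L x -> 0 <= s <= 1 -> L (s *: x)) ->
  forall rho, rho = ln (fine (mu L)) - ln (fine (mu K)) -> `|rho| <= rho0 ->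
  Num.sqrt (fine (mu K) * fine (mu L)) * (1 + (bm_exponent n p / 8 - e) * rho ^+ 2) <=
  fine (mu M).
Proof.
move=> e0.
have [r r0 Hr] := pointwise_midpoint p1 n0 V0 homV cV e0.
exists (Num.min r (Num.min 1 e^-1)); first by rewrite !lt_min r0 ltr01 invr_gt0.
move=> K L M mK mL mM K0 L0 KLM Kstar Lstar rho rhoE; rewrite !le_min => /and3P[rr r1 re].
set k := fine (mu K); set m := fine (mu L).
have k0 : 0 < k by exact: fmu_gt0.
have m0 : 0 < m by exact: fmu_gt0.
pose S := Num.sqrt (k * m).
have S0 : 0 < S by rewrite sqrtr_gt0 mulr_gt0.
have er1 : e * rho ^+ 2 <= 1.
  rewrite -[rho ^+ 2]real_normK ?num_real//.
  have : e * `|rho| <= 1 by rewrite mulrC -ler_pdivlMr// mul1r.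
  have := normr_ge0 rho; nra.
pose q := p / (p - 1).
have q0 : 0 < q by rewrite divr_gt0 ?subr_gt0// (lt_trans _ p1).
pose N (x : E) := n%:R + q * V x.
have N0 x : 0 < N x by rewrite ltr_pwDl// mulr_ge0// ltW.
have mN : measurable_fun [set: E] (fun x : E => (N x)^-1 : R).
  apply: measurable_fun_invr; first by move=> x; exact: ltW.
  by apply: measurable_funD => //; exact: measurable_funM.
pose a (x : E) := S * ((1 - e * rho ^+ 2) / 2) + S * (rho ^+ 2 / 16) * (N x)^-1.
have ma : measurable_fun [set: E] a.
  by apply: measurable_funD => //; exact: measurable_funM.
have c1 : 0 <= S * ((1 - e * rho ^+ 2) / 2).
  by rewrite mulr_ge0 ?(ltW S0)// divr_ge0// subr_ge0.
have c2 : 0 <= S * (rho ^+ 2 / 16).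
  by rewrite mulr_ge0 ?(ltW S0)// divr_ge0// sqr_ge0.
pose C := S * ((1 - e * rho ^+ 2) / 2) + S * (rho ^+ 2 / 16) * n%:R^-1.
have aC x : 0 <= a x <= C.
  rewrite /a addr_ge0//=; last by rewrite mulr_ge0// invr_ge0 ltW.
  by rewrite lerD2l ler_wpM2l// lef_pV2 ?posrE// lerDl mulr_ge0 ?(ltW q0).
have inta (A : set E) : measurable A -> (0 < mu A)%E ->
    (forall x (s : R), A x -> 0 <= s <= 1 -> A (s *: x)) ->
    ((S * ((1 - e * rho ^+ 2) / 2) + S * (rho ^+ 2 / 16) * bm_exponent n p)%:E <=
     ((fine (mu A))^-1)%:E * \int[lebesgue_rV R n]_(x in A) (a x * expR (- V x))%:E)%E.
  move=> mA A0 Astar; have A0' := fmu_gt0 mA A0.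
  rewrite -[leLHS]mul1e -[X in (X * _)%E](_ : (((fine (mu A))^-1)%:E * mu A)%E = _); last first.
    by rewrite [X in (_ * X)%E](finite_measure_fine mu mA) -EFinM mulVf// gt_eqF.
  rewrite -muleA; apply: lee_wpmul2l; first by rewrite lee_fin invr_ge0 ltW.
  have -> : (\int[lebesgue_rV R n]_(x in A) (a x * expR (- V x))%:E = \int[lebesgue_rV R
      n]_(x in A)
     ((S * ((1 - e * rho ^+ 2) / 2))%:E * (expR (- V x))%:E + (S * (rho ^+ 2 / 16))%:E *
         ((N x)^-1 * expR (- V x))%:E))%E.
    by apply: eq_integral => x _; rewrite -!EFinM -EFinD /a; congr (_%:E); ring.
  have mNV : measurable_fun A (fun x : E => ((N x)^-1 * expR (- V x))%:E).
    by apply: measurable_funTS; apply/measurable_EFinP; exact: measurable_funM.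
  have mV' : measurable_fun A (fun x : E => (expR (- V x))%:E).
    by apply: measurable_funTS; exact/measurable_EFinP.
  have NV0 x : (0 <= ((N x)^-1 * expR (- V x))%:E)%E.
    by rewrite lee_fin mulr_ge0 ?expR_ge0// invr_ge0 ltW.
  rewrite ge0_integralD//; last 4 first.
  - by move=> x _; rewrite -EFinM lee_fin mulr_ge0 ?expR_ge0.
  - exact: emeasurable_funM.
  - by move=> x _; rewrite mule_ge0.
  - exact: emeasurable_funM.
  rewrite !ge0_integralZl_EFin// -muE//.
  rewrite muleC EFinD ge0_muleDl ?lee_fin//; last first.
    rewrite mulr_ge0// /bm_exponent !mulr_ge0 ?expR_ge0 ?powR_ge0 ?invr_ge0//.
    apply: fine_ge0; apply: integral_ge0 => t _.
    by rewrite lee_fin mulr_ge0 ?powR_ge0 ?expR_ge0.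
  apply: leeD => //; rewrite EFinM -muleA; apply: lee_wpmul2l; first by rewrite lee_fin.
  exact: (star_shaped_bound p1 n0 V0 homV mV muE mA Astar).
have := @transport_measure R n V mu mV muE 2^-1 C K L M a a _ mK mL mM K0 L0 KLM ma aC ma aC.
rewrite (finite_measure_fine mu mM) => H.
rewrite -lee_fin; apply: (le_trans _ (H _ _)) => {H}.
- apply: le_trans (leeD (inta _ mK K0 Kstar) (inta _ mL L0 Lstar)).
  by rewrite -EFinD lee_fin le_eqVlt; apply/orP; left; apply/eqP; rewrite -/S; field.
- by apply/andP; split; lra.
move=> x y s Kx Ly sn s0 P1 P2.
have P1' : 0 < \prod_(q <- s) q.1 by exact: prodr_pair_gt0.
have P2' : 0 < \prod_(q <- s) q.2 by exact: prodr_pair_gt0.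
apply: le_trans (ler_wpM2l (expR_ge0 _) (prod_half_ge s0)).
rewrite sn; set X := ln _ - ln _.
have XE : X ^+ 2 = (rho + (V y - V x)) ^+ 2.
  rewrite /X P1 P2 rhoE -/k -/m !ln_div ?posrE ?expR_gt0// !expRK; ring.
rewrite XE.
have T2 : \prod_(q <- s) q.1 * \prod_(q <- s) q.2 = Num.sqrt (\prod_(q <- s) q.1 * \prod_(q
    <- s) q.2) ^+ 2.
  by rewrite sqr_sqrtr// mulr_ge0// ltW.
have TE : Num.sqrt (\prod_(q <- s) q.1 * \prod_(q <- s) q.2) * S = expR (- ((V x + V y) / 2)).
  rewrite P1 P2 -/k -/m /S -sqrtrM; last by rewrite mulr_ge0// divr_ge0 ?expR_ge0// ltW.
  rewrite (_ : _ * (k * m) = expR (- ((V x + V y) / 2)) ^+ 2).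
    by rewrite sqrtr_sqr ger0_norm ?expR_ge0.
  rewrite (_ : _ * (k * m) = expR (- V x) * expR (- V y)); last by field; rewrite !gt_eqF.
  by rewrite -expRD -expRM_natl; congr expR; field.
rewrite [X in _ * X <= _]T2; set T := Num.sqrt _ in TE *.
have T0 : 0 <= T by exact: sqrtr_ge0.
have hxy := Hr rho x y rr; rewrite -/q -/(N x) -/(N y) in hxy.
rewrite (_ : (a x + a y) * T ^+ 2 = (T * S) * T *
  (1 + rho ^+ 2 / 16 * ((N x)^-1 + (N y)^-1) - e * rho ^+ 2)); last first.
  have id2 (S' T' u v : R) : (S' * ((1 - e * rho ^+ 2) / 2) + S' * (rho ^+ 2 / 16) * u +
      (S' * ((1 - e * rho ^+ 2) / 2) + S' * (rho ^+ 2 / 16) * v)) * T' ^+ 2 =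
      T' * S' * T' * (1 + rho ^+ 2 / 16 * (u + v) - e * rho ^+ 2) by field.
  exact: id2.
apply: (le_trans (ler_wpM2l _ hxy)); first by rewrite TE mulr_ge0 ?expR_ge0.
rewrite TE expRD expRN le_eqVlt; apply/orP; left; apply/eqP.
have id3 (E' T' w f : R) : 0 < E' -> E'^-1 * T' * (E' * w * f) = w * (T' * f).
  by move=> E0; field; rewrite gt_eqF.
exact/id3/expR_gt0.
Qed.

End measure_inequalities.

(** * The exponent near p = 1 *)

Section exponent_limit.
Context {R : realType}.
Local Notation T := (measurableTypeR R).
Local Notation leb := (@lebesgue_measure R).

(** Since a >= 1 and t >= c, the integrand c^a t^(-a) is at most c / t. This is at most 1
    for t below sqrt c and at most sqrt c beyond. *)
Lemma upper_gamma_le (a c : R) : 1 <= a -> 0 < c ->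
  c `^ a * upper_gamma (1 - a) c <= 2 * Num.sqrt c.
Proof.
move=> a1 c0.
(* the integral is split at e, so that both pieces are at most e *)
set e := Num.sqrt c.
have e0 : 0 < e by rewrite sqrtr_gt0.
have ec : c / e = e by rewrite -[c]sqr_sqrtr ?(ltW c0)// -/e expr2 mulfK// gt_eqF.
rewrite -lee_fin EFinM.
set I := (\int[leb]_(t in `[c, +oo[) (t `^ (1 - a - 1) * expR (- t))%:E)%E.
have mpow : measurable_fun [set: T] (fun t : T => t `^ (1 - a - 1) * expR (- t) : R).
  apply: measurable_funM; first exact: measurable_powR.
  by apply: measurableT_comp => //; exact: measurableT_comp.
have pow0 (t : T) : 0 <= t `^ (1 - a - 1) * expR (- t).
  by rewrite mulr_ge0 ?powR_ge0 ?expR_ge0.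
have I0 : (0 <= I)%E by apply: integral_ge0 => t _; rewrite lee_fin.
apply: (@le_trans _ _ ((c `^ a)%:E * I)%E).
  by rewrite lee_wpmul2l ?lee_fin ?powR_ge0//; exact: fine_ge0_le.
have mexp : measurable_fun [set: T] (fun t : T => expR (- (1 * t)) : R).
  by apply: measurableT_comp => //; apply: measurableT_comp => //; exact: measurable_funM.
have mC : measurable (`[c, c + e]%classic : set T) by exact: measurable_itv.
have mCy : measurable (`[c, +oo[%classic : set T) by exact: measurable_itv.
rewrite -ge0_integralZl_EFin ?powR_ge0//; last 2 first.
- by move=> t _; rewrite lee_fin.
- by apply: measurable_funTS; exact/measurable_EFinP.
apply: (@le_trans _ _ (\int[leb]_(t in `[c, +oo[)
  ((\1_(`[c, c + e]%classic : set T) t)%:E + e%:E * (expR (- (1 * t)))%:E))%E).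
  apply: ge0_le_integral => //.
  - by move=> t _; rewrite -EFinM lee_fin mulr_ge0 ?powR_ge0.
  - by apply: measurable_funTS; apply: emeasurable_funM => //; exact/measurable_EFinP.
  - apply: measurable_funTS; apply: emeasurable_funD.
      exact/measurable_EFinP/measurable_indic.
    by apply: emeasurable_funM => //; exact/measurable_EFinP.
  move=> t; rewrite /= in_itv/= andbT => ct.
  have t0 : 0 < t by exact: lt_le_trans ct.
  rewrite -!EFinM -EFinD lee_fin mul1r mulrA.
  have -> : c `^ a * t `^ (1 - a - 1) = (c / t) `^ a.
    rewrite powRM ?invr_ge0 ?(ltW c0) ?(ltW t0)// -[t^-1]powR_inv1 ?(ltW t0)// -powRrM.
    by congr (_ * _ `^ _); ring.
  have ct01 : 0 < c / t <= 1 by rewrite divr_gt0//= ler_pdivrMr// mul1r.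
  have et1 : expR (- t) <= 1 by rewrite expR_le1 oppr_le0 ltW.
  have h1 : (c / t) `^ a <= c / t by exact: ge1r_powR.
  have /andP[h2 h3] := ct01.
  have h4 : 0 <= (c / t) `^ a by exact: powR_ge0.
  have h5 := expR_ge0 (- t).
  have [te|te] := leP t e.
    rewrite indicE mem_set/=; last by rewrite in_itv/= ct/=; lra.
    rewrite mulr1n; have : 0 <= e * expR (- t) by rewrite mulr_ge0// ltW.
    nra.
  apply: (@le_trans _ _ (e * expR (- t))); last by rewrite lerDr.
  rewrite ler_wpM2r//; apply: (le_trans h1).
  rewrite -[leRHS]ec ler_pM2l// lef_pV2 ?posrE// ltW//.
rewrite ge0_integralD//; last 3 first.
- by apply/measurable_EFinP; apply: measurable_funTS; exact: measurable_indic.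
- by move=> t _; rewrite -EFinM lee_fin mulr_ge0 ?expR_ge0// ltW.
- by apply: measurable_funTS; apply: emeasurable_funM => //; exact/measurable_EFinP.
rewrite integral_indic// ge0_integralZl_EFin ?(ltW e0)//; last first.
  by apply: measurable_funTS; exact/measurable_EFinP.
rewrite integral_expR_tail// mulr_natl mulr2n EFinD; apply: leeD.
  apply: (@le_trans _ _ (leb (`[c, c + e]%classic : set T))).
    by apply: le_measure; rewrite ?inE//; exact: measurableI.
  rewrite -[leLHS]/(lebesgue_measure (`[c, c + e]%classic : set R)) lebesgue_measure_itv/=
      lte_fin ltrDl e0 -EFinD lee_fin; lra.
rewrite -EFinM lee_fin divr1 mul1r ler_piMr ?(ltW e0)// expR_le1 oppr_le0 ltW//.
Qed.

Lemma bm_exponent_ge0 n (p : R) : 0 <= bm_exponent n p.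
Proof.
rewrite /bm_exponent !mulr_ge0 ?expR_ge0 ?powR_ge0 ?invr_ge0//.
apply: fine_ge0; apply: integral_ge0 => t _.
by rewrite lee_fin mulr_ge0 ?powR_ge0 ?expR_ge0.
Qed.

Lemma bm_exponent_cvg0 n : (2 <= n)%N -> bm_exponent n q @[q --> (1 : R)^'+] --> (0 : R).
Proof.
move=> n2.
have nR2 : 2 <= n%:R :> R by rewrite (ler_nat R 2).
pose g (q : R) := expR ((q - 1) * n%:R) * (2 * Num.sqrt ((q - 1) * n%:R)).
have g0 : g q @[q --> (1:R)^'+] --> (0:R).
  have -> : (0:R) = g 1 by rewrite /g subrr mul0r sqrtr0 !mulr0.
  apply: cvg_at_right_filter.
  have lin : ((q - 1) * n%:R) @[q --> (1:R)] --> ((1 - 1) * n%:R : R).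
    by apply: cvgM; [apply: cvgB; [exact: cvg_id|exact: cvg_cst]|exact: cvg_cst].
  apply: cvgM.
    by apply: (@continuous_comp _ _ _ (fun q : R => (q - 1) * n%:R) expR) => //; exact:
        continuous_expR.
  apply: cvgM; first exact: cvg_cst.
  by apply: (@continuous_comp _ _ _ (fun q : R => (q - 1) * n%:R) Num.sqrt) => //; exact:
      sqrt_continuous.
apply: (@squeeze_cvgr _ _ _ _ (fun=> 0) g) => //; last exact: cvg_cst.
near=> q; apply/andP; split; first exact: bm_exponent_ge0.
have q1 : 1 < q by near: q; exact: nbhs_right_gt.
have q2 : q < 2 by near: q; apply: nbhs_right_lt; lra.
have q0 : 0 < q by lra.
rewrite /bm_exponent; set c := (q - 1) * n%:R / q.
have c0 : 0 < c by rewrite divr_gt0// mulr_gt0//; lra.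
have cle : c <= (q - 1) * n%:R.
  have h : 0 <= (q - 1) * n%:R by rewrite mulr_ge0//; lra.
  by rewrite /c ler_pdivrMr// ler_peMr// ltW.
have a1 : 1 <= n%:R / q by rewrite ler_pdivlMr// mul1r; lra.
apply: (@le_trans _ _ (expR c * (2 * Num.sqrt c))).
  rewrite -2!mulrA; set G := c `^ _ * _.
  have G0 : 0 <= expR c * G.
    rewrite mulr_ge0 ?expR_ge0// mulr_ge0 ?powR_ge0//.
    apply: fine_ge0; apply: integral_ge0 => t _.
    by rewrite lee_fin mulr_ge0 ?powR_ge0 ?expR_ge0.
  apply: (@le_trans _ _ (expR c * G)).
    by rewrite ler_piMl// invf_le1//; lra.
  by rewrite ler_pM2l ?expR_gt0//; exact: upper_gamma_le.
by rewrite /g; apply: ler_pM; rewrite ?expR_ge0 ?mulr_ge0 ?sqrtr_ge0 ?ler_expR// ler_pM2l//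
    ler_wsqrtr.
Unshelve. all: by end_near. Qed.

End exponent_limit.

(** * Convex bodies *)

Section convex_bodies.
Context {R : realType} {n : nat}.
Local Notation E := (borel_rV R n).

Lemma compact_measurable_rV (K : set 'rV[R]_n) : compact K -> measurable (K : set E).
Proof.
move=> cK; rewrite -[K]setCK; apply: measurableC; apply: sub_sigma_algebra.
by apply: closed_openC; apply: compact_closed => //; exact: norm_hausdorff.
Qed.

Lemma minkowski_comb_compact (l : R) (K L : set 'rV[R]_n) :
  compact K -> compact L -> compact (minkowski_comb l K L).
Proof.
move=> cK cL.
have -> : minkowski_comb l K L = (fun z : 'rV[R]_n * 'rV[R]_n => l *: z.1 + (1 - l) *: z.2)
    @` (K `*` L).
  apply/seteqP; split=> [_ [x Kx [y Ly <-]]|_ [[x y] [/= Kx Ly] <-]].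
    by exists (x, y).
  by exists x => //; exists y.
apply: continuous_compact; last exact: compact_setX.
apply: continuous_subspaceT => z; apply: cvgD.
  by apply: cvgZr; exact: cvg_fst.
by apply: cvgZr; exact: cvg_snd.
Qed.

Lemma minkowski_comb1 (K L : set 'rV[R]_n) : L !=set0 -> minkowski_comb 1 K L = K.
Proof.
move=> [y0 Ly0]; apply/seteqP; split=> [_ [x Kx [y Ly <-]]|x Kx].
  by rewrite subrr scale0r scale1r addr0.
by exists x => //; exists y0 => //; rewrite subrr scale0r scale1r addr0.
Qed.

Lemma minkowski_comb0 (K L : set 'rV[R]_n) : K !=set0 -> minkowski_comb 0 K L = L.
Proof.
move=> [x0 Kx0]; apply/seteqP; split=> [_ [x Kx [y Ly <-]]|y Ly].
  by rewrite subr0 scale0r scale1r add0r.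
by exists x0 => //; exists y => //; rewrite subr0 scale0r scale1r add0r.
Qed.

Lemma minkowski_comb_star (l : R) (K L : set 'rV[R]_n) : convex_set K -> convex_set L ->
  K 0 -> L 0 ->
  forall x (s : R), minkowski_comb l K L x -> 0 <= s <= 1 -> minkowski_comb l K L (s *: x).
Proof.
move=> cK cL K0 L0 _ s [x Kx [y Ly <-]] s01.
exists (s *: x).
  by have := convex_setE cK s01 Kx K0; rewrite scaler0 addr0.
exists (s *: y).
  by have := convex_setE cL s01 Ly L0; rewrite scaler0 addr0.
by rewrite scalerDr !scalerA ![s * _]mulrC.
Qed.

Lemma minkowski_comb_concave (K L : set 'rV[R]_n) (s v l : R) : convex_set K -> convex_set L ->
  0 <= s <= 1 -> 0 <= v <= 1 -> 0 < l < 1 -> 0 < l * s + (1 - l) * v < 1 ->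
  forall x y, minkowski_comb s K L x -> minkowski_comb v K L y ->
  minkowski_comb (l * s + (1 - l) * v) K L (l *: x + (1 - l) *: y).
Proof.
move=> cK cL /andP[s0 s1] /andP[v0 v1] /andP[l0 l1].
set u := l * s + (1 - l) * v => /andP[u0 u1] _ _ [x1 Kx1 [y1 Ly1 <-]] [x2 Kx2 [y2 Ly2 <-]].
have ls : 0 <= l * s by rewrite mulr_ge0// ltW.
have lv : 0 <= (1 - l) * v by rewrite mulr_ge0//; lra.
have ls' : 0 <= l * (1 - s) by rewrite mulr_ge0//; lra.
have lv' : 0 <= (1 - l) * (1 - v) by rewrite mulr_ge0//; lra.
have u1' : 0 < 1 - u by lra.
have u1E : 1 - u = l * (1 - s) + (1 - l) * (1 - v) by rewrite /u; ring.
have i1 : 0 <= l * s / u <= 1.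
  by rewrite divr_ge0 ?(ltW u0)//= ler_pdivrMr// mul1r lerDl.
have i2 : 0 <= l * (1 - s) / (1 - u) <= 1.
  by rewrite divr_ge0 ?(ltW u1')//= ler_pdivrMr// mul1r u1E lerDl.
exists (l * s / u *: x1 + (1 - l * s / u) *: x2); first exact: convex_setE.
exists (l * (1 - s) / (1 - u) *: y1 + (1 - l * (1 - s) / (1 - u)) *: y2); first exact:
    convex_setE.
have e1 : u * (l * s / u) = l * s by field; rewrite gt_eqF.
have e2 : u * (1 - l * s / u) = (1 - l) * v by rewrite mulrBr e1 mulr1 /u; ring.
have e3 : (1 - u) * (l * (1 - s) / (1 - u)) = l * (1 - s) by rewrite mulrC divfK// gt_eqF.
have e4 : (1 - u) * (1 - l * (1 - s) / (1 - u)) = (1 - l) * (1 - v).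
  by rewrite mulrBr e3 mulr1 u1E; ring.
rewrite !scalerDr !scalerA e1 e2 e3 e4 -!addrA; congr (_ + _).
by rewrite addrCA.
Qed.

End convex_bodies.

Section main.
Context {R : realType} {n : nat} (p : R) (V : 'rV[R]_n -> R).
Local Notation E := (borel_rV R n).
Variable mu : {finite_measure set E -> \bar R}.
Hypothesis V0 : forall x, 0 <= V x.
Hypothesis homV : homogeneous p V.
Hypothesis convV : convex_function setT V.
Hypothesis muE : forall A : set E, measurable A ->
    mu A = (\int[lebesgue_rV R n]_(x in A) (expR (- V x))%:E)%E.

Let cV := convex_functionE convV.

Lemma homogeneous_convex_measurable : measurable_fun [set: E] (V : E -> R).
Proof.
apply: (measurability (@RGenInftyO.G R)) => [|/= _ [_ [c] -> <-]].
  exact: RGenInftyO.measurableE.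
rewrite setTI; apply: sub_sigma_algebra.
rewrite [X in open X](_ : _ = [set x | V x < c]).
  exact: (homogeneous_sublevel_open V0 homV cV).
by apply/seteqP; split=> x /=; rewrite in_itv.
Qed.

Let mV := homogeneous_convex_measurable.

(** The interior contains a cube, on which V is bounded. *)
Lemma convex_body_measure_gt0 (K : set 'rV[R]_n) : convex_body K -> (0 < mu K)%E.
Proof.
move=> [cK _ [x]]; rewrite /interior /= => /nbhs_ballP[e /= e0 eK].
have mK := compact_measurable_rV cK.
have [M M0 MV] := homogeneous_bounded_ball V0 homV cV.
pose d := Num.min (e / 2) 1.
have d0 : 0 < d by rewrite lt_min divr_gt0//=.
have [de d1] : d < e /\ d <= 1.
  have : d <= e / 2 /\ d <= 1 by apply/andP; rewrite -le_min; exact: lexx.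
  by move=> [? ?]; split => //; lra.
pose B : set E := [set v : 'rV[R]_n | forall i, (`]x ord0 i - d, (x ord0 i + d)[%classic :
    set (measurableTypeR R)) (v ord0 i)].
have mI i : measurable (`]x ord0 i - d, (x ord0 i + d)[%classic : set (measurableTypeR R)).
  exact: measurable_itv.
have Bnorm v : B v -> forall i, `|v ord0 i - x ord0 i| < d.
  by move=> Bv i; have := Bv i; rewrite /= in_itv/= ltr_norml => /andP[? ?]; apply/andP;
      split; lra.
have BK : B `<=` K.
  move=> v Bv; apply: eK; split => // i j; rewrite ord1 /ball/=.
  by rewrite distrC (lt_trans (Bnorm _ Bv j)).
have mB : measurable B.
  apply: sub_sigma_algebra.
  rewrite [X in open X](_ : _ = ball x d); first exact: ball_open.
  apply/seteqP; split=> [v Bv|v [_ vx] i].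
    by split => // i j; rewrite ord1 /ball/= distrC; exact: Bnorm.
  have := vx ord0 i; rewrite /ball/= distrC ltr_norml in_itv/= => /andP[? ?].
  by apply/andP; split; lra.
have lB : lebesgue_rV R n B = ((2 * d) ^+ n)%:E.
  rewrite /B (lebesgue_rV_box mI).
  rewrite (eq_bigr (fun=> (2 * d)%:E)).
    by rewrite prodEFin prodr_const card_ord.
  move=> i _; rewrite lebesgue_measure_itv/= lte_fin ifT; last by lra.
  by rewrite -EFinD; congr (_%:E); ring.
pose C := 2 `^ p * (V x + M).
have VB v : B v -> V v <= C.
  move=> Bv; have -> : v = x + (v - x) by rewrite addrC subrK.
  apply: (le_trans (homogeneous_add_le V0 homV cV _ _)).
  rewrite ler_wpM2l ?powR_ge0// lerD2l MV// => i; rewrite !mxE.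
  by rewrite (le_trans (ltW (Bnorm _ Bv i))).
apply: (@lt_le_trans _ _ (mu B)); last by rewrite le_measure// inE.
rewrite muE//.
apply: (@lt_le_trans _ _ ((expR (- C))%:E * lebesgue_rV R n B)%E).
  by rewrite lB -EFinM lte_fin mulr_gt0 ?expR_gt0// exprn_gt0// mulr_gt0.
rewrite -integral_cst//; apply: ge0_le_integral => //.
- by move=> v _; rewrite lee_fin expR_ge0.
- apply: measurable_funTS; apply/measurable_EFinP.
  by apply: measurableT_comp => //; exact: measurableT_comp.
- by move=> v Bv; rewrite lee_fin ler_expR lerN2; exact: VB.
Qed.

Lemma brunn_minkowski0 : brunn_minkowski mu 0.
Proof.
move=> K L l bK bL K0 L0 /andP[l0 l1]; rewrite eqxx.
have [cK convK _] := bK; have [cL convL _] := bL.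
have mK := compact_measurable_rV cK; have mL := compact_measurable_rV cL.
have mM := compact_measurable_rV (@minkowski_comb_compact _ _ l _ _ cK cL).
have [->|ln0] := eqVneq l 0.
  rewrite minkowski_comb0; last by exists 0.
  by rewrite subr0 poweRe0 poweRe1 ?mul1e.
have [->|ln1] := eqVneq l 1.
  rewrite minkowski_comb1; last by exists 0.
  by rewrite subrr poweRe0 poweRe1 ?mule1.
have l01 : 0 < l < 1 by rewrite !lt_neqAle l0 l1 ln1 eq_sym ln0.
rewrite (finite_measure_fine mu mK) (finite_measure_fine mu mL)
  (finite_measure_fine mu mM) !poweR_EFin -EFinM lee_fin.
apply: (log_concave_measure cV mV muE l01 mK mL mM) => //.
- exact: convex_body_measure_gt0.
- exact: convex_body_measure_gt0.
- by move=> x y Kx Ly; exists x => //; exists y.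
Qed.

(** The sets M t = t K + (1 - t) L satisfy the hypotheses of [power_concave_of_midpoint]
    with phi t = ln (mu (M t)). *)
Lemma brunn_minkowski_lt (be : R) : (0 < n)%N -> 1 < p -> 0 < be -> be < bm_exponent n p ->
  brunn_minkowski mu be.
Proof.
move=> n0 p1' be0 beal K L l bK bL K0 L0 /andP[l0 l1]; rewrite gt_eqF//.
have [cK convK _] := bK; have [cL convL _] := bL.
pose M t := minkowski_comb t K L.
have mM t : measurable (M t : set E).
  exact: compact_measurable_rV (@minkowski_comb_compact _ _ t _ _ cK cL).
have M1 : M 1 = K by apply: minkowski_comb1; exists 0.
have M0 : M 0 = L by apply: minkowski_comb0; exists 0.
pose h t := fine (mu (M t)).
have muM t : mu (M t) = (h t)%:E by exact: finite_measure_fine.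
have M0_gt0 : (0 < mu (M 0%R))%E by rewrite M0; exact: convex_body_measure_gt0.
have M1_gt0 : (0 < mu (M 1%R))%E by rewrite M1; exact: convex_body_measure_gt0.
have Mconc s v t : 0 <= s <= 1 -> 0 <= v <= 1 -> 0 < t < 1 -> 0 < t * s + (1 - t) * v < 1 ->
    (0 < mu (M s))%E -> (0 < mu (M v))%E ->
    h s `^ t * h v `^ (1 - t) <= h (t * s + (1 - t) * v).
  move=> s01 v01 t01 u01 Ms Mv.
  apply: (log_concave_measure cV mV muE t01 (mM s) (mM v) (mM _)) => //.
  exact: minkowski_comb_concave.
have h0 t : 0 <= t <= 1 -> 0 < h t.
  move=> /andP[t0 t1].
  have [->|tn0] := eqVneq t 0; first by rewrite -lte_fin -muM.
  have [->|tn1] := eqVneq t 1; first by rewrite -lte_fin -muM.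
  have t01 : 0 < t < 1 by rewrite !lt_neqAle t0 t1 tn1 eq_sym tn0.
  have tE : t * 1 + (1 - t) * 0 = t by rewrite mulr0 mulr1 addr0.
  have := Mconc 1 0 t; rewrite tE ler01 !lexx => /(_ isT isT t01 t01 M1_gt0 M0_gt0).
  by apply: lt_le_trans; rewrite mulr_gt0// powR_gt0// -lte_fin -muM.
have Mt0 t : 0 <= t <= 1 -> (0 < mu (M t))%E by move=> /h0; rewrite -lte_fin -muM.
pose phi t := ln (h t).
have lc s v t : 0 <= s <= 1 -> 0 <= v <= 1 -> 0 < t < 1 -> 0 < t * s + (1 - t) * v < 1 ->
    t * phi s + (1 - t) * phi v <= phi (t * s + (1 - t) * v).
  move=> s01 v01 t01 u01.
  have := Mconc s v t s01 v01 t01 u01 (Mt0 _ s01) (Mt0 _ v01).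
  have /andP[u0 u1] := u01.
  rewrite -ler_ln ?posrE ?mulr_gt0 ?powR_gt0 ?h0//; last by rewrite !ltW.
  by rewrite lnM ?posrE ?powR_gt0 ?h0// !ln_powR.
have mid (e : R) : 0 < e -> exists2 rho0 : R, 0 < rho0 & forall s v : R,
     0 < s < 1 -> 0 < v < 1 -> `|phi v - phi s| <= rho0 ->
     expR ((phi s + phi v) / 2) * (1 + (bm_exponent n p / 8 - e) * (phi v - phi s) ^+ 2) <=
     expR (phi ((s + v) / 2)).
  move=> e0.
  have [rho0 rho0_gt0 H] := midpoint_measure V0 cV mV muE p1' n0 homV e0.
  exists rho0 => // s v s01 v01 Hrho.
  have /andP[s0 s1] := s01; have /andP[v0 v1] := v01.
  have s01' : 0 <= s <= 1 by rewrite !ltW.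
  have v01' : 0 <= v <= 1 by rewrite !ltW.
  have u01 : 0 < (s + v) / 2 < 1 by apply/andP; split; lra.
  have uE : 2^-1 * s + (1 - 2^-1) * v = (s + v) / 2 by field.
  have half : 0 < (2^-1 : R) < 1 by apply/andP; split; lra.
  have incl x y : M s x -> M v y -> M ((s + v) / 2) (2^-1 *: x + (1 - 2^-1) *: y).
    by rewrite -uE; apply: minkowski_comb_concave => //; rewrite uE.
  have := H (M s) (M v) (M ((s + v) / 2)) (mM _) (mM _) (mM _) (Mt0 _ s01') (Mt0 _ v01') incl
    (minkowski_comb_star convK convL K0 L0) (minkowski_comb_star convK convL K0 L0) _ erefl
        Hrho.
  have /andP[u0 u1] := u01.
  rewrite -/(h s) -/(h v) -/(h ((s + v) / 2)) -/(phi s) -/(phi v).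
  rewrite [X in _ -> _ <= X]lnK ?posrE ?h0//; last by rewrite !ltW.
  congr (_ * _ <= _).
  rewrite -powR12_sqrt ?mulr_ge0 ?ltW ?h0// /powR gt_eqF ?mulr_gt0 ?h0//.
  by rewrite lnM ?posrE ?h0// mulrC.
have hbe t : 0 <= t <= 1 -> (mu (M t) `^ be)%E = (expR (be * phi t))%:E.
  by move=> t01; rewrite muM poweR_EFin /powR gt_eqF ?h0.
have [-> ->] : mu K = mu (M 1) /\ mu L = mu (M 0) by rewrite M1 M0.
rewrite -/(M l) !hbe ?ler01 ?lexx ?l0//.
rewrite -!EFinM -EFinD lee_fin.
have [->|ln0] := eqVneq l 0; first by rewrite mul0r add0r subr0 mul1r.
have [->|ln1] := eqVneq l 1; first by rewrite subrr mul0r addr0 mul1r.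
apply: (power_concave_of_midpoint be0 beal lc mid).
by rewrite !lt_neqAle l0 l1 ln1 eq_sym ln0.
Qed.

End main.

Theorem theorem5p1 (R : realType) (n : nat) (p : R)
    (V : 'rV[R]_n -> R)
    (mu : {finite_measure set (borel_rV R n) -> \bar R})
    (alpha : R) :
  (2 <= n)%N ->
  1 <= p ->
  (forall x : 'rV[R]_n, 0 <= V x) ->
  homogeneous p V ->
  convex_function setT V ->
  (forall A : set (borel_rV R n), measurable A ->
    mu A = (\int[lebesgue_rV R n]_(x in A) (expR (- V x))%:E)%E) ->
  brunn_minkowski mu alpha ->
  (forall beta : R, brunn_minkowski mu beta -> beta <= alpha) ->
  (if p == 1 then lim (bm_exponent n q @[q --> (1 : R)^'+])
   else bm_exponent n p) <= alpha
  /\ bm_exponent n q @[q --> (1 : R)^'+] --> (0 : R).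
Proof.
move=> n2 p1 V0 homV convV muE _ alpha_max.
have cvg0 := @bm_exponent_cvg0 R n n2; split => //.
have alpha0 : 0 <= alpha.
  by apply: alpha_max; exact: (brunn_minkowski0 V0 homV convV muE).
case: eqVneq => [_|pn1]; first by rewrite (cvg_lim _ cvg0).
have p1' : 1 < p by rewrite lt_neqAle eq_sym pn1.
rewrite leNgt; apply/negP => lt_alpha.
pose beta := (alpha + bm_exponent n p) / 2.
have : beta <= alpha.
  apply: alpha_max; apply: (brunn_minkowski_lt V0 homV convV muE) => //.
  - by rewrite (ltn_trans _ n2).
  - by rewrite /beta; lra.
  - by rewrite /beta; lra.
rewrite /beta; lra.
Qed.
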